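(* Every link in $\mathbb{R}^3$ has a meander diagram.
   Context: Links are tame and have finitely many components. All link diagrams are regular, with finitely many crossings, all of them transverse double points. A meander diagram for a $k$-component link $L$ is a link diagram representing $L$ in which each component is decomposed into at most two simple (non-self-intersecting) arcs, colored black and red, such that every crossing of the diagram is between a black arc and a red arc (so no two arcs of the same color, from the same or different components, cross each other). *)

(* Defs.v *)
From HB Require Import structures.
From mathcomp Require Import all_boot all_order all_algebra.
From mathcomp Require Import all_classical all_reals all_analysis.
Import Order.TTheory GRing.Theory Num.Theory.
Import numFieldNormedType.Exports.

Set Implicit Arguments.
Unset Strict Implicit.
Unset Printing Implicit Defensive.

Local Open Scope classical_set_scope.
Local Open Scope ring_scope.

(* A closed curve is a 1-periodic function on R, i.e. a function on R / Z;
   [0, 1[ is used as a set of representatives of the circle. *)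
Definition curves (R : realType) (k d : nat) := 'I_k -> R -> 'rV[R]_d.

Definition periodic1 (R : realType) (T : Type) (f : R -> T) : Prop :=
  forall t, f (t + 1) = f t.

Definition params (R : realType) (k : nat) : set ('I_k * R) :=
  [set x | 0 <= x.2 < 1].

Definition at_param (R : realType) (k d : nat) (c : curves R k d)
  (x : 'I_k * R) : 'rV[R]_d := c x.1 x.2.

Definition trace (R : realType) (k d : nat) (c : curves R k d) :
    set 'rV[R]_d :=
  [set p | exists i t, p = c i t].

Definition affine_between (R : realType) (d : nat) (f : R -> 'rV[R]_d)
    (a b : R) : Prop :=
  exists p v : 'rV[R]_d, forall t, a <= t <= b -> f t = p + t *: v.

Definition polygonal (R : realType) (d : nat) (f : R -> 'rV[R]_d) : Prop :=
  periodic1 f /\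
  exists (n : nat) (b : nat -> R),
    [/\ b 0%N = 0, b n = 1 &
        forall m, (m < n)%N ->
          b m <= b m.+1 /\ affine_between f (b m) (b m.+1)].

Definition link_param (R : realType) (k : nat) (c : curves R k 3) : Prop :=
  [/\ forall i, continuous (c i),
      forall i, periodic1 (c i) &
      forall x y, params x -> params y ->
        at_param c x = at_param c y -> x = y].

Definition polygonal_link_param (R : realType) (k : nat)
    (c : curves R k 3) : Prop :=
  link_param c /\ forall i, polygonal (c i).

Definition homeomorphism (T : topologicalType) (f : T -> T) : Prop :=
  continuous f /\
  exists g : T -> T, [/\ continuous g, cancel f g & cancel g f].

Definition ambient_isotopic (R : realType) (A B : set 'rV[R]_3) : Prop :=
  exists H : R -> 'rV[R]_3 -> 'rV[R]_3,
    [/\ {within [set z : R * 'rV[R]_3 | 0 <= z.1 <= 1],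
           continuous (fun z => H z.1 z.2)},
        forall t : R, 0 <= t <= 1 -> homeomorphism (H t),
        forall p, H 0 p = p &
        H 1 @` A = B].

Definition is_link (R : realType) (k : nat) (L : set 'rV[R]_3) : Prop :=
  exists c : curves R k 3, link_param c /\ L = trace c.

Definition tame (R : realType) (k : nat) (L : set 'rV[R]_3) : Prop :=
  exists c : curves R k 3,
    polygonal_link_param c /\ ambient_isotopic L (trace c).

Definition tame_link (R : realType) (k : nat) (L : set 'rV[R]_3) : Prop :=
  is_link k L /\ tame k L.

(* [passes_over x y], meaningful only when x and y are the two parameters
   of a crossing, says that the strand at x passes over the strand at y. *)
Record diagram_data (R : realType) (k : nat) := DiagramData {
  shadow : curves R k 2;
  passes_over : rel ('I_k * R)
}.

Definition crossing (R : realType) (k : nat) (D : diagram_data R k)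
    (x y : 'I_k * R) : Prop :=
  [/\ params x, params y, x <> y &
      at_param (shadow D) x = at_param (shadow D) y].

(* Both strands are straight near the crossing (so a crossing is never at a
   vertex of a polygon), with linearly independent directions. *)
Definition transverse (R : realType) (k : nat) (c : curves R k 2)
    (x y : 'I_k * R) : Prop :=
  exists u v : 'rV[R]_2, row_free (col_mx u v) /\
    \forall h \near (0 : R),
      c x.1 (x.2 + h) = at_param c x + h *: u /\
      c y.1 (y.2 + h) = at_param c y + h *: v.

Definition link_diagram (R : realType) (k : nat) (D : diagram_data R k) :
    Prop :=
  [/\ forall i, polygonal (shadow D i),
      finite_set [set z : ('I_k * R) * ('I_k * R) | crossing D z.1 z.2],
      forall x y z, crossing D x y -> crossing D y z -> x = z,
      forall x y, crossing D x y -> transverse (shadow D) x y &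
      forall x y, crossing D x y -> passes_over D x y = ~~ passes_over D y x].

Definition proj_plane (R : realType) (p : 'rV[R]_3) : 'rV[R]_2 :=
  col' ord_max p.

Definition height (R : realType) (p : 'rV[R]_3) : R := p 0 ord_max.

Definition represents (R : realType) (k : nat) (D : diagram_data R k)
    (L : set 'rV[R]_3) : Prop :=
  exists c : curves R k 3,
    [/\ polygonal_link_param c,
        forall i t, proj_plane (c i t) = shadow D i t,
        forall x y, crossing D x y ->
          passes_over D x y = (height (at_param c y) < height (at_param c x)) &
        ambient_isotopic L (trace c)].

(* The image in R / Z of the closed interval [a, b]. *)
Definition on_arc (R : realType) (a b t : R) : Prop :=
  exists m : int, a <= t + m%:~R <= b.

(* Values at integer translates are identified, so that an interval of length
   1 parametrizes a simple closed curve. *)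
Definition simple_arc (R : realType) (d : nat) (f : R -> 'rV[R]_d)
    (a b : R) : Prop :=
  forall s t, a <= s <= b -> a <= t <= b -> f s = f t ->
    exists m : int, s = t + m%:~R.

(* Component i is cut into the black arc [a i, b i] and the red arc
   [b i, a i + 1].  When b i = a i (resp. b i = a i + 1) there is a single
   arc, which is red (resp. black).  Arcs are closed, so the last two clauses
   also prevent the end points of the arcs from being crossings. *)
Definition meander_coloring (R : realType) (k : nat) (D : diagram_data R k)
    (a b : 'I_k -> R) : Prop :=
  let black (x : 'I_k * R) := on_arc (a x.1) (b x.1) x.2 in
  let red (x : 'I_k * R) := on_arc (b x.1) (a x.1 + 1) x.2 in
  [/\ forall i, a i <= b i <= a i + 1,
      forall i, simple_arc (shadow D i) (a i) (b i) /\
                simple_arc (shadow D i) (b i) (a i + 1),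
      forall x y, crossing D x y ->
        (black x /\ red y) \/ (red x /\ black y),
      forall x y, crossing D x y -> ~ (black x /\ black y) &
      forall x y, crossing D x y -> ~ (red x /\ red y)].

Definition meander_diagram (R : realType) (k : nat) (D : diagram_data R k) :
    Prop :=
  link_diagram D /\ exists a b : 'I_k -> R, meander_coloring D a b.

Definition has_meander_diagram (R : realType) (k : nat)
    (L : set 'rV[R]_3) : Prop :=
  exists D : diagram_data R k, meander_diagram D /\ represents D L.

(* Main.v *)
Require Import Defs.
From HB Require Import structures.
From mathcomp Require Import all_boot all_order all_algebra.
From mathcomp Require Import all_classical all_reals all_analysis.
From mathcomp Require Import ring lra zify.
Import Order.TTheory GRing.Theory Num.Theory.
Import numFieldNormedType.Exports.

(* Shearing by a generic vector puts a polygonal link in general position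
   with respect to the projection.  Each component starts as a closing edge
   so short that no other closing edge crosses it, followed by edges that
   are coloured black one at a time in their order.  Before the next edge is
   added to the black path, its crossings with the black edges are removed:
   starting with the last black edge [(v, v')], the crossing nearest to [v]
   is slid along the edge and past [v], in a thin triangle that tilts
   steeply enough to pass above or below everything in its way.  This
   creates new crossings only with edges crossing the segment up to [v],
   hence neither black nor part of the new edge, and with edges incident to
   [v], black only if they come earlier, so that the procedure terminates.
   At the end all edges but the closing ones are black and no two black
   edges cross: the black arc of a component is its path and the red arc is
   its closing edge. *)

(** Over and under are not tracked by the moves: the diagram is read off the heights of the final
    polygons, so a move only has to be an isotopy in space that preserves the general position
    [good]. That notion allows several edges to project through one point. No triple point remains
    in the end, because among three strands through a point two have the same colour, and strands of
    one colour do not cross. A slide is free to create crossings with closing edges and with edges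
    not yet coloured. This is why the closing edges are made disjoint from each other beforehand and
    then never moved, and why only black edges have to be watched: for the black edge being cleared,
    the number of edges of the new path that cross it drops with each slide. *)

Set Implicit Arguments.
Unset Strict Implicit.
Unset Printing Implicit Defensive.

Local Open Scope classical_set_scope.
Local Open Scope ring_scope.

(** * Ambient isotopies *)

Lemma cont_id {T : topologicalType} : continuous (fun x : T => x).
Proof. by move=> x; exact: cvg_id. Qed.

Lemma cont_cst {T U : topologicalType} (a : U) : continuous (fun _ : T => a).
Proof. by move=> x; exact: cvg_cst. Qed.

Lemma cont_comp {T U V : topologicalType} (f : T -> U) (g : U -> V) :
  continuous f -> continuous g -> continuous (fun x => g (f x)).
Proof. by move=> cf cg x; apply: continuous_comp; [exact: cf|exact: cg]. Qed.

Lemma cont_fst {T U : topologicalType} : continuous (fun x : T * U => x.1).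
Proof. by move=> x; exact: cvg_fst. Qed.

Lemma cont_snd {T U : topologicalType} : continuous (fun x : T * U => x.2).
Proof. by move=> x; exact: cvg_snd. Qed.

Lemma cont_pair {T U V : topologicalType} (f : T -> U) (g : T -> V) :
  continuous f -> continuous g -> continuous (fun x => (f x, g x)).
Proof. by move=> cf cg x; apply: cvg_pair; [exact: cf|exact: cg]. Qed.

Section Continuity.
Context {R : realType} {T : topologicalType} {V : normedModType R}.

Lemma contD (f g : T -> V) :
  continuous f -> continuous g -> continuous (fun x => f x + g x).
Proof. by move=> cf cg x; apply: cvgD; [exact: cf|exact: cg]. Qed.

Lemma contB (f g : T -> V) :
  continuous f -> continuous g -> continuous (fun x => f x - g x).
Proof. by move=> cf cg x; apply: cvgB; [exact: cf|exact: cg]. Qed.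

Lemma contZ (f : T -> R) (g : T -> V) :
  continuous f -> continuous g -> continuous (fun x => f x *: g x).
Proof. by move=> cf cg x; apply: cvgZ; [exact: cf|exact: cg]. Qed.

Lemma contM (f g : T -> R) :
  continuous f -> continuous g -> continuous (fun x => f x * g x).
Proof. by move=> cf cg x; apply: cvgM; [exact: cf|exact: cg]. Qed.

Lemma cont_norm (f : T -> V) : continuous f -> continuous (fun x => `|f x|).
Proof. by move=> cf x; apply: cvg_norm; exact: cf. Qed.

Lemma cont_min (f g : T -> R) : continuous f -> continuous g ->
  continuous (fun x => Num.min (f x) (g x)).
Proof. by move=> cf cg; exact: cont_comp (cont_pair cf cg) min_continuous. Qed.

Lemma cont_max (f g : T -> R) : continuous f -> continuous g ->
  continuous (fun x => Num.max (f x) (g x)).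
Proof. by move=> cf cg; exact: cont_comp (cont_pair cf cg) max_continuous. Qed.

End Continuity.

Section Push.
Context {R : realType}.
Implicit Types (p q w : 'rV[R]_3) (A B C : set 'rV[R]_3).

(** The two isotopies run simultaneously, [K t] after [H t], instead of one after the other: no
    reparametrization of time occurs, and the end points are right because [H 0] and [K 0] are the
    identity. *)
Lemma ambient_isotopic_trans A B C :
  ambient_isotopic A B -> ambient_isotopic B C -> ambient_isotopic A C.
Proof.
move=> [H [cH hH H0 HA]] [K [cK hK K0 KB]].
exists (fun t p => K t (H t p)); split.
- move/subspace_continuousP: cH => cH; move/subspace_continuousP: cK => cK.
  apply/subspace_continuousP => z Sz.
  pose F (y : R * 'rV[R]_3) := (y.1, H y.1 y.2).
  apply: (@cvg_comp _ _ _ F (fun y => K y.1 y.2)); last exact: (cK (F z)).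
  have cF : F y @[y --> within [set z : R * 'rV[R]_3 | 0 <= z.1 <= 1] (nbhs z)]
      --> F z.
    have c1 : y.1 @[y --> within [set z : R * 'rV[R]_3 | 0 <= z.1 <= 1] (nbhs z)]
        --> z.1.
      apply: (cvg_trans (G := y.1 @[y --> nbhs z])); last exact: cvg_fst.
      by apply: cvg_fmap2; exact: cvg_within.
    exact: (cvg_pair c1 (cH _ Sz)).
  move=> U /cF; rewrite /nbhs/= => hU.
  apply: filterS2 hU (withinT _ _) => y /= hy Sy.
  exact: hy.
- move=> t t01.
  have [cHt [g [cg gH Hg]]] := hH t t01.
  have [cKt [k [ck gK Kg]]] := hK t t01.
  split; first by move=> x; apply: continuous_comp; [exact: cHt|exact: cKt].
  exists (g \o k); split.
  + by move=> x; apply: continuous_comp; [exact: ck|exact: cg].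
  + by move=> x; rewrite /= gK gH.
  + by move=> x; rewrite /= Hg Kg.
- by move=> p; rewrite H0 K0.
- by rewrite -KB -HA -image_comp.
Qed.

(* Since [s |-> s + t g(p + s w)] is increasing, the inverse solves
   [r + t g(q + r w) = 0] on the interval [[-1, 0]]. *)
Lemma push_homeomorphism w (g : 'rV[R]_3 -> R) (t : R) :
    continuous g -> (forall p, 0 <= g p <= 1) ->
    (forall p s, 0 < s -> g p - s < g (p + s *: w)) -> 0 <= t <= 1 ->
  homeomorphism (fun p => p + (t * g p) *: w).
Proof.
move=> cg g01 gmon /andP[t0 t1].
have cf : continuous (fun p => p + (t * g p) *: w).
  apply: contD; first exact: cont_id.
  by apply: contZ; [apply: contM => //|]; exact: cont_cst.
split=> //.
pose phi q s := s + t * g (q + s *: w).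
have phim q s s' : s < s' -> phi q s < phi q s'.
  move=> ss'; have := gmon (q + s *: w) (s' - s).
  rewrite subr_gt0 => /(_ ss').
  rewrite -addrA -scalerDl addrCA addrN addr0.
  rewrite /phi; set u := g _; set v := g _ => uv.
  have [le|le] := lerP u v; nra.
have cphi q : continuous (phi q).
  apply: contD; first exact: cont_id.
  apply: contM; first exact: cont_cst.
  apply: cont_comp cg; apply: contD; first exact: cont_cst.
  by apply: contZ; [exact: cont_id|exact: cont_cst].
have cphi' s : continuous (phi^~ s).
  apply: contD; first exact: cont_cst.
  apply: contM; first exact: cont_cst.
  apply: cont_comp cg; apply: contD; first exact: cont_id.
  exact: cont_cst.
have /choice[r rP] q : exists s, phi q s = 0.
  have [| | |s _ <-] := @IVT R (phi q) (-1) 0 0; last by exists s.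
  - by lra.
  - by apply: continuous_subspaceT; exact: cphi.
  - have := g01 (q + (-1) *: w); have := g01 (q + 0 *: w).
    rewrite /phi => /andP[a1 a2] /andP[b1 b2].
    rewrite ge_min le_max; apply/andP; split; apply/orP; [left|right]; nra.
have phi_lt q s s' : phi q s < phi q s' -> s < s'.
  by case: (ltgtP s s') => [//|/(phim q)|->]; [lra|rewrite ltxx].
have runiq q s : phi q s = 0 -> r q = s.
  move=> qs; have := rP q.
  by case: (ltgtP (r q) s) => // /(phim q); lra.
(* Strict monotonicity traps [r y] between [r q - e] and [r q + e] as soon as [phi y] is negative at
   the first and positive at the second, which is an open condition on [y]. *)
have cr : continuous r.
  move=> q; apply/(@cvgrPdist_lt _ _ _ _ (nbhs_filter q)) => e e0.
  have lo : phi q (r q - e) < 0 by rewrite -(rP q); apply: phim; lra.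
  have hi : 0 < phi q (r q + e) by rewrite -(rP q); apply: phim; lra.
  have nlo : \forall y \near q, phi y (r q - e) < 0.
    exact: (@cvgr_lt _ _ _ (nbhs_filter q) _ _ (cphi' (r q - e) q) _ lo).
  have nhi : \forall y \near q, 0 < phi y (r q + e).
    exact: (@cvgr_gt _ _ _ (nbhs_filter q) _ _ (cphi' (r q + e) q) _ hi).
  apply: filterS2 nlo nhi => y ylo yhi.
  have lo' : r q - e < r y by apply: (phi_lt y); rewrite rP.
  have hi' : r y < r q + e by apply: (phi_lt y); rewrite rP.
  by rewrite distrC ltr_distl lo' hi'.
exists (fun q => q + r q *: w); split.
- by apply: contD; [exact: cont_id|apply: contZ => //; exact: cont_cst].
- move=> p; rewrite (runiq _ (- (t * g p))); last first.
    by rewrite /phi scaleNr addrK addNr.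
  by rewrite scaleNr addrK.
- move=> q; rewrite -addrA -scalerDl; have := rP q; rewrite /phi => ->.
  by rewrite scale0r addr0.
Qed.

(** The last hypothesis says that [g] decreases at a rate less than 1 along [w], so that the points
    of a line parallel to [w] are moved along it without changing their order. *)
Lemma push_isotopy w (g : 'rV[R]_3 -> R) A :
    continuous g -> (forall p, 0 <= g p <= 1) ->
    (forall p s, 0 < s -> g p - s < g (p + s *: w)) ->
  ambient_isotopic A [set p + g p *: w | p in A].
Proof.
move=> cg g01 gmon; exists (fun t p => p + (t * g p) *: w); split.
- apply: continuous_subspaceT; apply: contD; first exact: cont_snd.
  apply: contZ; last exact: cont_cst.
  by apply: contM; [exact: cont_fst|exact: cont_comp cont_snd cg].
- by move=> t; exact: push_homeomorphism.
- by move=> p; rewrite mul0r scale0r addr0.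
- by apply: eq_imagel => p _; rewrite mul1r.
Qed.

Lemma shear_isotopy (w : 'rV[R]_3) A : height w = 0 ->
  ambient_isotopic A [set p + height p *: w | p in A].
Proof.
move=> hw; have hD p s : height (p + s *: w) = height p.
  by move: hw; rewrite /height !mxE => ->; rewrite mulr0 addr0.
have ch : continuous (@height R) by exact: coord_continuous.
exists (fun t p => p + (t * height p) *: w); split.
- apply: continuous_subspaceT; apply: contD; first exact: cont_snd.
  apply: contZ; last exact: cont_cst.
  by apply: contM; [exact: cont_fst|exact: cont_comp cont_snd ch].
- move=> t _.
  have cH s : continuous (fun p => p + (s * height p) *: w).
    apply: contD; first exact: cont_id.
    apply: contZ; last exact: cont_cst.
    by apply: contM => //; exact: cont_cst.
  split; first exact: cH.
  exists (fun p => p + (- t * height p) *: w); split; first exact: cH.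
  + by move=> p; rewrite hD -addrA -scalerDl mulNr addrN scale0r addr0.
  + by move=> p; rewrite hD -addrA -scalerDl mulNr addNr scale0r addr0.
- by move=> p; rewrite mul0r scale0r addr0.
- by apply: eq_imagel => p _; rewrite mul1r.
Qed.

Lemma ambient_isotopic_refl A : ambient_isotopic A A.
Proof.
have := @shear_isotopy 0 A; rewrite {1}/height mxE => /(_ erefl).
rewrite (_ : [set _ | p in A] = A)//.
by under eq_imagel do rewrite scaler0 addr0; exact: image_id.
Qed.

End Push.

(** * Triangle moves *)

Section Segments.
Context {R : realType} {V : lmodType R}.
Implicit Types (a b c z : V).

Definition seg a b : set V :=
  [set z | exists2 t, 0 <= t <= 1 & z = a + t *: (b - a)].

Definition tri a b c : set V :=
  [set z | exists s t,
     [/\ 0 <= s, 0 <= t, s + t <= 1 & z = a + s *: (b - a) + t *: (c - a)]].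

Lemma seg_l a b : seg a b a.
Proof. by exists 0; rewrite ?scale0r ?addr0//; lra. Qed.

Lemma seg_r a b : seg a b b.
Proof. by exists 1; rewrite ?scale1r ?subrKC//; lra. Qed.

Lemma seg_sym a b : seg a b = seg b a.
Proof.
suff H x y : seg x y `<=` seg y x by apply/seteqP; split; exact: H.
move=> _ [t t01 ->]; exists (1 - t); first lra.
by rewrite scalerBl scale1r addrA subrKC -[y - x]opprB scalerN.
Qed.

End Segments.

Section Eventually.
Context {R : realType}.

(** The right neighbourhoods of 0 in explicit form: finitely many requirements on a small positive
    parameter are met by a common value. *)
Definition evsmall (P : R -> Prop) : Prop :=
  exists2 d0, 0 < d0 & forall d, 0 < d <= d0 -> P d.

Lemma ev_and P Q : evsmall P -> evsmall Q -> evsmall (fun d => P d /\ Q d).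
Proof.
move=> [d d0 dP] [e e0 eQ]; exists (Num.min d e); first by rewrite lt_min d0.
by move=> x /andP[x0]; rewrite le_min => /andP[xd xe]; split;
  [apply: dP|apply: eQ]; rewrite x0.
Qed.

Lemma ev_mono P Q : (forall d, 0 < d -> P d -> Q d) -> evsmall P -> evsmall Q.
Proof.
move=> PQ [d d0 dP]; exists d => // x xd; apply: PQ; last exact: dP.
by case/andP: xd.
Qed.

Lemma ev_le (e : R) : 0 < e -> evsmall (fun d => d <= e).
Proof. by move=> e0; exists e => // d /andP[]. Qed.

Lemma ev_true (P : R -> Prop) : (forall d, 0 < d -> P d) -> evsmall P.
Proof. by move=> H; exists 1 => // d /andP[/H]. Qed.

Lemma ev_all (T : eqType) (s : seq T) (P : T -> R -> Prop) :
  (forall x, x \in s -> evsmall (P x)) ->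
  evsmall (fun d => forall x, x \in s -> P x d).
Proof.
elim: s => [|y s IH] H; first by exists 1.
have /ev_mono := ev_and (H y (mem_head _ _))
  (IH (fun x xs => H x (mem_behead (s := y :: s) xs))).
by apply=> d _ [Py Ps] x; rewrite inE => /orP[/eqP->//|]; exact: Ps.
Qed.

Lemma ev_ex P : evsmall P -> exists2 d, 0 < d & P d.
Proof. by move=> [d d0 dP]; exists d => //; apply: dP; rewrite d0/=. Qed.

End Eventually.

Section Delta.
Context {R : realType}.
Local Notation pt := 'rV[R]_3.
Implicit Types (a b c p u w x y z : pt) (C D : 'cV[R]_3).

Definition trace_of (E : seq (pt * pt)) : set pt :=
  [set z | exists2 e, e \in E & seg e.1 e.2 z].

Lemma trace_eqi (E E' : seq (pt * pt)) : E =i E' -> trace_of E = trace_of E'.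
Proof.
by move=> EE; apply/seteqP; split=> z [e eE ze]; exists e; rewrite // ?EE// -EE.
Qed.

Lemma trace_cons (e : pt * pt) E : trace_of (e :: E) = seg e.1 e.2 `|` trace_of E.
Proof.
apply/seteqP; split=> [z [f]|z [ze|[f fE zf]]].
- by rewrite inE => /orP[/eqP->|fE] zf; [left|right; exists f].
- by exists e => //; rewrite mem_head.
- by exists f => //; rewrite inE fE orbT.
Qed.

Definition indep n (u w : 'rV[R]_n) : Prop :=
  forall s t, s *: u + t *: w = 0 -> s = 0 /\ t = 0.

Lemma indep_row_free n (u w : 'rV[R]_n) :
  indep u w -> row_free (col_mx u w).
Proof.
move=> iuw; rewrite -kermx_eq0; apply/eqP/row_matrixP => i; rewrite row0.
have : row i (kermx (col_mx u w)) *m col_mx u w = 0.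
  by rewrite -row_mul mulmx_ker row0.
set r : 'rV_(1 + 1) := row _ _.
rewrite -[r]hsubmxK mul_row_col (mx11_scalar (lsubmx r))
  (mx11_scalar (rsubmx r)) !mul_scalar_mx => /iuw[-> ->].
by rewrite !raddf0 row_mx0.
Qed.

Definition dotc C x : R := (x *m C) 0 0.

Lemma dotcD C x y : dotc C (x + y) = dotc C x + dotc C y.
Proof. by rewrite /dotc mulmxDl mxE. Qed.

Lemma dotcZ C k x : dotc C (k *: x) = k * dotc C x.
Proof. by rewrite /dotc -scalemxAl mxE. Qed.

Lemma dotc0 C : dotc C 0 = 0.
Proof. by rewrite /dotc mul0mx mxE. Qed.

Lemma cont_dotc C : continuous (dotc C).
Proof.
have -> : dotc C = fun x => \sum_i x 0 i * C i 0.
  by apply: funext => x; rewrite /dotc mxE.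
under eq_fun do rewrite !big_ord_recl big_ord0.
do 3![apply: contD; first by apply: contM;
  [exact: coord_continuous|exact: cont_cst]].
exact: cont_cst.
Qed.

(** The columns of a right inverse are coordinate functionals on the plane of [u] and [w], extended
    to all of space. *)
Lemma dual_pair u w : indep u w -> exists C D : 'cV[R]_3,
  [/\ dotc C u = 1, dotc C w = 0, dotc D u = 0 & dotc D w = 1].
Proof.
move=> /indep_row_free/row_freeP[B].
rewrite -[B]hsubmxK.
move: (lsubmx B) (rsubmx B) => C D.
rewrite mul_col_row scalar_mx_block => /eq_block_mx[h1 h2 h3 h4].
by exists C, D; split; rewrite /dotc ?h1 ?h2 ?h3 ?h4 mxE.
Qed.

(* Extends a spike of height [h] along the push direction; [Z] is the signed
   coordinate in that direction. *)
Definition spike (d h Z : R) : R :=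
  Num.max 0 (Num.min (h + Z / d) (h - Z / (1 + d))).

Lemma spike_eq0 d h Z :
  h + Z / d <= 0 \/ h - Z / (1 + d) <= 0 -> spike d h Z = 0.
Proof.
by move=> H; apply/max_idPl; rewrite ge_min; apply/orP; case: H; [left|right].
Qed.

Lemma spike_eq0_h d h Z : 0 < d -> h <= 0 -> spike d h Z = 0.
Proof.
move=> d0 h0; apply: spike_eq0; have [Z0|/ltW Z0] := lerP 0 Z; [right|left].
- have : 0 <= Z / (1 + d) by apply: divr_ge0 => //; lra.
  lra.
- have : Z / d <= 0 by rewrite pmulr_lle0// invr_gt0.
  lra.
Qed.

Lemma spike_ge0 d h Z : 0 <= spike d h Z.
Proof. by rewrite le_max lexx. Qed.

Lemma spike_le d h Z : 0 < d -> 0 <= h -> spike d h Z <= h.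
Proof.
move=> d0 h0; rewrite ge_max h0/= ge_min; apply/orP.
have [Z0|/ltW Z0] := lerP 0 Z; [right|left].
- have : 0 <= Z / (1 + d) by apply: divr_ge0 => //; lra.
  lra.
- have : Z / d <= 0 by rewrite pmulr_lle0// invr_gt0.
  lra.
Qed.

Lemma spike0 d h : 0 <= h -> spike d h 0 = h.
Proof. by move=> h0; rewrite /spike !mul0r subr0 addr0 minxx; apply/max_idPr. Qed.

(** The descending side has slope [-1 / (1 + d)]; with 1 in place of [1 + d] the inequality would
    not be strict and the push would collapse points. *)
Lemma spike_mono d h Z s : 0 < d -> 0 < s -> spike d h Z - s < spike d h (Z + s).
Proof.
move=> d0 s0; have k0 : 0 < s / d by apply: divr_gt0.
have k1 : s / (1 + d) < s by rewrite ltr_pdivrMr; nra.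
rewrite ltrBlDr {1}/spike gt_max; apply/andP; split.
  by have := spike_ge0 d h (Z + s); lra.
have [le|lt] := lerP (h + Z / d) (h - Z / (1 + d)).
  rewrite -ltrBlDr /spike lt_max lt_min !mulrDl; apply/orP; right.
  by apply/andP; split; lra.
rewrite -ltrBlDr /spike lt_max lt_min !mulrDl; apply/orP; right.
by apply/andP; split; lra.
Qed.

(** On a ray from a vertex of the base all quantities are proportional to the distance [s], so a
    condition on the direction alone makes the spike vanish on the whole ray. The excluded case is a
    direction pointing into the triangle: [nu] is the rate at which its plane is left, [al] the rate
    along the base, [ze] the rate towards the apex. *)
Lemma spike_cone al ze nu : 0 <= nu ->
    ~ [/\ nu = 0, 0 < al & 0 <= ze <= 2 * al] ->
  evsmall (fun d => forall s h, 0 <= s -> h <= 2 * (s * al) - s * nu / d ->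
    spike d h (s * ze) = 0).
Proof.
move=> nu0 H.
have [al0|al0] := lerP al 0.
  apply: ev_true => d d0 s h s0 hh; apply: spike_eq0_h => //.
  have : 0 <= s * nu / d by apply: divr_ge0 => //; [exact: mulr_ge0|exact: ltW].
  nra.
have [nu1|nu1] := eqVneq nu 0; last first.
  have {}nu0 : 0 < nu by rewrite lt_neqAle eq_sym nu1.
  have : 0 < nu / (2 * al) by apply: divr_gt0 => //; lra.
  move=> /ev_le; apply: ev_mono => d d0; rewrite ler_pdivlMr; last lra.
  move=> dn s h s0 hh; apply: spike_eq0_h => //; apply: (le_trans hh).
  rewrite subr_le0 ler_pdivlMr//; nra.
have [ze0|ze0] := ltrP ze 0.
  have : 0 < - ze / (2 * al) by apply: divr_gt0; lra.
  move=> /ev_le; apply: ev_mono => d d0; rewrite ler_pdivlMr; last lra.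
  move=> dz s h s0 hh; apply: spike_eq0; left.
  rewrite -(pmulr_lle0 _ d0) mulrDl divfK ?gt_eqF//.
  move: hh; rewrite nu1 mulr0 mul0r subr0 => hh; nra.
have [zea|zea] := lerP ze (2 * al).
  by exfalso; apply: H; rewrite nu1 ze0 zea.
have : 0 < (ze - 2 * al) / (2 * al) by apply: divr_gt0; lra.
move=> /ev_le; apply: ev_mono => d d0; rewrite ler_pdivlMr; last lra.
move=> dz s h s0 hh; apply: spike_eq0; right.
have d1 : 0 < 1 + d by lra.
rewrite -(pmulr_lle0 _ d1) mulrBl divfK ?gt_eqF//.
move: hh; rewrite nu1 mulr0 mul0r subr0 => hh; nra.
Qed.

End Delta.

Section DeltaMove.
Context {R : realType}.
Local Notation pt := 'rV[R]_3.
Implicit Types (e : pt * pt) (E : seq (pt * pt)) (p x y z : pt).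
Variables (a b c : pt) (C D : 'cV[R]_3).
Let u : pt := b - a.
(** This vector leads from the midpoint of the base to the apex, so that a tent of height 1 over the
    base, peaking at its midpoint, bends the base into the two other sides. *)
Let w : pt := c - a - 2^-1 *: u.
Hypotheses (Cu : dotc C u = 1) (Cw : dotc C w = 0).
Hypotheses (Du : dotc D u = 0) (Dw : dotc D w = 1).

(** The component outside the plane of the triangle. With [A] and [Z] as coordinates in that plane
    and [N] as distance from it, the triangle is given by [N = 0] and [0 <= Z <= tent]. *)
Let rho x : pt := x - dotc C x *: u - dotc D x *: w.
Let A z : R := dotc C (z - a).
Let Z z : R := dotc D (z - a).
Let N z : R := `|rho (z - a)|.
Let tent z : R := 1 - `|2 * A z - 1|.
(* Pushing [z] by [g d z *: w] carries the segment [a, b] onto the path [a, c, b];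
   for small [d] it moves only points near the triangle. *)
Let g (d : R) z : R := spike d (tent z - N z / d) (Z z).

Let rhoD x y : rho (x + y) = rho x + rho y.
Proof. by rewrite /rho !dotcD; apply/rowP => i; rewrite !mxE; ring. Qed.

Let rhoZ k x : rho (k *: x) = k *: rho x.
Proof. by rewrite /rho !dotcZ; apply/rowP => i; rewrite !mxE; ring. Qed.

Let rho_w : rho w = 0.
Proof. by rewrite /rho Cw Dw scale0r subr0 scale1r subrr. Qed.

Let rho_u : rho u = 0.
Proof. by rewrite /rho Cu Du scale0r subr0 scale1r subrr. Qed.

Let tent_le1 z : tent z <= 1.
Proof. by rewrite /tent; have := normr_ge0 (2 * A z - 1); lra. Qed.

Let N_ge0 z : 0 <= N z. Proof. exact: normr_ge0. Qed.

Let cont_A : continuous A.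
Proof.
apply: (cont_comp (f := fun z => z - a)); last exact: cont_dotc.
by apply: contB; [exact: cont_id|exact: cont_cst].
Qed.

Let cont_Z : continuous Z.
Proof.
apply: (cont_comp (f := fun z => z - a)); last exact: cont_dotc.
by apply: contB; [exact: cont_id|exact: cont_cst].
Qed.

Let cont_N : continuous N.
Proof.
apply: cont_norm; apply: (cont_comp (f := fun z => z - a)).
  by apply: contB; [exact: cont_id|exact: cont_cst].
apply: contB; first apply: contB; first exact: cont_id.
- by apply: contZ; [exact: cont_dotc|exact: cont_cst].
- by apply: contZ; [exact: cont_dotc|exact: cont_cst].
Qed.

Let cont_tent : continuous tent.
Proof.
apply: contB; first exact: cont_cst.
apply: cont_norm; apply: contB; last exact: cont_cst.
by apply: contM => //; exact: cont_cst.
Qed.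

Let cont_g d : continuous (g d).
Proof.
have ch : continuous (fun z => tent z - N z / d).
  by apply: contB => //; apply: contM => //; exact: cont_cst.
apply: cont_max; first exact: cont_cst.
apply: cont_min; [apply: contD|apply: contB] => //;
  by apply: contM => //; exact: cont_cst.
Qed.

Let g_bound (d : R) z : 0 < d -> 0 <= g d z <= 1.
Proof.
move=> d0; rewrite spike_ge0/=.
have [h0|/ltW h0] := lerP 0 (tent z - N z / d); last first.
  by rewrite /g spike_eq0_h//; lra.
apply: (le_trans (spike_le _ d0 h0)).
have : 0 <= N z / d by apply: divr_ge0 => //; exact: ltW.
by have := tent_le1 z; lra.
Qed.

Let g_mono (d : R) z (s : R) : 0 < d -> 0 < s -> g d z - s < g d (z + s *: w).
Proof.
move=> d0 s0; have Es : z + s *: w - a = (z - a) + s *: w by rewrite addrAC.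
rewrite /g /tent /N /A /Z Es (rhoD (z - a)) rhoZ rho_w scaler0 addr0.
by rewrite !(dotcD _ (z - a)) !dotcZ Cw Dw mulr0 addr0 mulr1; exact: spike_mono.
Qed.

Let triP z : N z = 0 -> 0 <= Z z <= tent z -> tri a b c z.
Proof.
move=> /normr0_eq0 rz /andP[Z0 Zt].
have zE : z = a + A z *: u + Z z *: w.
  by move: rz; rewrite /rho -/(A z) -/(Z z) => /rowP rz; apply/rowP => i;
     move: (rz i); rewrite !mxE; lra.
exists (A z - Z z / 2), (Z z).
have : Z z <= 1 - `|2 * A z - 1| by [].
rewrite lerBrDl -lerBrDr ler_norml => /andP[h1 h2].
split; [lra|lra|lra|].
rewrite {1}zE /w /u; apply/rowP => i; rewrite !mxE; lra.
Qed.

(** The function [phi] below measures how far the conditions of [triP] fail. It has a positive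
    minimum on the segment by compactness, and a [d] below this minimum kills the spike. *)
Let g_eq0_far x y :
    (forall z, seg x y z -> ~ tri a b c z) ->
  evsmall (fun d => forall z, seg x y z -> g d z = 0).
Proof.
move=> H.
pose l t := x + t *: (y - x).
have cl : continuous l.
  apply: contD; first exact: cont_cst.
  by apply: contZ; [exact: cont_id|exact: cont_cst].
pose phi t := Num.max (N (l t)) (Num.max (- Z (l t)) (Z (l t) - tent (l t))).
have cphi : continuous phi.
  apply: cont_max; first exact: cont_comp cl cont_N.
  apply: cont_max.
    have -> : (fun t => - Z (l t)) = (fun t => 0 - Z (l t)).
      by apply: funext => t; rewrite sub0r.
    by apply: contB; [exact: cont_cst|exact: cont_comp cl cont_Z].
  by apply: contB; [exact: cont_comp cl cont_Z|exact: cont_comp cl cont_tent].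
have [t0 t01 tmin] := @EVT_min R phi 0 1 ler01 (continuous_subspaceT cphi).
have p0 : 0 < phi t0.
  rewrite ltNge; apply/negP; rewrite /phi !ge_max => /and3P[h1 h2 h3].
  apply: (H (l t0)); first by exists t0 => //; move: t01; rewrite in_itv.
  by apply: triP; [apply/le_anti; rewrite h1/=|lra].
have := ev_le p0; apply: ev_mono => d d0 dle _ [t t01' ->].
have {tmin} := tmin t; rewrite in_itv/= => /(_ t01') /(le_trans dle).
rewrite -/(l t) /phi !le_max => H'.
rewrite /g; have [h0|h0] := lerP (tent (l t) - N (l t) / d) 0.
  exact: spike_eq0_h.
have Nd : 0 <= N (l t) / d by apply: divr_ge0 => //; exact: ltW.
have T1 := tent_le1 (l t).
apply: spike_eq0; case/or3P: H' => h.
- by have : 1 <= N (l t) / d by [rewrite ler_pdivlMr ?mul1r]; lra.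
- left; have : Z (l t) / d <= - 1 by rewrite ler_pdivrMr//; lra.
  by lra.
- right; rewrite subr_le0 ler_pdivlMr; last lra.
  nra.
Qed.

(** At a vertex shared with the triangle compactness gives no positive bound; the homogeneity used
    in [spike_cone] replaces it. *)
Let g_eq0_end (P : pt) (al ze nu : R) y :
    (forall s : R, 0 <= s -> tent (P + s *: (y - P)) <= 2 * (s * al)) ->
    (forall s : R, 0 <= s -> 2 * (s * al) <= 1 -> tent (P + s *: (y - P)) = 2 * (s * al)) ->
    (forall s, Z (P + s *: (y - P)) = s * ze) ->
    (forall s : R, 0 <= s -> N (P + s *: (y - P)) = s * nu) -> 0 <= nu ->
    (0 < al -> y != P) ->
    P = a \/ P = b ->
    (forall z, seg P y z -> tri a b c z -> z = a \/ z = b) ->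
  evsmall (fun d => forall z, seg P y z -> g d z = 0).
Proof.
move=> t1 t2 hZ hN nu0 yP Pab H.
have /(spike_cone nu0) : ~ [/\ nu = 0, 0 < al & 0 <= ze <= 2 * al].
  move=> [nu1 al0 /andP[ze0 zea]].
  (* Up to [s0] the tent is exactly linear, so a direction pointing into the triangle keeps the
     segment inside it. Then the points at [s0] and at [s0 / 2] are both the end of the base other
     than [P], hence equal. *)
  pose s0 := Num.min 1 (2 * al)^-1.
  have s00 : 0 < s0 by rewrite lt_min ltr01 invr_gt0/=; lra.
  have s01 : s0 <= 1 by rewrite ge_min lexx.
  have s02 : 2 * (s0 * al) <= 1.
    have : s0 <= (2 * al)^-1 by rewrite ge_min lexx orbT.
    by rewrite -[(2 * al)^-1]mul1r ler_pdivlMr; nra.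
  have K s : 0 < s <= s0 -> P + s *: (y - P) = a \/ P + s *: (y - P) = b.
    move=> /andP[sp sl]; apply: H; first by exists s => //; lra.
    apply: triP; first by rewrite hN ?nu1 ?mulr0//; lra.
    rewrite hZ t2; [|lra|nra].
    by apply/andP; split; nra.
  have yP' : y - P != 0 by rewrite subr_eq0 yP.
  have K1 s : 0 < s -> P + s *: (y - P) != P.
    by move=> sp; rewrite -subr_eq0 addrAC subrr add0r scaler_eq0 negb_or yP' gt_eqF.
  have E : P + s0 *: (y - P) = P + (s0 / 2) *: (y - P).
    have s1 := K1 s0 s00; have s2 : P + (s0/2) *: (y - P) != P by apply: K1; lra.
    have k1 := K s0; have k2 := K (s0 / 2).
    have {}k1 : P + s0 *: (y - P) = a \/ P + s0 *: (y - P) = b.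
      by apply: k1; rewrite s00/=.
    have {}k2 : P + (s0 / 2) *: (y - P) = a \/ P + (s0 / 2) *: (y - P) = b.
      by apply: k2; apply/andP; split; lra.
    move: k1 k2 s1 s2; set p1 := P + _; set p2 := P + _ => k1 k2.
    by case: k1 => ->; case: k2 => ->; case: Pab => -> //; rewrite eqxx.
  move/addrI/eqP: E; rewrite -subr_eq0 -scalerBl scaler_eq0 (negPf yP') orbF.
  lra.
apply: ev_mono => d d0 hd _ [s s01 ->].
have s0 : 0 <= s by case/andP: s01.
rewrite /g hZ; apply: hd => //; rewrite hN// lerD2r; exact: t1.
Qed.

Let g_eq0_a y :
    (forall z, seg a y z -> tri a b c z -> z = a \/ z = b) ->
  evsmall (fun d => forall z, seg a y z -> g d z = 0).
Proof.
move=> H.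
have Ea s : a + s *: (y - a) - a = s *: (y - a) by rewrite addrAC subrr add0r.
apply: (@g_eq0_end a (A y) (Z y) (N y) y) => //; last by left.
- move=> s s0; rewrite /tent /A Ea dotcZ -/(A y).
  have := ler_norm (1 - 2 * (s * A y)); rewrite distrC; lra.
- move=> s s0 h; rewrite /tent /A Ea dotcZ -/(A y) ler0_norm; lra.
- by move=> s; rewrite /Z Ea dotcZ.
- by move=> s s0; rewrite /N Ea rhoZ normrZ ger0_norm.
- apply: contraTneq => ->; rewrite /A subrr dotc0.
  by rewrite ltxx.
Qed.

Let g_eq0_b y :
    (forall z, seg b y z -> tri a b c z -> z = a \/ z = b) ->
  evsmall (fun d => forall z, seg b y z -> g d z = 0).
Proof.
move=> H.
have Ea s : b + s *: (y - b) - a = u + s *: (y - b) by rewrite addrAC.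
apply: (@g_eq0_end b (- dotc C (y - b)) (dotc D (y - b)) `|rho (y - b)| y) => //; last by right.
- move=> s s0; rewrite /tent /A Ea dotcD dotcZ Cu.
  have := ler_norm (2 * (1 + s * dotc C (y - b)) - 1); lra.
- move=> s s0 h; rewrite /tent /A Ea dotcD dotcZ Cu ger0_norm; lra.
- by move=> s; rewrite /Z Ea dotcD dotcZ Du add0r.
- by move=> s s0; rewrite /N Ea rhoD rho_u add0r rhoZ normrZ ger0_norm.
- apply: contraTneq => ->; rewrite subrr dotc0 oppr0.
  by rewrite ltxx.
Qed.

Lemma delta_isotopy_coord E :
    (forall e z, e \in E -> seg e.1 e.2 z -> tri a b c z ->
       (z = a \/ z = b) /\ (z = e.1 \/ z = e.2)) ->
  ambient_isotopic (trace_of E `|` seg a b)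
    (trace_of E `|` (seg a c `|` seg c b)).
Proof.
move=> H.
have : evsmall (fun d => forall e, e \in E -> forall z, seg e.1 e.2 z -> g d z = 0).
  apply: ev_all => e eE.
  have He z := H e z eE.
  have [[z [zs zt]]|none] := pselect (exists z, seg e.1 e.2 z /\ tri a b c z); last first.
    by apply: g_eq0_far => z zs zt; apply: none; exists z.
  have [ab e12] := He z zs zt.
  case: e12 => ze; last rewrite (seg_sym e.1).
  - case: ab => zab; rewrite -ze zab; [apply: g_eq0_a|apply: g_eq0_b] => z' h1 h2;
      by case: (He z' _ h2) => //; rewrite -ze zab.
  - case: ab => zab; rewrite -ze zab; [apply: g_eq0_a|apply: g_eq0_b] => z' h1 h2;
      by case: (He z' _ h2) => //; rewrite seg_sym -ze zab.
move=> /ev_ex[d d0 gE].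
have := @push_isotopy _ w (g d) (trace_of E `|` seg a b) (@cont_g d)
  (fun p => @g_bound d p d0) (fun p s => @g_mono d p s d0).
suff -> : [set p + g d p *: w | p in trace_of E `|` seg a b] =
   trace_of E `|` (seg a c `|` seg c b) by [].
have gab t : 0 <= t <= 1 -> g d (a + t *: u) = 1 - `|2 * t - 1|.
  move=> t01; have Ea : a + t *: u - a = t *: u by rewrite addrAC subrr add0r.
  rewrite /g /tent /A /N /Z Ea !dotcZ Cu Du rhoZ rho_u scaler0 normr0 mul0r.
  rewrite mulr0 mulr1 subr0 spike0//.
  by rewrite subr_ge0 ler_norml; lra.
rewrite image_setU; congr setU.
  apply/seteqP; split=> [_ [z [e eE ze] <-]|z [e eE ze]].
    by rewrite (gE e)// scale0r addr0; exists e.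
  by exists z; [exists e|rewrite (gE e)// scale0r addr0].
have lo t : 0 <= t <= 2^-1 -> a + t *: u + g d (a + t *: u) *: w = a + (2 * t) *: (c - a).
  move=> t01; rewrite gab; last lra.
  rewrite ler0_norm; last lra.
  by rewrite /w; apply/rowP => i; rewrite !mxE; lra.
have hi t : 2^-1 <= t <= 1 ->
    a + t *: u + g d (a + t *: u) *: w = c + (2 * t - 1) *: (b - c).
  move=> t01; rewrite gab; last lra.
  rewrite ger0_norm; last lra.
  by rewrite /w /u; apply/rowP => i; rewrite !mxE; lra.
apply/seteqP; split.
- move=> _ [_ [t t01 ->] <-].
  have [tl|/ltW tl] := lerP t 2^-1.
  + by left; rewrite lo; [exists (2 * t) => //; lra|lra].
  + by right; rewrite hi; [exists (2 * t - 1) => //; lra|lra].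
- move=> z [] [t t01 ->].
  + exists (a + (t / 2) *: u); first by exists (t / 2) => //; lra.
    by rewrite lo; [congr (_ + _ *: _); lra|lra].
  + exists (a + ((t + 1) / 2) *: u); first by exists ((t + 1) / 2) => //; lra.
    by rewrite hi; [congr (_ + _ *: _); lra|lra].
Qed.

End DeltaMove.

(* A triangle that meets the rest of the link only in vertices of its base
   guides an isotopy replacing the base by the two other sides. *)
Lemma delta_isotopy (R : realType) (a b c : 'rV[R]_3)
    (E : seq ('rV[R]_3 * 'rV[R]_3)) :
    indep (b - a) (c - a) ->
    (forall e z, e \in E -> seg e.1 e.2 z -> tri a b c z ->
       (z = a \/ z = b) /\ (z = e.1 \/ z = e.2)) ->
  ambient_isotopic (trace_of E `|` seg a b)
    (trace_of E `|` (seg a c `|` seg c b)).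
Proof.
move=> iuv; have /dual_pair[C [D [? ? ? ?]]] :
    indep (b - a) (c - a - 2^-1 *: (b - a)).
  move=> s t H; have [] := iuv (s - t / 2) t.
    rewrite -[RHS]H; apply/rowP => i; rewrite !mxE; lra.
  move=> h1 h2; lra.
exact: (@delta_isotopy_coord R a b c C D).
Qed.

(** * General position *)

(* [lra] gives up when vector equations are present in the context. *)
Ltac slra :=
  repeat match goal with
  | H : is_true (~~ _) |- _ => clear H
  | H : ~ _ |- _ => clear H
  | H : @eq ?T _ _ |- _ =>
    let U := open_constr:(matrix _ _ _) in unify T U; clear H
  end; lra.

Section Shadows.
Context {R : realType}.
Local Notation pt := 'rV[R]_3.
Local Notation edge := (pt * pt)%type.
Local Notation sh := (@proj_plane R).
Implicit Types (e f g : edge) (E F : seq edge) (x y z w : pt).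

Lemma shD x y : sh (x + y) = sh x + sh y.
Proof. by apply/rowP => i; rewrite !mxE. Qed.

Lemma shZ (k : R) x : sh (k *: x) = k *: sh x.
Proof. by apply/rowP => i; rewrite !mxE. Qed.

Lemma shB x y : sh (x - y) = sh x - sh y.
Proof. by apply/rowP => i; rewrite !mxE. Qed.

Lemma sh_seg x y z : seg x y z -> seg (sh x) (sh y) (sh z).
Proof. by move=> [t t01 ->]; exists t => //; rewrite shD shZ shB. Qed.

Definition vert : pt := delta_mx 0 ord_max.

Lemma sh_vert : sh vert = 0.
Proof.
by apply/rowP => i; rewrite !mxE eqxx/= eq_sym (negPf (neq_lift _ _)).
Qed.

Lemma sh_inj_height x y : sh x = sh y -> height x = height y -> x = y.
Proof.
move=> /rowP sxy hxy; apply/rowP => i.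
have [j ->|->] := unliftP ord_max i; last exact: hxy.
by have := sxy j; rewrite !mxE.
Qed.

Lemma heightD x y : height (x + y) = height x + height y.
Proof. by rewrite /height mxE. Qed.

Lemma heightZ (k : R) x : height (k *: x) = k * height x.
Proof. by rewrite /height mxE. Qed.

Lemma heightB x y : height (x - y) = height x - height y.
Proof. by rewrite /height !mxE. Qed.

Lemma height_vert : height vert = 1.
Proof. by rewrite /height mxE !eqxx. Qed.

Lemma seg_sh_inj x y z z' : sh x <> sh y -> seg x y z -> seg x y z' ->
  sh z = sh z' -> z = z'.
Proof.
move=> nxy [t _ ->] [t' _ ->]; rewrite !shD !shZ => /addrI/eqP.
rewrite -subr_eq0 -scalerBl scaler_eq0 subr_eq0 => /orP[/eqP->//|].
by rewrite shB subr_eq0 eq_sym => /eqP.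
Qed.

Definition esh e : set 'rV[R]_2 := seg (sh e.1) (sh e.2).
Definition endp x e : Prop := x = e.1 \/ x = e.2.
Definition shares e f : Prop := exists2 x, endp x e & endp x f.
Definition same_ends e f : Prop := e = f \/ e = (f.2, f.1).

(** General position for oriented edges. Only vertices are kept off the shadows of other edges; this
    already prevents shadows from overlapping, see [cross_unique]. Disjointness is asked in
    space. *)
Record good E : Prop := Good {
  good_neq : forall e, e \in E -> sh e.1 <> sh e.2;
  good_vertex : forall e f x, e \in E -> f \in E -> endp x f ->
    esh e (sh x) -> endp x e;
  good_disj : forall e f z, e \in E -> f \in E -> ~ shares e f ->
    seg e.1 e.2 z -> ~ seg f.1 f.2 z;
  good_same : forall e f, e \in E -> f \in E -> same_ends e f -> e = f }.

Definition flip e : edge := (e.2, e.1).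

Lemma esh_flip e : esh (flip e) = esh e.
Proof. by rewrite /esh seg_sym. Qed.

Lemma endp_flip x e : endp x (flip e) <-> endp x e.
Proof. by rewrite /endp /flip/=; split=> -[]; auto. Qed.

Lemma shares_sym e f : shares e f -> shares f e.
Proof. by move=> [x]; exists x. Qed.

Lemma shares_flip e f : shares (flip e) f <-> shares e f.
Proof. by split=> -[x /endp_flip]; exists x. Qed.

Lemma same_ends_sym e f : same_ends e f -> same_ends f e.
Proof. by move=> [->|->]; [left|right; case: f]. Qed.

Lemma esh_end e x : endp x e -> esh e (sh x).
Proof. by move=> [->|->]; [exact: seg_l|exact: seg_r]. Qed.

Let pair_ok e f := forall x, endp x f -> esh e (sh x) -> endp x e.

(** The shadow of [f] runs along that of [e] in the same direction, [k] being the ratio of speeds.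
    Having two common points, they overlap; the later of the two starts lies on both edges, hence is
    a vertex of both, and so is the earlier of the two ends. *)
Let overlap_pos e f (k t1 t2 s1 s2 : R) :
    sh e.1 <> sh e.2 -> pair_ok e f -> pair_ok f e ->
    (forall s, sh f.1 + s *: (sh f.2 - sh f.1) =
      sh e.1 + (t1 + (s - s1) * k) *: (sh e.2 - sh e.1)) ->
    0 < k -> t2 = t1 + (s2 - s1) * k -> t1 != t2 ->
    0 <= t1 <= 1 -> 0 <= t2 <= 1 -> 0 <= s1 <= 1 -> 0 <= s2 <= 1 -> e = f.
Proof.
move=> ne ef fe H k0 t2E t12 t1b t2b s1b s2b.
have ne' : sh e.2 - sh e.1 != 0 by rewrite subr_eq0 eq_sym; apply/eqP.
have einj t t' : sh e.1 + t *: (sh e.2 - sh e.1) =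
    sh e.1 + t' *: (sh e.2 - sh e.1) -> t = t'.
  move=> /addrI/eqP; rewrite -subr_eq0 -scalerBl scaler_eq0 (negPf ne') orbF.
  by rewrite subr_eq0 => /eqP.
have f1 : sh f.1 = sh e.1 + (t1 - s1 * k) *: (sh e.2 - sh e.1).
  by have := H 0; rewrite scale0r addr0 sub0r mulNr.
have f2 : sh f.2 = sh e.1 + (t1 + (1 - s1) * k) *: (sh e.2 - sh e.1).
  by have := H 1; rewrite scale1r subrKC.
have e1 : sh e.1 = sh e.1 + 0 *: (sh e.2 - sh e.1) by rewrite scale0r addr0.
have e2 : sh e.2 = sh e.1 + 1 *: (sh e.2 - sh e.1) by rewrite scale1r subrKC.
have [lowt1 lowt2] : t1 - s1 * k < 1 /\ 0 < t1 + (1 - s1) * k.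
  by have [tt|tt|tt] := ltgtP t1 t2; [split; nra|split; nra|rewrite tt eqxx in t12].
have e_at (t : R) s : t1 + (s - s1) * k = t -> 0 <= s <= 1 ->
    forall x, endp x e -> sh x = sh e.1 + t *: (sh e.2 - sh e.1) -> endp x f.
  by move=> st s01 x xe xt; apply: fe => //; exists s => //; rewrite H st.
have E1 : e.1 = f.1.
  have [y0|y0] := lerP 0 (t1 - s1 * k).
    case: (ef f.1 (or_introl erefl)) => //.
      by exists (t1 - s1 * k) => //; lra.
    move=> fe2; move: f1; rewrite fe2 {1}e2 => /einj h; exfalso; slra.
  have := e_at 0 (s1 - t1 / k) _ _ e.1 (or_introl erefl) e1.
  case=> //.
  - by rewrite addrAC subrr add0r mulNr divfK ?gt_eqF// subrr.
  - apply/andP; split.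
      by rewrite subr_ge0 ler_pdivrMr//; lra.
    have : 0 <= t1 / k by apply: divr_ge0; lra.
    lra.
  - move=> ef2; move: f2; rewrite -ef2 {1}e1 => /einj h; exfalso; slra.
have E2 : e.2 = f.2.
  have [y0|y0] := lerP (t1 + (1 - s1) * k) 1.
    case: (ef f.2 (or_intror erefl)) => //.
      by exists (t1 + (1 - s1) * k) => //; lra.
    move=> fe1; move: f2; rewrite fe1 {1}e1 => /einj h; exfalso; slra.
  have := e_at 1 (s1 + (1 - t1) / k) _ _ e.2 (or_intror erefl) e2.
  case=> //.
  - by rewrite [s1 + _]addrC addrK divfK ?gt_eqF//; lra.
  - have h0 : 0 <= (1 - t1) / k by apply: divr_ge0; lra.
    have h1 : (1 - t1) / k <= 1 - s1 by rewrite ler_pdivrMr//; lra.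
    lra.
  - move=> ef1; move: f1; rewrite -ef1 {1}e2 => /einj h; exfalso; slra.
by case: e f E1 E2 {ne ef fe H ne' einj f1 f2 e1 e2 e_at} => [? ?] [? ?] /= -> ->.
Qed.

(* If the shadows of two edges overlapped, an end point of one of them would lie
   inside the other. *)
Lemma cross_unique E e f s s' : good E -> e \in E -> f \in E -> e <> f ->
  esh e s -> esh f s -> esh e s' -> esh f s' -> s = s'.
Proof.
move=> gE eE fE ef [t1 t1b ->] [s1 s1b st1] [t2 t2b ->] [s2 s2b st2].
have [->//|t12] := eqVneq t1 t2; exfalso.
have ne := good_neq gE eE.
have ok1 : pair_ok e f by move=> x; exact: (good_vertex gE eE fE).
have ok2 : pair_ok f e by move=> x; exact: (good_vertex gE fE eE).
have ne' : sh e.2 - sh e.1 != 0 by rewrite subr_eq0 eq_sym; apply/eqP.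
have s12 : s2 - s1 != 0.
  apply/negP; rewrite subr_eq0 => /eqP s12.
  move: st1; rewrite -s12 -st2 => /addrI/eqP.
  rewrite -subr_eq0 -scalerBl scaler_eq0 (negPf ne') orbF subr_eq0.
  by rewrite (negPf t12).
pose k := (t2 - t1) / (s2 - s1).
have k0 : k != 0.
  by rewrite mulf_neq0 ?invr_eq0// subr_eq0 eq_sym.
have W : sh f.2 - sh f.1 = k *: (sh e.2 - sh e.1).
  apply: (scalerI s12); rewrite scalerA mulrC divfK//.
  have -> : (s2 - s1) *: (sh f.2 - sh f.1) =
      (sh f.1 + s2 *: (sh f.2 - sh f.1)) - (sh f.1 + s1 *: (sh f.2 - sh f.1)).
    by apply/rowP => i; rewrite !mxE; ring.
  by rewrite -st1 -st2; apply/rowP => i; rewrite !mxE; ring.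
have H r : sh f.1 + r *: (sh f.2 - sh f.1) =
    sh e.1 + (t1 + (r - s1) * k) *: (sh e.2 - sh e.1).
  rewrite scalerDl addrA st1 -scalerA -W -addrA -scalerDl.
  by rewrite addrCA subrr addr0.
have t2E : t2 = t1 + (s2 - s1) * k.
  by rewrite /k mulrCA divff// mulr1 addrCA subrr addr0.
have [kp|kn] := ltrP 0 k.
  apply: ef; exact: (overlap_pos ne ok1 ok2 H kp t2E).
have kn' : 0 < - k by rewrite oppr_gt0 lt_neqAle k0.
have := @overlap_pos e (flip f) (- k) t1 t2 (1 - s1) (1 - s2) ne.
move=> P; have : e = flip f.
  apply: P => //; rewrite ?esh_flip.
  - by move=> x /endp_flip; exact: ok1.
  - by move=> x xe; rewrite esh_flip endp_flip; exact: ok2.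
  - move=> r; rewrite /flip/=; have := H (1 - r).
    rewrite (_ : t1 + (1 - r - s1) * k = t1 + (r - (1 - s1)) * - k); last ring.
    by move=> <-; apply/rowP => i; rewrite !mxE; ring.
  - by rewrite t2E; ring.
  - lra.
  - lra.
by move=> efl; apply: ef; apply: (good_same gE) => //; right.
Qed.

Lemma adjacent_meet E e f x s : good E -> e \in E -> f \in E -> e <> f ->
  endp x e -> endp x f -> esh e s -> esh f s -> s = sh x.
Proof.
move=> gE eE fE ef xe xf es fs.
by apply: (cross_unique gE eE fE ef) => //; exact: esh_end.
Qed.

Lemma good_sub E E' : {subset E' <= E} -> good E -> good E'.
Proof.
move=> sub [h1 h2 h3 h4]; split.
- by move=> e /sub; exact: h1.
- by move=> e f x /sub + /sub; exact: h2.
- by move=> e f z /sub + /sub; exact: h3.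
- by move=> e f /sub + /sub; exact: h4.
Qed.

End Shadows.

(** * Distance between disjoint segments *)

Section Separation.
Context {R : realType} {n : nat}.
Local Notation V := 'rV[R]_n.+1.
Implicit Types (a b c d z w : V).

Lemma sep_seg a b c d : (forall z, seg a b z -> ~ seg c d z) ->
  exists2 eta : R, 0 < eta &
    forall z w, seg a b z -> seg c d w -> eta <= `|z - w|.
Proof.
move=> H.
pose F (x : R * R) : V := a + x.1 *: (b - a) - (c + x.2 *: (d - c)).
have cF : continuous F.
  apply: contB; (apply: contD; first exact: cont_cst);
  by apply: contZ; [exact: cont_fst || exact: cont_snd|exact: cont_cst].
pose I01 := `[0 : R, 1]%classic.
have K0 : I01 `*` I01 !=set0.
  by exists (0, 0); split; rewrite /I01/= in_itv/= lexx ler01.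
have cK : compact (I01 `*` I01) by apply: compact_setX; exact: segment_compact.
have cN : {within I01 `*` I01, continuous (fun x => `|F x|)}.
  by apply: continuous_subspaceT; exact: cont_norm.
have [[s t] + zmin] := compact_EVT_min K0 cK cN.
rewrite inE => -[/= + +].
rewrite /I01/= !in_itv/= => s01 t01.
exists `|F (s, t)|.
  rewrite normr_gt0; apply/eqP => /eqP; rewrite subr_eq0 => /eqP Fst.
  by apply: (H (a + s *: (b - a))); [exists s|rewrite Fst; exists t].
move=> _ _ [s' s01' ->] [t' t01' ->].
by apply: (zmin (s', t')); rewrite inE; split; rewrite /I01/= in_itv.
Qed.

Lemma near_avoid (C : R) a b c d : (forall z, seg a b z -> ~ seg c d z) ->
  evsmall (fun e => forall z0 z, seg a b z0 -> `|z - z0| <= C * e ->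
    ~ seg c d z).
Proof.
move=> /sep_seg[eta eta0 H].
have C0 : 0 < `|C| + 1 by have := normr_ge0 C; lra.
have : 0 < eta / (2 * (`|C| + 1)) by apply: divr_gt0 => //; lra.
move=> /ev_le; apply: ev_mono => e e0; rewrite ler_pdivlMr; last lra.
move=> ee z0 z z0s zz zs; have := H _ _ z0s zs; rewrite distrC.
have := ler_norm C; nra.
Qed.

End Separation.

(** * Preservation of general position *)

Section Good.
Context {R : realType}.
Local Notation pt := 'rV[R]_3.
Local Notation edge := (pt * pt)%type.
Local Notation sh := (@proj_plane R).
Implicit Types (e f g : edge) (E F : seq edge) (x y z w : pt).

(** The pairwise content of [good], which lets a set be extended one edge at a time by [good_cons];
    excluding [same_ends] also ensures that the new edge is not yet in the set. *)
Definition compat e f : Prop :=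
  [/\ forall x, endp x f -> esh e (sh x) -> endp x e,
      forall x, endp x e -> esh f (sh x) -> endp x f,
      ~ shares e f -> forall z, seg e.1 e.2 z -> ~ seg f.1 f.2 z &
      ~ same_ends e f].

Lemma compat_flip e f : compat (flip e) f -> compat e f.
Proof.
move=> [h1 h2 h3 h4]; split.
- by move=> x xf; rewrite -esh_flip => /(h1 _ xf) /endp_flip.
- by move=> x /endp_flip; exact: h2.
- move=> nef z ze; apply: h3; first by move=> /shares_flip.
  by rewrite seg_sym.
- move=> ef; apply: h4; case: ef => [->|->]; first by right.
  by left; rewrite /flip; case: f {h1 h2 h3}.
Qed.

Lemma good_cons e F : good F -> sh e.1 <> sh e.2 ->
  (forall f, f \in F -> compat e f) -> good (e :: F).
Proof.
move=> [g1 g2 g3 g4] ne H; split.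
- by move=> f; rewrite inE => /orP[/eqP->//|]; exact: g1.
- move=> f f' x; rewrite !inE => /orP[/eqP->|fF] /orP[/eqP->|fF']//.
  + by have [] := H _ fF'; auto.
  + by have [] := H _ fF; auto.
  + exact: g2.
- move=> f f' z; rewrite !inE => /orP[/eqP->|fF] /orP[/eqP->|fF'].
  + by case; exists e.1; left.
  + by have [] := H _ fF'; auto.
  + have [_ _ h _] := H _ fF; move=> nfe zf ze.
    by apply: (h _ z) => // /shares_sym.
  + exact: g3.
- move=> f f'; rewrite !inE => /orP[/eqP->|fF] /orP[/eqP->|fF']//.
  + by have [] := H _ fF'.
  + by have [_ _ _ h] := H _ fF => /same_ends_sym.
  + exact: g4.
Qed.

Lemma good_compat e F f : good (e :: F) -> e \notin F -> f \in F -> compat e f.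
Proof.
move=> gE eF fF.
have e0 : e \in e :: F by rewrite mem_head.
have f0 : f \in e :: F by rewrite inE fF orbT.
split.
- by move=> x; exact: (good_vertex gE).
- by move=> x; exact: (good_vertex gE).
- by move=> nef z; exact: (good_disj gE).
- by move=> /(good_same gE e0 f0) ef; rewrite ef fF in eF.
Qed.

Lemma compat_notin e F : (forall f, f \in F -> compat e f) -> e \notin F.
Proof. by move=> H; apply/negP => /H[_ _ _]; case; left. Qed.

Lemma good_cat_eq E E' : E =i E' -> good E -> good E'.
Proof. by move=> EE; apply: good_sub => e; rewrite EE. Qed.

Lemma seg_cut (W : lmodType R) (a b z : W) (t : R) : 0 < t < 1 ->
  seg a (a + t *: (b - a)) z -> exists2 s, 0 <= s < 1 & z = a + s *: (b - a).
Proof.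
move=> t01 [s s01 ->]; exists (s * t); first by nra.
by rewrite [a + _ - a]addrC addKr scalerA.
Qed.

Lemma seg_cutW (W : lmodType R) (a b z : W) (t : R) : 0 < t < 1 ->
  seg a (a + t *: (b - a)) z -> seg a b z.
Proof. by move=> t01 /seg_cut -/(_ t01)[s s01 ->]; exists s => //; lra. Qed.

Lemma seg_cut_end (W : lmodType R) (a b : W) (t : R) : a <> b -> 0 < t < 1 ->
  ~ seg a (a + t *: (b - a)) b.
Proof.
move=> ab t01 /seg_cut -/(_ t01)[s s01 H].
have H' : s *: (b - a) = b - a by rewrite [in RHS]H [a + _]addrC addrK.
have /eqP : (1 - s) *: (b - a) = 0 by rewrite scalerBl scale1r H' subrr.
rewrite scaler_eq0 !subr_eq0 => /orP[/eqP s1|/eqP ba].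
  by move: s01; rewrite -s1 ltxx andbF.
exact: ab.
Qed.

(* The piece from [a] of an edge subdivided at [m]. *)
Lemma compat_cut a b F (t : R) (m := a + t *: (b - a)) :
    good ((a, b) :: F) -> (a, b) \notin F -> 0 < t < 1 ->
    (forall f, f \in F -> ~ esh f (sh m)) ->
  forall f, f \in F -> compat (a, m) f.
Proof.
move=> gE gF t01 mF f fF.
have [c1 c2 c3 c4] := good_compat gE gF fF.
have ne : sh a <> sh b by apply: (good_neq gE (e := (a, b))); rewrite mem_head.
have shm : sh m = sh a + t *: (sh b - sh a) by rewrite /m shD shZ shB.
have sub s : esh (a, m) s -> esh (a, b) s.
  by rewrite /esh/= shm; exact: seg_cutW.
have nb : ~ esh (a, m) (sh b) by rewrite /esh/= shm; exact: seg_cut_end.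
have mf : ~ endp m f by move=> /esh_end; exact: mF.
split.
- move=> x xf xm; have [->|xb] := c1 x xf (sub _ xm); first by left.
  by move: xm; rewrite xb.
- move=> x [->|->]; last by move=> /mF.
  by apply: c2; left.
- move=> nsh z zam zf.
  have zab : seg a b z by exact: seg_cutW zam.
  have [[x xab xf]|nab] := pselect (shares (a, b) f); last exact: (c3 nab z).
  have xE : x = b by case: xab => // xa; case: nsh; exists x; [left|].
  have ef : (a, b) <> f by move=> ef; apply: c4; left.
  have := @adjacent_meet _ _ (a, b) f x (sh z) gE (mem_head _ _) _ ef xab xf.
  rewrite inE fF orbT => /(_ isT) H; apply: nb; rewrite -xE -H.
  + exact: sh_seg zam.
  + exact: sh_seg zab.
  + exact: sh_seg zf.
- by case=> [E|[_ E]]; apply: mf; [right; rewrite -E|left].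
Qed.

Lemma good_subdiv a b F (t : R) (m := a + t *: (b - a)) :
    good ((a, b) :: F) -> (a, b) \notin F -> 0 < t < 1 ->
    (forall f, f \in F -> ~ esh f (sh m)) ->
  good ((a, m) :: (m, b) :: F) /\
  ((a, m) \notin (m, b) :: F /\ (m, b) \notin F).
Proof.
move=> gE gF t01 mF.
have ne : sh a <> sh b by apply: (good_neq gE (e := (a, b))); rewrite mem_head.
have shm : sh m = sh a + t *: (sh b - sh a) by rewrite /m shD shZ shB.
have mE : m = b + (1 - t) *: (a - b) by apply/rowP => i; rewrite !mxE; ring.
have nb : ~ esh (a, m) (sh b) by rewrite /esh/= shm; exact: seg_cut_end.
have na : ~ esh (m, b) (sh a).
  rewrite /esh/= seg_sym mE shD shZ shB; apply: seg_cut_end; last by lra.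
  by move=> /esym.
have am : sh a <> sh m by move=> am; apply: na; rewrite am; exact: seg_l.
have bm : sh b <> sh m by move=> bm; apply: nb; rewrite bm; exact: seg_r.
have C1 := compat_cut gE gF t01 mF.
have C2 f : f \in F -> compat (m, b) f.
  move=> fF; apply: compat_flip.
  have gF' : (b, a) \notin F.
    apply/negP => baF; have [_ _ _] := good_compat gE gF baF.
    by case; right.
  have gE' : good ((b, a) :: F).
    apply: good_cons; first by apply: good_sub gE => e eF; rewrite inE eF orbT.
      by move=> /esym.
    by move=> e eF; apply: compat_flip; exact: (good_compat gE gF).
  have /(compat_cut gE' gF') : 0 < 1 - t < 1 by lra.
  by rewrite -mE; apply.
have C3 : compat (a, m) (m, b).
  split.
  - by move=> x [->|->]; [right|move=> /nb].
  - by move=> x [->|->]; [move=> /na|left].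
  - by case; exists m; [right|left].
  - by case=> E; [exact: (am (congr1 (sh \o fst) E))
      |exact: (ne (congr1 (sh \o fst) E))].
have C13 f : f \in (m, b) :: F -> compat (a, m) f.
  by rewrite inE => /orP[/eqP->//|]; exact: C1.
split; last by split; apply: compat_notin.
apply: good_cons => //; apply: good_cons => //; last by move=> /esym.
by apply: good_sub gE => e eF; rewrite inE eF orbT.
Qed.

Let compat_side x y c F :
    good ((x, y) :: F) -> (x, y) \notin F ->
    indep (sh y - sh x) (sh c - sh x) ->
    (forall f z, f \in F -> seg f.1 f.2 z -> tri x y c z ->
      (z = x \/ z = y) /\ endp z f) ->
    (forall f w, f \in F -> endp w f -> ~ endp w (x, y) -> ~ esh (x, c) (sh w)) ->
    (forall f, f \in F -> ~ esh f (sh c)) ->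
    ~ esh (x, c) (sh y) ->
  forall f, f \in F -> compat (x, c) f.
Proof.
move=> gE gF ind T W Cc ny f fF.
have [c1 c2 c3 c4] := good_compat gE gF fF.
split.
- move=> w wf wxc; have [[->|wy]|nw] := pselect (endp w (x, y)).
  + by left.
  + by move: wxc; rewrite wy => /ny.
  + by case: (W _ _ fF wf nw).
- by move=> w [->|->]; [apply: c2; left|move=> /Cc].
- move=> nsh z zxc zf.
  have zt : tri x y c z.
    case: zxc => s s01 ->; exists 0, s.
    by split; rewrite ?scale0r ?addr0//; lra.
  have [[zx|zy] zef] := T f z fF zf zt.
    by case: nsh; exists z => //; left.
  by apply: ny; rewrite -zy; exact: sh_seg zxc.
- by case=> [E|[_ E]]; apply: (Cc f fF); apply: esh_end;
    [right; rewrite -E|left].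
Qed.

Lemma indep_side n (x y c : 'rV[R]_n) :
  indep (y - x) (c - x) -> ~ seg x c y.
Proof.
move=> ind [s s01 ys]; have [] := ind 1 (- s).
  by rewrite ys scale1r [x + _]addrC addrK scaleNr subrr.
by move=> /eqP; rewrite oner_eq0.
Qed.

Lemma tri_swap n (x y c z : 'rV[R]_n) : tri x y c z -> tri y x c z.
Proof.
move=> [s [t [s0 t0 st ->]]]; exists (1 - s - t), t; split; [lra|lra|lra|].
by apply/rowP => i; rewrite !mxE; ring.
Qed.

Lemma indep_swap n (x y c : 'rV[R]_n) :
  indep (y - x) (c - x) -> indep (x - y) (c - y).
Proof.
move=> ind s t H; have [] := ind (- s - t) t; last by move=> ? ?; split; lra.
by rewrite -[RHS]H; apply/rowP => i; rewrite !mxE; ring.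
Qed.

(** The triangle has to be free of other edges in space, whereas its shadow may be crossed by
    theirs: in the shadow only vertices are restricted. *)
Lemma good_delta x y c F :
    good ((x, y) :: F) -> (x, y) \notin F ->
    indep (sh y - sh x) (sh c - sh x) ->
    (forall f z, f \in F -> seg f.1 f.2 z -> tri x y c z ->
      (z = x \/ z = y) /\ endp z f) ->
    (forall f w, f \in F -> endp w f -> ~ endp w (x, y) ->
      ~ esh (x, c) (sh w) /\ ~ esh (c, y) (sh w)) ->
    (forall f, f \in F -> ~ esh f (sh c)) ->
  [/\ good ((x, c) :: (c, y) :: F),
      (x, c) \notin (c, y) :: F, (c, y) \notin F &
      ambient_isotopic (trace_of ((x, y) :: F))
        (trace_of ((x, c) :: (c, y) :: F))].
Proof.
move=> gE gF ind T W Cc.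
have ny : ~ esh (x, c) (sh y) by exact: indep_side ind.
have ind' := indep_swap ind.
have nx : ~ esh (c, y) (sh x) by rewrite /esh seg_sym; exact: indep_side ind'.
have C1 : forall f, f \in F -> compat (x, c) f.
  by apply: (compat_side gE gF) => // f w fF wf nw; have [] := W f w fF wf nw.
have C2 f : f \in F -> compat (c, y) f.
  move=> fF; apply: compat_flip.
  have gF' : (y, x) \notin F.
    apply/negP => baF; have [_ _ _] := good_compat gE gF baF.
    by case; right.
  have gE' : good ((y, x) :: F).
    apply: good_cons; first by apply: good_sub gE => e eF; rewrite inE eF orbT.
      by move=> E; exact: (good_neq gE (mem_head _ _) (esym E)).
    by move=> e eF; apply: compat_flip; exact: (good_compat gE gF).
  apply: (compat_side gE' gF') => //.
  - move=> f' z f'F zf' /tri_swap zt; have [[->|->] ?] := T f' z f'F zf' zt.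
      by split; [right|].
    by split; [left|].
  - move=> f' w f'F wf' nw; rewrite /esh seg_sym.
    have [] // := W f' w f'F wf'.
    by move=> [wx|wy]; apply: nw; [right|left].
  - by rewrite /esh seg_sym.
have xc : sh x <> sh c.
  move=> xc; have [] := ind 0 1; last by move=> _ /eqP; rewrite oner_eq0.
  by rewrite xc subrr scaler0 addr0 scale0r.
have yc : sh y <> sh c.
  move=> yc; have [] := ind' 0 1; last by move=> _ /eqP; rewrite oner_eq0.
  by rewrite yc subrr scaler0 addr0 scale0r.
have C3 : compat (x, c) (c, y).
  split.
  - by move=> w [->|->]; [right|move=> /ny].
  - by move=> w [->|->]; [move=> /nx|left].
  - by case; exists c; [right|left].
  - by case=> E; [exact: (xc (congr1 (sh \o fst) E))
      |exact: (good_neq gE (mem_head _ _) (congr1 (sh \o fst) E))].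
have C13 f : f \in (c, y) :: F -> compat (x, c) f.
  by rewrite inE => /orP[/eqP->//|]; exact: C1.
split; try exact: compat_notin.
  apply: good_cons => //; apply: good_cons => //; last by move=> /esym.
  by apply: good_sub gE => e eF; rewrite inE eF orbT.
have ind3 : indep (y - x) (c - x).
  move=> s t H; apply: ind; rewrite -!shB -!shZ -shD H.
  by apply/rowP => i; rewrite !mxE.
have T3 e z : e \in F -> seg e.1 e.2 z -> tri x y c z ->
    (z = x \/ z = y) /\ (z = e.1 \/ z = e.2) by exact: T.
have := delta_isotopy ind3 T3.
by rewrite !trace_cons/= ![_ `|` trace_of F]setUC setUCA.
Qed.

End Good.

(** * Sliding an edge along a black edge *)

Section Thin.
Context {R : realType} {n : nat}.
Local Notation V := 'rV[R]_n.+1.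

(** The strip extends beyond [p + D] by the fraction [e], since the apex of the thin triangle has to
    lie past the vertex [v]. *)
Lemma thin_avoid (p D u c d : V) : (forall z, seg p (p + D) z -> ~ seg c d z) ->
  evsmall (fun e : R => forall xi eta : R, 0 <= xi <= 1 + e -> `|eta| <= e ->
    ~ seg c d (p + xi *: D + eta *: u)).
Proof.
move=> /(near_avoid (`|D| + `|u|)); apply: ev_mono => e e0 H xi eta xib etab.
have D0 := normr_ge0 D; have u0 := normr_ge0 u.
have [x1|x1] := lerP xi 1.
  apply: (H (p + xi *: D)).
    by exists xi; [lra|rewrite [p + D]addrC addrK].
  by rewrite [_ + eta *: u]addrC addrK normrZ; nra.
apply: (H (p + D)); first exact: seg_r.
have -> : p + xi *: D + eta *: u - (p + D) = (xi - 1) *: D + eta *: u.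
  by apply/rowP => i; rewrite !mxE; ring.
apply: (le_trans (ler_normD _ _)); rewrite !normrZ ger0_norm; last lra.
by nra.
Qed.

Lemma indep_coord (p D u : V) (x y x' y' : R) : indep D u ->
  p + x *: D + y *: u = p + x' *: D + y' *: u -> x = x' /\ y = y'.
Proof.
move=> ind H; have [] := ind (x - x') (y - y'); last by move=> *; split; lra.
rewrite -[0](subrr (p + x' *: D + y' *: u)) -{1}H.
by apply/rowP => i; rewrite !mxE; ring.
Qed.

End Thin.

Lemma mem_swap2 (T : eqType) (x y : T) (s : seq T) :
  [:: x, y & s] =i [:: y, x & s].
Proof. by move=> z; rewrite !inE orbCA. Qed.

Lemma mem_rot4 (T : eqType) (x y z t : T) (s : seq T) :
  [:: x, y, z, t & s] =i [:: t, x, y, z & s].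
Proof.
move=> w; rewrite !inE.
by case: (w == x); case: (w == y); case: (w == z); case: (w == t).
Qed.

Section Crosses.
Context {R : realType}.
Local Notation pt := 'rV[R]_3.
Local Notation edge := (pt * pt)%type.
Local Notation sh := (@proj_plane R).
Implicit Types (e f g : edge) (E F : seq edge) (x y z w : pt).

Lemma seg_split a b (t : R) : 0 < t < 1 ->
  seg a b = seg a (a + t *: (b - a)) `|` seg (a + t *: (b - a)) b :> set pt.
Proof.
move=> t01; apply/seteqP; split=> [z [k k01 ->]|z []].
- have [kt|tk] := lerP k t; [left|right].
    exists (k / t); first by rewrite divr_ge0 ?ler_pdivrMr ?mul1r//=; lra.
    by rewrite [a + _ - a]addrC addKr scalerA divfK// gt_eqF//; lra.
  exists ((k - t) / (1 - t)).
    by rewrite divr_ge0 ?ler_pdivrMr ?mul1r//=; lra.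
  have t1 : 1 - t != 0 by rewrite gt_eqF//; lra.
  by apply/rowP => i; rewrite !mxE; field; exact: t1.
- exact: seg_cutW.
- move=> [k k01 ->]; exists (t + k * (1 - t)); first nra.
  by apply/rowP => i; rewrite !mxE; ring.
Qed.

Lemma trace_split a b F (t : R) : 0 < t < 1 -> trace_of ((a, b) :: F) =
  trace_of [:: (a, a + t *: (b - a)), (a + t *: (b - a), b) & F].
Proof. by move=> /(seg_split a b) h; rewrite !trace_cons/= setUA -h. Qed.

Definition crosses e f : Prop := ~ shares e f /\ exists s, esh e s /\ esh f s.

End Crosses.

Module Slide.
Section Slide.
Context {R : realType}.
Local Notation pt := 'rV[R]_3.
Local Notation edge := (pt * pt)%type.
Local Notation sh := (@proj_plane R).
Implicit Types (e f g : edge) (E F : seq edge) (x y z w : pt).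

(** The edge [(a, b)] is slid along [gam] past [v]. The crossing is at [tau] on [(a, b)] and at [r]
    on [gam], and [p] is the point of [(a, b)] there. In the plane, [D] and [U] are coordinate
    vectors with origin at the crossing, so that [v] is at (1, 0). *)
Variables (a b v v' : pt) (F : seq edge) (tau r : R).
Let gam : edge := (v, v').
Let p : pt := a + tau *: (b - a).
Let u : pt := b - a.
Let U := sh u.
Let D := sh v - sh p.
Hypotheses (gE : good ((a, b) :: F)) (gF : (a, b) \notin F).
Hypotheses (gamF : gam \in F) (nsh : ~ shares (a, b) gam).
Hypotheses (tau01 : 0 <= tau <= 1) (r01 : 0 <= r <= 1).
Hypothesis pgam : sh p = sh v + r *: (sh v' - sh v).

Lemma gamE : gam \in (a, b) :: F. Proof. by rewrite inE gamF orbT. Qed.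
Lemma gE0 : (a, b) \in (a, b) :: F. Proof. exact: mem_head. Qed.
Lemma FE f : f \in F -> f \in (a, b) :: F. Proof. by move=> fF; rewrite inE fF orbT. Qed.
#[local] Hint Resolve gamE gE0 FE : core.
Lemma gnf f : f \in F -> (a, b) <> f.
Proof. by move=> fF gf; move: gF; rewrite gf fF. Qed.

Lemma shp : sh p = sh a + tau *: (sh b - sh a).
Proof. by rewrite /p shD shZ shB. Qed.

Lemma p_g : esh (a, b) (sh p). Proof. by exists tau; last exact: shp. Qed.
Lemma p_gam : esh gam (sh p). Proof. by exists r. Qed.
#[local] Hint Resolve p_g p_gam : core.

Lemma endp_gF w : endp w (a, b) -> esh gam (sh w) -> False.
Proof.
by move=> wab /(good_vertex gE gamE gE0 wab) wg; apply: nsh; exists w.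
Qed.

Lemma endp_gam w : endp w gam -> esh (a, b) (sh w) -> False.
Proof.
by move=> wg /(good_vertex gE gE0 gamE wg) wab; apply: nsh; exists w.
Qed.

Lemma tau_int : 0 < tau < 1.
Proof.
have /andP[t0 t1] := tau01; rewrite !lt_neqAle t0 t1 !andbT.
apply/andP; split; apply/eqP => tE.
- by apply: (endp_gF (or_introl erefl)); move: p_gam; rewrite /p -tE scale0r addr0.
- by apply: (endp_gF (or_intror erefl)); move: p_gam; rewrite /p tE scale1r subrKC.
Qed.

Lemma r_int : 0 < r < 1.
Proof.
have /andP[t0 t1] := r01; rewrite !lt_neqAle t0 t1 !andbT.
apply/andP; split; apply/eqP => tE.
- by apply: (endp_gam (or_introl erefl)); move: p_g; rewrite pgam -tE scale0r addr0.
- by apply: (endp_gam (or_intror erefl)); move: p_g; rewrite pgam tE scale1r subrKC.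
Qed.

Ltac tlra := first [lra | have := r_int; have := tau_int; lra].
Ltac tnra := first [nra | have := r_int; have := tau_int; nra].

Lemma vv' : sh v <> sh v'. Proof. exact: (good_neq gE gamE). Qed.
Lemma ab : sh a <> sh b. Proof. exact: (good_neq gE gE0). Qed.

Lemma UE : U = sh b - sh a. Proof. by rewrite /U /u shB. Qed.
Lemma U0 : U != 0. Proof. by rewrite UE subr_eq0 eq_sym; apply/eqP/ab. Qed.
Lemma DE : D = - r *: (sh v' - sh v).
Proof. by rewrite /D pgam opprD addNKr scaleNr. Qed.
Lemma D0 : D != 0.
Proof.
apply/negP; rewrite DE scaler_eq0 oppr_eq0 subr_eq0 => /orP[/eqP r0|/eqP v'v].
  by move: r_int; rewrite r0 ltxx.
exact: vv'.
Qed.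

Lemma p_unique s : esh (a, b) s -> esh gam s -> s = sh p.
Proof.
move=> sg sgam; exact: (cross_unique gE gE0 gamE (gnf gamF) sg sgam p_g p_gam).
Qed.

Lemma g_pt (k : R) : - tau <= k <= 1 - tau -> esh (a, b) (sh p + k *: U).
Proof.
move=> kb; exists (tau + k); first tlra.
by rewrite shp UE/=; apply/rowP => i; rewrite !mxE; ring.
Qed.

(** So [gam] has second coordinate 0 and first coordinate at most 1: a path that changes sides
    beyond 1 misses it. *)
Lemma gam_pt s : esh gam s -> exists2 k : R, k <= 1 & s = sh p + k *: D.
Proof.
move=> [t /andP[t0 t1] ->]; have /andP[r0 _] := r_int.
exists (1 - t / r).
  by rewrite gerBl divr_ge0// ltW.
have {}r0 : r != 0 by exact: lt0r_neq0.
rewrite DE pgam; apply/rowP => i; rewrite !mxE; field; exact: r0.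
Qed.

Lemma pv_gam s : seg (sh p) (sh v) s -> esh gam s.
Proof.
move=> [t t01 ->]; exists (r * (1 - t)); first tnra.
by rewrite -/D DE pgam; apply/rowP => i; rewrite !mxE; ring.
Qed.

Lemma pvE s : seg (sh p) (sh p + D) s = seg (sh p) (sh v) s.
Proof. by rewrite /D subrKC. Qed.

Lemma indDU : indep D U.
Proof.
have key (k : R) : D = k *: U -> False.
  move=> DU.
  (* This [e] is small enough for [sh p + e *: D] to lie on both edges, against [p_unique]. *)
  pose e := Num.min 1 (Num.min tau (1 - tau) / (1 + `|k|)).
  have k1 : 0 < 1 + `|k| by have := normr_ge0 k; tlra.
  have m0 : 0 < Num.min tau (1 - tau) by rewrite lt_min; apply/andP; split; tlra.
  have e0 : 0 < e by rewrite lt_min ltr01 divr_gt0.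
  have e1 : e <= 1 by rewrite ge_min lexx.
  have ek : e * (1 + `|k|) <= Num.min tau (1 - tau).
    by rewrite -ler_pdivlMr// ge_min lexx orbT.
  have ekb : `|e * k| <= Num.min tau (1 - tau).
    by rewrite normrM gtr0_norm//; apply: le_trans ek; tnra.
  move: ekb; rewrite le_min !ler_norml => /andP[/andP[h1 h2] /andP[h3 h4]].
  have : sh p + e *: D = sh p.
    apply: p_unique.
      by rewrite DU scalerA; apply: g_pt; tlra.
    by apply: pv_gam; exists e => //; tlra.
  move/eqP; rewrite -subr_eq0 addrAC subrr add0r scaler_eq0 (negPf D0) orbF.
  by rewrite gt_eqF.
move=> s t H.
have s0 : s = 0.
  apply: contrapT => /eqP s0; apply: (key (- (t / s))).
  apply: (scalerI s0); rewrite scalerA mulrN mulrCA divff// mulr1 scaleNr.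
  by apply/eqP; rewrite -addr_eq0 H.
split=> //; move/eqP: H; rewrite s0 scale0r add0r scaler_eq0 (negPf U0) orbF.
by move/eqP.
Qed.

Let pgam3 : pt := v + r *: (v' - v).
Let c0 : R := height pgam3 - height p.

Lemma shpgam3 : sh pgam3 = sh p. Proof. by rewrite pgam /pgam3 shD shZ shB. Qed.

Lemma c0_neq0 : c0 != 0.
Proof.
rewrite /c0 subr_eq0; apply/eqP => h.
have pE : pgam3 = p by apply: sh_inj_height => //; exact: shpgam3.
apply: (good_disj gE gE0 gamE nsh (z := p)); first by exists tau.
by rewrite -pE; exists r.
Qed.

(* A point far above or below [v], on the side of [gam] where [p] lies: the steep
   segment from [p] to [low d] misses all edges. *)
Let low (d : R) : pt := v - (c0 / d) *: vert.

Lemma sh_low d : sh (low d) = sh v.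
Proof. by rewrite /low shB shZ sh_vert scaler0 subr0. Qed.

Lemma sh_lowpt d s : sh (p + s *: (low d - p)) = sh p + s *: (sh v - sh p).
Proof. by rewrite shD shZ (shB (low d)) sh_low. Qed.

Lemma height_lowpt d s : height (p + s *: (low d - p)) =
  height p + s * (height v - c0 / d - height p).
Proof.
by rewrite heightD heightZ (heightB (low d)) /low heightB heightZ height_vert mulr1.
Qed.

Lemma p_notin f : f \in F -> ~ seg f.1 f.2 p.
Proof.
move=> fF pf; have [[x xg xf]|nfg] := pselect (shares (a, b) f); last first.
  by apply: (good_disj gE gE0 (FE fF) nfg (z := p)) => //; exists tau.
have px := adjacent_meet gE gE0 (FE fF) (gnf fF) xg xf p_g (sh_seg pf).
by apply: (endp_gF xg); rewrite -px.
Qed.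

(** Over [gam] the heights differ by [c0 * (1 - s + s / d)], which is never 0. Any other edge has at
    most one point over the segment from [sh p] to [sh v]. If that point is over [sh p], it is not
    [p] by [p_notin]; elsewhere the height of the steep segment is unbounded as [d] tends to 0. *)
Lemma low_avoid f : f \in F ->
  evsmall (fun d => forall z, seg p (low d) z -> ~ seg f.1 f.2 z).
Proof.
move=> fF.
have fne := good_neq gE (FE fF).
have [fg|fg] := eqVneq f gam.
  rewrite fg; apply: ev_true => d d0 z [s s01 zE] zg.
  pose z' := pgam3 + s *: (v - pgam3).
  have z'g : seg gam.1 gam.2 z'.
    exists (r * (1 - s)); first tnra.
    by rewrite /z' /pgam3/=; apply/rowP => i; rewrite !mxE; ring.
  have zz' : z = z'.
    apply: (seg_sh_inj vv' zg z'g).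
    by rewrite zE sh_lowpt /z' shD shZ shB shpgam3.
  have := congr1 (@height R) zz'.
  rewrite zE height_lowpt /z' heightD heightZ (heightB v).
  have -> : height pgam3 = height p + c0 by rewrite /c0 subrKC.
  move=> H; have {}H : c0 * (s / d + (1 - s)) = 0 by tlra.
  move/eqP: H; rewrite mulf_eq0 (negPf c0_neq0)/= => /eqP H.
  have sd : 0 <= s / d by apply: divr_ge0; tlra.
  have sd0 : s / d = 0 by tlra.
  move/eqP: sd0; rewrite mulf_eq0 invr_eq0 (gt_eqF d0) orbF => /eqP s0.
  by move: H; rewrite s0 mul0r; tlra.
have gf : gam <> f by move=> gf; rewrite gf eqxx in fg.
have [[y [s [ys yf]]]|none] :=
    pselect (exists y s, seg (sh p) (sh v) s /\ seg f.1 f.2 y /\ sh y = s); last first.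
  apply: ev_true => d d0 z zs zf; apply: none; exists z, (sh z); split=> //.
  by rewrite -(sh_low d); exact: sh_seg.
case: yf => yf sy; subst s.
case: (ys) => s s01 yE.
have uniq_y d z : seg p (low d) z -> seg f.1 f.2 z -> z = y.
  move=> zs zf; apply: (seg_sh_inj fne zf yf).
  apply: (cross_unique gE gamE (FE fF) gf).
  - by apply: pv_gam; rewrite -(sh_low d); exact: sh_seg.
  - exact: sh_seg.
  - exact: pv_gam.
  - exact: sh_seg.
have s_param d z t : z = p + t *: (low d - p) -> z = y -> t = s.
  move=> zE zy; move: yE; rewrite -zy zE sh_lowpt => /addrI/eqP.
  rewrite -subr_eq0 -scalerBl scaler_eq0 (negPf D0) orbF subr_eq0.
  by move/eqP.
have [s0|s0] := eqVneq s 0.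
  apply: ev_true => d d0 z zs zf; have zy := uniq_y d z zs zf.
  case: zs => t t01 zE; have ts := s_param d z t zE zy.
  by apply: (p_notin fF); rewrite -(_ : z = p)// zE ts s0 scale0r addr0.
have sp : 0 < s by rewrite lt_neqAle eq_sym s0; tlra.
pose h := height y - height (p + s *: (v - p)).
have h1 : 0 < `|h| + 1 by have := normr_ge0 h; tlra.
have sc0 : 0 < `|s * c0| by rewrite normr_gt0 mulf_neq0 ?c0_neq0.
have : 0 < `|s * c0| / (2 * (`|h| + 1)) by apply: divr_gt0 => //; tlra.
move=> /ev_le; apply: ev_mono => d d0; rewrite ler_pdivlMr; last tlra.
move=> dle z zs zf; have zy := uniq_y d z zs zf.
case: zs => t t01 zE; have ts := s_param d z t zE zy.
have hE : h * d = - (s * c0).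
  have -> : h = - (s * c0) / d.
    rewrite /h -zy zE ts height_lowpt heightD heightZ (heightB v).
    by field; exact: lt0r_neq0.
  by rewrite divfK// gt_eqF.
have := congr1 Num.norm hE; rewrite normrN normrM (gtr0_norm d0).
tnra.
Qed.

Let region (e : R) (xi eta : R) := 0 <= xi <= 1 + e /\ `|eta| <= e.

Lemma ev_base f : f \in F ->
  evsmall (fun e : R => ~ esh f (sh p + e *: U) /\ ~ esh f (sh p - e *: U)).
Proof.
move=> fF; have [pf|npf] := pselect (esh f (sh p)).
  have tau0 : 0 < Num.min tau (1 - tau) by rewrite lt_min; apply/andP; split; tlra.
  have := ev_le tau0; apply: ev_mono => e e0.
  rewrite le_min => /andP[e1 e2].
  have key k : - tau <= k <= 1 - tau -> k != 0 -> ~ esh f (sh p + k *: U).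
    move=> kb k0 kf.
    have := cross_unique gE gE0 (FE fF) (gnf fF) (g_pt kb) kf p_g pf.
    move/eqP; rewrite -subr_eq0 addrAC subrr add0r scaler_eq0 (negPf U0) orbF.
    by rewrite (negPf k0).
  split; first by apply: key; [tlra|rewrite gt_eqF].
  by rewrite -scaleNr; apply: key; [tlra|rewrite oppr_eq0 gt_eqF].
have : forall z : 'rV[R]_2, seg (sh p) (sh p + 0) z -> ~ esh f z.
  by move=> _ [t _ ->]; rewrite addr0 subrr scaler0 addr0.
move=> /(thin_avoid U); apply: ev_mono => e e0 H.
have H0 k := H 0 k; split.
- have := H0 e; rewrite scale0r addr0; apply; first tlra.
  by rewrite ger0_norm// ltW.
- have := H0 (- e); rewrite scale0r addr0 scaleNr; apply; first tlra.
  by rewrite normrN ger0_norm// ltW.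
Qed.

Lemma ev_tri d f : (forall z, seg p (low d) z -> ~ seg f.1 f.2 z) ->
  evsmall (fun e : R => forall xi eta, region e xi eta ->
    ~ seg f.1 f.2 (p + xi *: (low d - p) + eta *: u)).
Proof.
rewrite -{1}[low d](subrKC p) => /(thin_avoid u); apply: ev_mono => e e0 H.
by move=> xi eta [h1 h2]; exact: H.
Qed.

Lemma ev_shadow f : evsmall (fun e : R =>
  (forall s, esh f s -> ~ seg (sh p) (sh v) s) ->
  forall xi eta, region e xi eta -> ~ esh f (sh p + xi *: D + eta *: U)).
Proof.
have [H|nH] := pselect (forall s, esh f s -> ~ seg (sh p) (sh v) s); last first.
  by apply: ev_true => d _ /nH.
have : forall z : 'rV[R]_2, seg (sh p) (sh p + D) z -> ~ esh f z.
  by move=> z; rewrite pvE => zs /H.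
move=> /(thin_avoid U); apply: ev_mono => e e0 H' _ xi eta [h1 h2].
exact: H'.
Qed.

Lemma v'_off : ~ seg (sh p) (sh v) (sh v').
Proof.
move=> [t /andP[t0 t1] H].
have : (r * t + (1 - r)) *: (sh v' - sh v) = 0.
  have : sh v' - sh p = t *: D by rewrite H [sh p + _]addrC addrK.
  rewrite DE scaleNr scalerN scalerA => H'.
  rewrite scalerDl [r * t]mulrC -[X in X + _]opprK -H' scalerBl scale1r pgam.
  by apply/rowP => i; rewrite !mxE; ring.
move/eqP; rewrite scaler_eq0 subr_eq0 => /orP[/eqP H1|/eqP/esym/vv'//].
by have := r_int; nra.
Qed.

(** The only vertices over [gam] are its ends, and [v'] is off the part from [sh p] to [sh v]. The
    vertex [v] does lie over the strip and is treated by hand in [slide_exists]. *)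
Lemma ev_vertex f w : f \in (a, b) :: F -> endp w f -> w <> v ->
  evsmall (fun e : R => forall xi eta, region e xi eta ->
    sh w <> sh p + xi *: D + eta *: U).
Proof.
move=> fE wf wv.
have : forall z : 'rV[R]_2, seg (sh p) (sh p + D) z -> ~ seg (sh w) (sh w) z.
  move=> z; rewrite pvE => zp [t _]; rewrite subrr scaler0 addr0 => zw.
  rewrite zw in zp; have [//|wv'] := good_vertex gE gamE fE wf (pv_gam zp).
  by apply: v'_off; move: zp; rewrite wv'.
move=> /(thin_avoid U); apply: ev_mono => e e0 H xi eta [h1 h2] E.
by apply: (H xi eta h1 h2); rewrite -E; exact: seg_l.
Qed.

Lemma ev_vertices f : f \in (a, b) :: F ->
  evsmall (fun e : R => forall w, endp w f -> w <> v ->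
    forall xi eta, region e xi eta -> sh w <> sh p + xi *: D + eta *: U).
Proof.
move=> fE.
have H w : endp w f -> evsmall (fun e : R => w <> v ->
    forall xi eta, region e xi eta -> sh w <> sh p + xi *: D + eta *: U).
  move=> wf; have [->|wv] := pselect (w = v); first by apply: ev_true.
  by have := ev_vertex fE wf wv; apply: ev_mono.
have := ev_and (H f.1 (or_introl erefl)) (H f.2 (or_intror erefl)).
by apply: ev_mono => e e0 [h1 h2] w [->|->].
Qed.

(* The quadratic term keeps the apex off the shadows of the edges through [v]. *)
Let apex (e : R) := sh p + (1 + e) *: D + (e ^+ 2 / 2) *: U.

(** Seen from [sh v], the apex lies in the direction [D + (e / 2) *: U], which turns with [e]. An
    edge through [sh v] has a fixed direction, so it contains the apex for at most one [e], and half
    of such a value bounds the good ones. *)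
Lemma ev_apex f : f \in F -> evsmall (fun e : R => ~ esh f (apex e)).
Proof.
move=> fF; have [vf|nvf] := pselect (esh f (sh v)); last first.
  have : forall z : 'rV[R]_2, seg (sh v) (sh v) z -> ~ esh f z.
    by move=> _ [t _ ->]; rewrite subrr scaler0 addr0.
  move=> /(near_avoid (`|D| + `|U|)) /(ev_and (ev_le ltr01)).
  apply: ev_mono => e e0 [e1 H].
  apply: (H (sh v)); first exact: seg_l.
  have -> : apex e - sh v = e *: D + (e ^+ 2 / 2) *: U.
    by rewrite /apex {1}/D; apply/rowP => i; rewrite !mxE; ring.
  apply: (le_trans (ler_normD _ _)); rewrite !normrZ !ger0_norm; [|nra|lra].
  have h : 0 <= e * (1 - e / 2) * `|U| by rewrite !mulr_ge0//; lra.
  by rewrite mulrDl; lra.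
have [fg|fg] := eqVneq f gam.
  apply: ev_true => e e0; rewrite fg => /gam_pt[k _].
  rewrite -[RHS]addr0 -(scale0r U) => /(indep_coord indDU)[_ /eqP].
  by rewrite gt_eqF// divr_gt0// exprn_gt0.
have wE : exists W : 'rV[R]_2, forall s, esh f s -> exists k : R, s = sh v + k *: W.
  have [vE|vE] := good_vertex gE (FE fF) gamE (or_introl erefl) vf.
    exists (sh f.2 - sh f.1) => s [t _ ->]; exists t; by rewrite [v]vE.
  exists (sh f.1 - sh f.2) => s; rewrite /esh seg_sym => -[t _ ->].
  by exists t; rewrite [v]vE.
case: wE => W WE.
have bad (e : R) : 0 < e -> esh f (apex e) -> exists k : R, D + (e / 2) *: U = k *: W.
  move=> e0 /WE[k kE]; exists (k / e).
  have : apex e - sh v = k *: W by rewrite kE addrC addKr.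
  have -> : apex e - sh v = e *: (D + (e / 2) *: U).
    by rewrite /apex {1}/D; apply/rowP => i; rewrite !mxE; ring.
  move=> H; apply: (scalerI (lt0r_neq0 e0)); rewrite H scalerA.
  by congr (_ *: _); field; exact: lt0r_neq0.
have [[e1 [e10 he1]]|none] := pselect (exists e1 : R, 0 < e1 /\ esh f (apex e1)); last first.
  by apply: ev_true => e e0 h; apply: none; exists e.
exists (e1 / 2); first lra.
move=> e /andP[e0 ee] he.
have [k kE] := bad e e0 he; have [k1 k1E] := bad e1 e10 he1.
have : k1 *: (D + (e / 2) *: U) = k *: (D + (e1 / 2) *: U).
  by rewrite kE k1E !scalerA mulrC.
move=> H; have [] := indDU (s := k1 - k) (t := k1 * (e / 2) - k * (e1 / 2)).
  move/eqP: H; rewrite -subr_eq0 => /eqP <-.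
  by apply/rowP => i; rewrite !mxE; ring.
move=> kk; have {kk} -> : k1 = k by lra.
move=> h; have {h} k0 : k = 0.
  have /eqP : k * (e - e1) = 0 by lra.
  by rewrite mulf_eq0 => /orP[/eqP//|]; rewrite subr_eq0 => /eqP; lra.
move: kE; rewrite k0 scale0r -[D]scale1r => /indDU[/eqP].
by rewrite oner_eq0.
Qed.

(** The tilt [d] is chosen first and the width [e] afterwards: once the steep segment from [p] to
    [low d] is free, a thin triangle around it is free as well. *)
Lemma slide_data : exists d e : R,
  [/\ 0 < d, 0 < e, e <= 1 & 2 * e <= tau /\ 2 * e <= 1 - tau] /\
  forall f, f \in F ->
  [/\ ~ esh f (sh p + e *: U) /\ ~ esh f (sh p - e *: U),
      forall xi eta, region e xi eta ->
        ~ seg f.1 f.2 (p + xi *: (low d - p) + eta *: u),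
      (forall s, esh f s -> ~ seg (sh p) (sh v) s) ->
      forall xi eta, region e xi eta -> ~ esh f (sh p + xi *: D + eta *: U),
      forall g w, g \in (a, b) :: F -> endp w g -> w <> v ->
        forall xi eta, region e xi eta -> sh w <> sh p + xi *: D + eta *: U &
      ~ esh f (apex e)].
Proof.
have [d d0 dE] := ev_ex (ev_all low_avoid); exists d.
have Ef f (fF : f \in F) := ev_and (ev_base fF) (ev_and (ev_tri (dE f fF))
  (ev_and (ev_shadow f) (ev_apex fF))).
have t0 : 0 < tau / 2 by tlra.
have t1 : 0 < (1 - tau) / 2 by tlra.
have := ev_and (ev_and (ev_le ltr01) (ev_and (ev_le t0) (ev_le t1)))
  (ev_and (ev_all Ef) (ev_all ev_vertices)).
move=> /ev_ex[e e0 [[e1 [e2 e3]] [HF HV]]]; exists e; split.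
  by split => //; lra.
move=> f fF; have [h1 [h2 [h3 h4]]] := HF f fF; split=> //.
move=> g w gg wg wv; exact: (HV g gg w wg wv).
Qed.

Lemma sh_lo (e : R) : sh (p - e *: u) = sh p - e *: U.
Proof. by rewrite (shB p) shZ. Qed.

Lemma sh_hi (e : R) : sh (p + e *: u) = sh p + e *: U.
Proof. by rewrite (shD p) shZ. Qed.

Lemma sh_pt (t xi eta : R) : sh (p + xi *: (low t - p) + eta *: u) =
  sh p + xi *: D + eta *: U.
Proof. by rewrite (shD (p + _)) sh_lowpt shZ. Qed.

Lemma side_lo (e t : R) : esh (p - e *: u, p + (1 + e) *: (low t - p) + (e ^+ 2 / 2) *: u) `<=`
  [set s | exists2 k : R, 0 <= k <= 1 &
     s = sh p + (k * (1 + e)) *: D + (- e + k * (e + e ^+ 2 / 2)) *: U].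
Proof.
move=> _ [k k01 ->]; exists k => //=.
rewrite sh_lo sh_pt.
by apply/rowP => i; rewrite !mxE; ring.
Qed.

Lemma side_hi (e t : R) : esh (p + (1 + e) *: (low t - p) + (e ^+ 2 / 2) *: u, p + e *: u) `<=`
  [set s | exists2 k : R, 0 <= k <= 1 &
     s = sh p + (k * (1 + e)) *: D + (e + k * (e ^+ 2 / 2 - e)) *: U].
Proof.
move=> s; rewrite /esh seg_sym => -[k k01 ->]; exists k => //=.
rewrite sh_hi sh_pt.
by apply/rowP => i; rewrite !mxE; ring.
Qed.

Lemma lo_region (e k : R) : 0 < e <= 1 -> 0 <= k <= 1 ->
  region e (k * (1 + e)) (- e + k * (e + e ^+ 2 / 2)).
Proof.
move=> e01 k01; split; first by apply/andP; split; nra.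
have h1 : 0 <= k * e ^+ 2 by rewrite mulr_ge0 ?exprn_ge0//; lra.
have h2 : k * e ^+ 2 <= k * e by rewrite ler_wpM2l ?expr2//; [lra|nra].
by rewrite ler_norml; apply/andP; split; nra.
Qed.

Lemma hi_region (e k : R) : 0 < e <= 1 -> 0 <= k <= 1 ->
  region e (k * (1 + e)) (e + k * (e ^+ 2 / 2 - e)).
Proof.
move=> e01 k01; split; first by apply/andP; split; nra.
have h1 : 0 <= k * e ^+ 2 by rewrite mulr_ge0 ?exprn_ge0//; lra.
have h2 : k * e ^+ 2 <= k * e by rewrite ler_wpM2l ?expr2//; [lra|nra].
by rewrite ler_norml; apply/andP; split; nra.
Qed.

Lemma tri_region (e t : R) z : 0 < e <= 1 ->
  tri (p - e *: u) (p + e *: u) (p + (1 + e) *: (low t - p) + (e ^+ 2 / 2) *: u) z ->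
  exists xi eta : R, region e xi eta /\ z = p + xi *: (low t - p) + eta *: u.
Proof.
move=> e01 [k [l [k0 l0 kl ->]]].
exists (l * (1 + e)), (- e + k * (2 * e) + l * (e + e ^+ 2 / 2)); split; last first.
  by apply/rowP => i; rewrite !mxE; ring.
split; first by apply/andP; split; nra.
have h1 : 0 <= l * e ^+ 2 by rewrite mulr_ge0 ?exprn_ge0//; lra.
have h2 : l * e ^+ 2 <= l * e by rewrite ler_wpM2l ?expr2//; nra.
by rewrite ler_norml; apply/andP; split; nra.
Qed.

Lemma edge_lo (e : R) : 0 < e <= tau -> esh (a, p - e *: u) `<=`
  [set s | exists2 k : R, - tau <= k <= - e & s = sh p + k *: U].
Proof.
move=> e01 s; rewrite /esh seg_sym => -[k k01 ->].
exists (- e - k * (tau - e)); first by nra.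
rewrite /= sh_lo shp UE.
by apply/rowP => i; rewrite !mxE; ring.
Qed.

Lemma edge_hi (e : R) : 0 < e <= 1 - tau -> esh (p + e *: u, b) `<=`
  [set s | exists2 k : R, e <= k <= 1 - tau & s = sh p + k *: U].
Proof.
move=> e01 s [k k01 ->].
exists (e + k * (1 - tau - e)); first by nra.
rewrite /= sh_hi shp UE.
by apply/rowP => i; rewrite !mxE; ring.
Qed.

(* [lra] preprocesses the whole context, which makes it slow in the next proof;
   it fails if section variables have been cleared. *)
Ltac only_ineqs :=
  repeat match goal with
  | H : ?P |- _ =>
    lazymatch type of P with Prop => idtac end;
    lazymatch H with
    | gE => fail | gF => fail | gamF => fail | nsh => fail | pgam => fail
    | _ => idtac
    end;
    lazymatch P with
    | is_true (@Order.le _ _ _ _) => fail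
    | is_true (@Order.lt _ _ _ _) => fail
    | is_true (andb _ _) => fail
    | @eq (matrix _ _ _) _ _ => clear H
    | @eq _ _ _ => fail
    | _ => clear H
    end
  end.
Ltac slra := only_ineqs; lra.
Ltac snra := only_ineqs; nra.

(* Here [x] and [y] are close to [p] on both sides, and [q] lies just beyond [low d];
   [(a, b)] is replaced with the path [a, x, q, y, b]. *)
Lemma slide_exists : exists x q y,
  [/\ good [:: (a, x), (x, q), (q, y), (y, b) & F] /\
      uniq [:: (a, x); (x, q); (q, y); (y, b)],
      ambient_isotopic (trace_of ((a, b) :: F))
        (trace_of [:: (a, x), (x, q), (q, y), (y, b) & F]),
      uniq [:: x; q; y] /\ (forall f w, f \in (a, b) :: F -> w \in [:: x; q; y] ->
        ~ endp w f),
      forall f s, f \in [:: (a, x); (x, q); (q, y); (y, b)] -> esh f s ->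
        ~ esh gam s &
      [/\ forall f, f \in F -> (forall s, esh f s -> ~ seg (sh p) (sh v) s) ->
            forall s, esh f s -> ~ esh (x, q) s /\ ~ esh (q, y) s,
          esh (a, x) `<=` esh (a, b), esh (y, b) `<=` esh (a, b) &
          forall s, [/\ esh (a, x) s -> ~ esh (q, y) s,
            esh (a, x) s -> ~ esh (y, b) s & esh (x, q) s -> ~ esh (y, b) s]]].
Proof.
have [d [e [[d0 e0 e1 [e2 e3]] H]]] := slide_data.
have e01 : 0 < e <= 1 by rewrite e0.
have et : 0 < e <= tau by slra.
have et' : 0 < e <= 1 - tau by slra.
pose x := p - e *: u; pose y := p + e *: u.
pose q := p + (1 + e) *: (low d - p) + (e ^+ 2 / 2) *: u.
have shx : sh x = sh p - e *: U by rewrite /x sh_lo.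
have shy : sh y = sh p + e *: U by rewrite /y sh_hi.
have shq : sh q = apex e.
  by rewrite /q sh_pt.
have coord0 (k : R) : sh p + k *: U = sh p + 0 *: D + k *: U.
  by rewrite scale0r addr0.
have coordv : sh v = sh p + 1 *: D + 0 *: U.
  by rewrite scale1r scale0r addr0 /D subrKC.
have tx : 0 < tau - e < 1 by slra.
have xE : x = a + (tau - e) *: (b - a).
  by rewrite /x /p /u; apply/rowP => i; rewrite !mxE; ring.
have xF f : f \in F -> ~ esh f (sh x) by move=> fF; rewrite shx; case: (H f fF) => -[].
have yF f : f \in F -> ~ esh f (sh y) by move=> fF; rewrite shy; case: (H f fF) => -[].
have qF f : f \in F -> ~ esh f (sh q) by move=> fF; rewrite shq; case: (H f fF).
have := @good_subdiv _ a b F (tau - e) gE gF tx; rewrite -xE => /(_ xF)[g1 [n1 n1']].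
have g2 : good [:: (x, b), (a, x) & F].
  by apply: good_cat_eq g1; exact: mem_swap2.
have n2 : (x, b) \notin (a, x) :: F.
  by move: n1; rewrite !inE !negb_or eq_sym n1' andbT => /andP[].
have ty : 0 < 2 * e / (1 - tau + e) < 1.
  by rewrite divr_gt0 ?ltr_pdivrMr ?mul1r//=; slra.
have yE : y = x + (2 * e / (1 - tau + e)) *: (b - x).
  have -> : b - x = (1 - tau + e) *: u.
    by rewrite /x /p /u; apply/rowP => i; rewrite !mxE; ring.
  rewrite scalerA divfK; last by rewrite gt_eqF//; slra.
  by rewrite /x /y; apply/rowP => i; rewrite !mxE; ring.
have yF' f : f \in (a, x) :: F -> ~ esh f (sh y).
  rewrite inE => /orP[/eqP->|]; last exact: yF.
  move=> /(edge_lo et)[k kb]; rewrite shy => /addrI/eqP.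
  rewrite -subr_eq0 -scalerBl scaler_eq0 (negPf U0) orbF => /eqP; slra.
have := good_subdiv g2 n2 ty; rewrite -yE => /(_ yF')[g3 [n3 n3']].
have indq : indep (sh y - sh x) (sh q - sh x).
  move=> s t; rewrite shx shy shq /apex => E.
  have [] := indDU (s := t * (1 + e)) (t := s * (2 * e) + t * (e + e ^+ 2 / 2)).
    by rewrite -[RHS]E; apply/rowP => i; rewrite !mxE; ring.
  move=> /eqP; rewrite mulf_eq0 => /orP[/eqP->|/eqP]; last slra.
  rewrite mul0r addr0 => /eqP; rewrite mulf_eq0 => /orP[/eqP//|/eqP]; slra.
have shtri z : tri x y q z -> exists xi eta : R,
    [/\ region e xi eta, z = p + xi *: (low d - p) + eta *: u &
        sh z = sh p + xi *: D + eta *: U].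
  move=> /(tri_region e01)[xi [eta [reg zE]]]; exists xi, eta; split=> //.
  by rewrite zE sh_pt.
have on_line z (xi eta k : R) : z = p + xi *: (low d - p) + eta *: u ->
    sh z = sh p + xi *: D + eta *: U -> sh z = sh p + k *: U ->
    z = p + k *: u /\ eta = k.
  move=> zE sz; rewrite sz coord0 => /(indep_coord indDU)[xi0 ek].
  by rewrite zE xi0 ek scale0r addr0.
have tri_others f z : f \in [:: (y, b), (a, x) & F] -> seg f.1 f.2 z ->
    tri x y q z -> (z = x \/ z = y) /\ endp z f.
  rewrite !inE => /or3P[/eqP->|/eqP->|fF] zf /shtri[xi [eta [reg zE sz]]].
  - have [k kb sk] := edge_hi et' (sh_seg zf).
    have [zk ek] := on_line z xi eta k zE sz sk.
    case: reg => _; rewrite ler_norml => /andP[_ r1].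
    have ke : k = e by slra.
    by split; [right|left]; rewrite zk ke.
  - have [k kb sk] := edge_lo et (sh_seg zf).
    have [zk ek] := on_line z xi eta k zE sz sk.
    case: reg => _; rewrite ler_norml => /andP[r1 _].
    have ke : k = - e by slra.
    by split; [left|right]; rewrite zk ke scaleNr.
  - have [_ H1 _ _ _] := H f fF.
    by case: (H1 xi eta reg); rewrite -zE.
have gamH := H gam gamF.
(* A side has first coordinate 1 at [k = 1 / (1 + e)]. There [1 + e] times its second coordinate is
   [- e ^+ 2 / 2], and [3 * e ^+ 2 / 2] on the other side, whereas that of [v] is 0. *)
have v_lo : ~ esh (x, q) (sh v).
  move=> /side_lo[k k01]; rewrite coordv => /(indep_coord indDU)[k1 k2].
  have : (1 + e) * (- e + k * (e + e ^+ 2 / 2)) = 0 by rewrite -k2 mulr0.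
  rewrite mulrDr mulrA [(1 + e) * k]mulrC -k1; snra.
have v_hi : ~ esh (q, y) (sh v).
  move=> /side_hi[k k01]; rewrite coordv => /(indep_coord indDU)[k1 k2].
  have : (1 + e) * (e + k * (e ^+ 2 / 2 - e)) = 0 by rewrite -k2 mulr0.
  rewrite mulrDr mulrA [(1 + e) * k]mulrC -k1; snra.
have sides f w : f \in (a, b) :: F -> endp w f ->
    ~ esh (x, q) (sh w) /\ ~ esh (q, y) (sh w).
  move=> fE wf; have [->//|wv] := pselect (w = v).
  have [_ _ _ Hw _] := gamH.
  split=> [/side_lo|/side_hi] [k k01]; apply: (Hw f w fE wf wv).
    exact: lo_region.
  exact: hi_region.
have W f w : f \in [:: (y, b), (a, x) & F] -> endp w f -> ~ endp w (x, y) ->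
    ~ esh (x, q) (sh w) /\ ~ esh (q, y) (sh w).
  rewrite !inE => /or3P[/eqP->|/eqP->|fF] wf nw.
  - case: wf => /= wE; first by case: nw; right.
    by apply: (sides (a, b) w) => //; right.
  - case: wf => /= wE; last by case: nw; left.
    by apply: (sides (a, b) w) => //; left.
  - by apply: (sides f w) => //; exact: FE.
have q_line (k : R) : sh q <> sh p + k *: U.
  by rewrite shq coord0 => /(indep_coord indDU)[]; slra.
have qF' f : f \in [:: (y, b), (a, x) & F] -> ~ esh f (sh q).
  rewrite !inE => /or3P[/eqP->|/eqP->|fF]; last exact: qF.
  - by move=> /(edge_hi et')[k _] /q_line.
  - by move=> /(edge_lo et)[k _] /q_line.
have [g4 n4 n4' iso] := good_delta g3 n3 indq tri_others W qF'.
have EE : [:: (x, q), (q, y), (y, b), (a, x) & F] =i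
    [:: (a, x), (x, q), (q, y), (y, b) & F].
  exact: mem_rot4.
have sa : sh a = sh p + (- tau) *: U.
  by rewrite shp UE; apply/rowP => i; rewrite !mxE; ring.
have sb : sh b = sh p + (1 - tau) *: U.
  by rewrite shp UE; apply/rowP => i; rewrite !mxE; ring.
have kU (k l : R) : sh p + k *: U = sh p + l *: U -> k = l.
  by rewrite !coord0 => /(indep_coord indDU)[].
have shx' : sh x = sh p + (- e) *: U by rewrite shx scaleNr.
have no_ab w (k : R) : sh w = sh p + k *: U -> - tau < k -> k < 1 - tau ->
    ~ endp w (a, b).
  by move=> wk k1 k2 [wa|wb]; move: wk; rewrite ?wa ?wb/= ?sa ?sb => /kU; slra.
exists x, q, y; split.
- split; first exact: good_cat_eq g4.
  move: n4 n4' n3'; rewrite /= !inE !negb_or ![(a, x) == _]eq_sym.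
  move=> /and4P[-> -> -> _] /and3P[-> -> _] /andP[-> _] //.
- rewrite (trace_split a b F tx) -xE.
  rewrite (trace_eqi (mem_swap2 _ _ _)).
  by rewrite (trace_split x b _ ty) -yE -(trace_eqi EE).
- have xq : x <> q by move=> xq; apply: (q_line (- e)); rewrite -xq.
  have yq : y <> q by move=> yq; apply: (q_line e); rewrite -yq.
  have xy : x <> y.
    by move=> xy; move: shy; rewrite -xy shx' => /kU; slra.
  split.
    rewrite /= !inE !negb_or andbT -andbA; apply/and3P.
    by split; apply/eqP => // /esym.
  move=> f w; rewrite inE => /orP[/eqP->|fF].
    rewrite !inE => /or3P[] /eqP->.
    + by apply: (no_ab x (- e)) => //; slra.
    + by case=> /= qE; [apply: (q_line (- tau))|apply: (q_line (1 - tau))];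
        rewrite qE.
    + by apply: (no_ab y e) => //; slra.
  rewrite !inE => /or3P[] /eqP-> /esh_end.
  + exact: xF.
  + exact: qF.
  + exact: yF.
- move=> f s; rewrite !inE => /or4P[] /eqP->.
  + move=> /(edge_lo et)[k kb ->] /gam_pt[l _].
    rewrite coord0 -[RHS]addr0 -(scale0r U) => /(indep_coord indDU)[_]; slra.
  (* The side crosses the line of [gam] at [k = 1 / (1 + e / 2)], where its first coordinate
     [k * (1 + e)] exceeds 1. *)
  + move=> /side_lo[k k01 ->] /gam_pt[l l1].
    rewrite -[RHS]addr0 -(scale0r U) => /(indep_coord indDU)[h1 h2].
    have h3 : e * (k * (1 + e / 2) - 1) = 0 by rewrite -[RHS]h2; ring.
    move/eqP: h3; rewrite mulf_eq0 gt_eqF//= subr_eq0 => /eqP h3.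
    have k0 : 0 < k by have [//|] := ltrP 0 k; snra.
    have : k * (1 + e) = k * (1 + e / 2) + k * e / 2 by field.
    rewrite h1 h3 => h4; have : 0 < k * e by exact: mulr_gt0.
    slra.
  (* This side would reach the line of [gam] only at [k = 1 / (1 - e / 2)], which is greater than
     1. *)
  + move=> /side_hi[k k01 ->] /gam_pt[l l1].
    rewrite -[RHS]addr0 -(scale0r U) => /(indep_coord indDU)[h1 h2].
    have h3 : e * (1 - k * (1 - e / 2)) = 0 by rewrite -[RHS]h2; field.
    move/eqP: h3; rewrite mulf_eq0 gt_eqF//= subr_eq0 => /eqP h3.
    snra.
  + move=> /(edge_hi et')[k kb ->] /gam_pt[l _].
    rewrite coord0 -[RHS]addr0 -(scale0r U) => /(indep_coord indDU)[_]; slra.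
- split.
  + move=> f fF Hf s fs; have [_ _ Hs _ _] := H f fF.
    split=> [/side_lo|/side_hi] [k k01 sE]; move: fs; rewrite sE.
      by apply: Hs => //; exact: lo_region.
    by apply: Hs => //; exact: hi_region.
  + by move=> s /(edge_lo et)[k kb ->]; apply: g_pt; slra.
  + by move=> s /(edge_hi et')[k kb ->]; apply: g_pt; slra.
  + move=> s; split.
    * move=> /(edge_lo et)[k kb ->] /side_hi[l l01].
      rewrite coord0 => /(indep_coord indDU)[h1 h2].
      have l0 : l = 0 by snra.
      by move: h2; rewrite l0 mul0r; slra.
    * by move=> /(edge_lo et)[k kb ->] /(edge_hi et')[l lb] /kU; slra.
    * move=> /side_lo[l l01 ->] /(edge_hi et')[k kb].
      rewrite coord0 => /(indep_coord indDU)[h1 h2].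
      have l0 : l = 0 by snra.
      by move: h2; rewrite l0 mul0r; slra.
Qed.

End Slide.
End Slide.

(** * Paths of edges and the effect of one slide *)

Section PathEdges.
Context {T : eqType}.
Implicit Types (x y : T) (l : seq T).

Definition pe l : seq (T * T) := if l is x :: l' then pairmap pair x l' else [::].

Lemma pe_cat l1 x l2 : pe (l1 ++ x :: l2) = pe (rcons l1 x) ++ pe (x :: l2).
Proof.
case: l1 => [//|y l1] /=.
elim: l1 y => [//|z l1 IH] y /=.
by rewrite IH.
Qed.

Lemma pe_split l g : g \in pe l -> exists l1 l2, l = l1 ++ g.1 :: g.2 :: l2.
Proof.
case: l => [//|x l] /=; elim: l x => [//|y l IH] x /=.
rewrite inE => /orP[/eqP->|/IH[l1 [l2 E]]]; first by exists [::], l.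
by exists (x :: l1), l2; rewrite E.
Qed.

Lemma pe_split_eq l1 x y l2 :
  pe (l1 ++ x :: y :: l2) = pe (rcons l1 x) ++ (x, y) :: pe (y :: l2).
Proof. exact: pe_cat. Qed.

Lemma pe_mem l x y : (x, y) \in pe l -> x \in l /\ y \in l.
Proof.
by move=> /pe_split[l1 [l2 ->]]; rewrite !mem_cat !inE !eqxx !orbT.
Qed.

Lemma mem_pe l x : (1 < size l)%N -> x \in l ->
  exists2 g, g \in pe l & x = g.1 \/ x = g.2.
Proof.
case: l => [|y [|z l]]//= _.
elim: l y z => [|t l IH] y z.
  rewrite !inE => /orP[]/eqP->; exists (y, z); rewrite ?inE//=; auto.
rewrite inE => /orP[/eqP->|xl].
  by exists (y, z); rewrite ?mem_head//; left.
have [g gl gx] := IH z t xl.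
by exists g => //; rewrite inE gl orbT.
Qed.

End PathEdges.

(** [key] is a partial function in relational form: an edge has a crossing parameter only if it
    crosses. It serves to find the crossing nearest to the start of a black edge. *)
Lemma seq_min_key (R : realType) (T : eqType) (key : T -> R -> Prop) (s : seq T) :
    (forall y r r', y \in s -> key y r -> key y r' -> r = r') ->
    (exists2 y, y \in s & exists r, key y r) ->
  exists x r, [/\ x \in s, key x r & forall y r', y \in s -> key y r' -> r <= r'].
Proof.
elim: s => [|z s IH] ku [y]; first by [].
have kus y' r r' : y' \in s -> key y' r -> key y' r' -> r = r'.
  by move=> ys; apply: ku; rewrite inE ys orbT.
have [Hs|nHs] := pselect (exists2 y, y \in s & exists r, key y r).
  move=> _ _; have [x [r [xs xr xmin]]] := IH kus Hs.
  have [[r0 zr0]|nz] := pselect (exists r, key z r); last first.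
    exists x, r; split=> //; first by rewrite inE xs orbT.
    move=> y' r'; rewrite inE => /orP[/eqP-> zk|]; last exact: xmin.
    by case: nz; exists r'.
  have [rr|rr] := lerP r r0.
    exists x, r; split=> //; first by rewrite inE xs orbT.
    move=> y' r'; rewrite inE => /orP[/eqP-> zk|]; last exact: xmin.
    by rewrite (ku z r' r0) ?mem_head.
  exists z, r0; split=> //; first exact: mem_head.
  move=> y' r'; rewrite inE => /orP[/eqP-> zk|ys yk].
    by rewrite (ku z r' r0) ?mem_head.
  by rewrite (le_trans (ltW rr))// (xmin y').
rewrite inE => /orP[/eqP->|ys [r yr]]; last by case: nHs; exists y => //; exists r.
move=> [r zr]; exists z, r; split=> //; first exact: mem_head.
move=> y' r'; rewrite inE => /orP[/eqP-> zk|ys yk].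
  by rewrite (ku z r' r) ?mem_head.
by case: nHs; exists y' => //; exists r'.
Qed.

Section Inner.
Context {R : realType}.
Local Notation pt := 'rV[R]_3.
Local Notation edge := (pt * pt)%type.
Local Notation sh := (@proj_plane R).
Implicit Types (e f g : edge) (E F : seq edge) (x y z w : pt).

Lemma slide (a b v v' : pt) (F : seq edge) (p2 : 'rV[R]_2) :
    good ((a, b) :: F) -> (a, b) \notin F -> (v, v') \in F ->
    ~ shares (a, b) (v, v') -> esh (a, b) p2 -> esh (v, v') p2 ->
  exists x q y,
  [/\ good [:: (a, x), (x, q), (q, y), (y, b) & F] /\
      uniq [:: (a, x); (x, q); (q, y); (y, b)],
      ambient_isotopic (trace_of ((a, b) :: F))
        (trace_of [:: (a, x), (x, q), (q, y), (y, b) & F]),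
      uniq [:: x; q; y] /\ (forall f w, f \in (a, b) :: F -> w \in [:: x; q; y] ->
        ~ endp w f),
      forall f s, f \in [:: (a, x); (x, q); (q, y); (y, b)] -> esh f s ->
        ~ esh (v, v') s &
      [/\ forall f, f \in F -> (forall s, esh f s -> ~ seg p2 (sh v) s) ->
            forall s, esh f s -> ~ esh (x, q) s /\ ~ esh (q, y) s,
          esh (a, x) `<=` esh (a, b), esh (y, b) `<=` esh (a, b) &
          forall s, [/\ esh (a, x) s -> ~ esh (q, y) s,
            esh (a, x) s -> ~ esh (y, b) s & esh (x, q) s -> ~ esh (y, b) s]]].
Proof.
move=> gE gF gamF nsh [tau tau01 pE] [r r01 pE'].
have p3 : sh (a + tau *: (b - a)) = p2 by rewrite shD shZ shB.
have := @Slide.slide_exists R a b v v' F tau r gE gF gamF nsh tau01 r01.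
by rewrite p3; apply.
Qed.

Lemma crosses_sym e f : crosses e f -> crosses f e.
Proof. by move=> [nsh [s [se sf]]]; split; [move=> /shares_sym|exists s]. Qed.

Lemma crosses_adj e f x : endp x e -> endp x f -> ~ crosses e f.
Proof. by move=> xe xf [nsh _]; apply: nsh; exists x. Qed.

Section OneSlide.
(** The path [l] stands for the edge about to become black, [B] lists the black edges in order and
    [X] all others. The path is already clear of the black edges after number [k], which is [gam],
    and by [rmin] its edge [(c, d)] has the crossing with [gam] nearest to [v]. *)
Variables (c d v v' : pt) (B X : seq edge) (l1 l2 : seq pt) (k : nat).
Let l := l1 ++ c :: d :: l2.
Let E := pe l ++ B ++ X.
Let gam : edge := (v, v').
Hypotheses (gE : good E) (uE : uniq E) (ul : uniq l).
Hypothesis gg : forall g g', g \in pe l -> g' \in pe l -> ~ crosses g g'.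
Hypothesis bb : forall g g', g \in B -> g' \in B -> ~ crosses g g'.
Hypothesis (kB : (k < size B)%N) (Bk : nth gam B k = gam).
Hypothesis (vl : v \notin l).
Hypothesis D1 : forall i, (k < i < size B)%N -> ~ endp v (nth gam B i).
Hypothesis clear : forall i g, (k < i < size B)%N -> g \in pe l ->
  ~ crosses g (nth gam B i).
Variable r : R.
Hypotheses (ncd : ~ shares (c, d) gam) (r01 : 0 <= r <= 1).
Let p2 := sh v + r *: (sh v' - sh v).
Hypothesis p2g : esh (c, d) p2.
Hypothesis rmin : forall g r', g \in pe l -> ~ shares g gam -> 0 <= r' <= 1 ->
  esh g (sh v + r' *: (sh v' - sh v)) -> r <= r'.

Let F := pe (rcons l1 c) ++ pe (d :: l2) ++ B ++ X.

Let EF : perm_eq E ((c, d) :: F).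
Proof.
rewrite /E /l pe_split_eq /F -cat_cons -cat1s.
by rewrite -!catA perm_catCA.
Qed.

Let gEF : good ((c, d) :: F).
Proof. by apply: good_cat_eq gE; exact: perm_mem. Qed.

Let cdF : (c, d) \notin F.
Proof. by move: uE; rewrite (perm_uniq EF) /= => /andP[]. Qed.

Let gamB : gam \in B. Proof. by rewrite -Bk mem_nth. Qed.

Let gamF : gam \in F.
Proof. by rewrite /F !mem_cat gamB !orbT. Qed.

Let p2gam : esh gam p2. Proof. by exists r. Qed.

Let vv' : sh v <> sh v'.
Proof. by apply: (good_neq gEF (e := gam)); rewrite inE gamF orbT. Qed.

Let cd : sh c <> sh d.
Proof. exact: (good_neq gEF (e := (c, d)) (mem_head _ _)). Qed.

Let FE f : f \in F -> f \in (c, d) :: F.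
Proof. by move=> fF; rewrite inE fF orbT. Qed.

Let cdE : (c, d) \in (c, d) :: F. Proof. exact: mem_head. Qed.

Let shared_p2 w : endp w (c, d) -> p2 = sh w -> False.
Proof.
move=> wg pw; apply: ncd; exists w => //.
by apply: (good_vertex gEF (FE gamF) cdE wg); rewrite -/(esh gam) -pw.
Qed.

Let r1 : r <> 1.
Proof.
move=> rE; have pv : p2 = sh v' by rewrite /p2 rE scale1r subrKC.
apply: ncd; exists v'; last by right.
apply: (good_vertex gEF cdE (FE gamF)); first by right.
by rewrite -pv.
Qed.

Let pv_param s : seg p2 (sh v) s ->
  exists2 t : R, 0 <= t <= r & s = sh v + t *: (sh v' - sh v).
Proof.
move=> [t t01 ->]; exists (r * (1 - t)); first by have := r01; nra.
by rewrite /p2; apply/rowP => i; rewrite !mxE; ring.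
Qed.

Let v'_off : ~ seg p2 (sh v) (sh v').
Proof.
move=> /pv_param[t t0r /eqP]; rewrite -subr_eq0 => /eqP H.
have /eqP : (1 - t) *: (sh v' - sh v) = 0.
  by rewrite -H; apply/rowP => i; rewrite !mxE; ring.
rewrite scaler_eq0 !subr_eq0 => /orP[/eqP t1|/eqP/esym//].
by apply: r1; have := r01; lra.
Qed.

Let pv_gam s : seg p2 (sh v) s -> esh gam s.
Proof.
by move=> /pv_param[t t0r ->]; exists t => //; have := r01; lra.
Qed.

(** Black edges do not cross [gam]. A later one adjacent to it meets it only at the common vertex,
    which is not [v] by [D1], and [v'] is out of reach. *)
Let black_avoid i : (k < i < size B)%N ->
  forall s, esh (nth gam B i) s -> ~ seg p2 (sh v) s.
Proof.
move=> ki s sf spv; set f := nth gam B i in sf.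
have fB : f \in B by apply: mem_nth; case/andP: ki.
have fF : f \in F by rewrite /F !mem_cat fB !orbT.
have gf : gam <> f by move=> gf; apply: (D1 ki); rewrite -/f -gf; left.
have sg := pv_gam spv.
have [[w wg wf]|nsh] := pselect (shares gam f); last first.
  by apply: (bb gamB fB); split=> //; exists s.
have sw := adjacent_meet gEF (FE gamF) (FE fF) gf wg wf sg sf.
case: wg => wE; first by apply: (D1 ki); rewrite -/f -[v]wE.
by apply: v'_off; move: spv; rewrite sw wE.
Qed.

(** By minimality of [r] another edge of the path could meet the segment only at [p2], which lies on
    [(c, d)]; but edges of the path do not cross each other, and [p2] is not a vertex of
    [(c, d)]. *)
Let green_avoid f : f \in pe l -> f <> (c, d) ->
  forall s, esh f s -> ~ seg p2 (sh v) s.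
Proof.
move=> fl fcd s sf spv.
have fE : f \in (c, d) :: F by rewrite -(perm_mem EF) /E mem_cat fl.
have cdl : (c, d) \in pe l by rewrite /l pe_split_eq mem_cat mem_head orbT.
have vf : ~ endp v f.
  have [fl1 fl2] : f.1 \in l /\ f.2 \in l by apply: pe_mem; case: f fl {fcd sf fE}.
  by move=> [vE|vE]; move: vl; rewrite vE ?fl1 ?fl2.
have sg := pv_gam spv.
have nsh : ~ shares f gam.
  move=> [w wf wg]; have fg : f <> gam by move=> fg; apply: vf; rewrite fg; left.
  have sw := adjacent_meet gEF fE (FE gamF) fg wf wg sf sg.
  case: wg => wE; first by apply: vf; rewrite [v](esym wE).
  by apply: v'_off; move: spv; rewrite sw wE.
have [t t0r tE] := pv_param spv.
have rt : r <= t.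
  by apply: (rmin fl nsh); [have := r01; lra|rewrite -tE].
have sp : s = p2.
  by rewrite tE /p2; congr (_ + _ *: _); apply/eqP; rewrite eq_le rt; case/andP: t0r => _ ->.
have [[w wg wf]|nsf] := pselect (shares (c, d) f); last first.
  by apply: (gg cdl fl); split=> //; exists p2; rewrite -{2}sp.
have cdf : (c, d) <> f by move=> cdf; apply: fcd.
apply: (shared_p2 wg); apply: (adjacent_meet gEF cdE fE cdf wg wf p2g).
by rewrite -sp.
Qed.

(** None of the four new edges crosses [gam], while [(c, d)] did, so the count drops. They cross
    neither the rest of the path nor the later black edges, because these avoid the segment from the
    crossing to [v]. *)
Lemma one_slide : exists x q y (l' := l1 ++ [:: c, x, q, y, d & l2]),
  [/\ good (pe l' ++ B ++ X) /\ uniq (pe l' ++ B ++ X),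
      uniq l' /\ (forall f w, f \in (c, d) :: F -> w \in [:: x; q; y] -> ~ endp w f),
      ambient_isotopic (trace_of E) (trace_of (pe l' ++ B ++ X)),
      (forall g g', g \in pe l' -> g' \in pe l' -> ~ crosses g g') &
      (forall i g, (k < i < size B)%N -> g \in pe l' ->
         ~ crosses g (nth gam B i)) /\
      (count (fun g => `[< crosses g gam >]) (pe l') <
       count (fun g => `[< crosses g gam >]) (pe l))%N].
Proof.
have [x [q [y]]] := slide gEF cdF gamF ncd p2g p2gam.
move=> [[g' u'] iso [u3 fr] avg [sides sub1 sub2 mut]].
exists x, q, y => l'.
pose N := [:: (c, x); (x, q); (q, y); (y, d)].
have pel' : pe l' = pe (rcons l1 c) ++ N ++ pe (d :: l2).
  by rewrite /l' pe_cat.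
have E'F : perm_eq (pe l' ++ B ++ X) (N ++ F).
  by rewrite pel' /F -!catA perm_catCA.
have E'E : pe l' ++ B ++ X =i N ++ F by exact: perm_mem.
have NE n : n \in N -> n \in N ++ F by rewrite mem_cat => ->.
have g4 : good (N ++ F) by [].
have Nfresh n : n \in N -> exists2 w, endp w n & w \in [:: x; q; y].
  rewrite !inE => /or4P[] /eqP->.
  - by exists x; [right|rewrite !inE eqxx].
  - by exists x; [left|rewrite !inE eqxx].
  - by exists q; [left|rewrite !inE eqxx orbT].
  - by exists y; [left|rewrite !inE eqxx !orbT].
have NF n : n \in N -> n \notin F.
  move=> /Nfresh[w wn wx]; apply/negP => nF; exact: (fr _ w (FE nF) wx wn).
have uF : uniq F by move: uE; rewrite (perm_uniq EF) /= => /andP[].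
have fresh_l w : w \in [:: x; q; y] -> w \notin l.
  move=> wx; apply/negP => wl.
  have [|g gl wg] := mem_pe _ wl; first by rewrite /l size_cat /= !addnS.
  by apply: (fr g w _ wx wg); rewrite -(perm_mem EF) /E mem_cat gl.
have cfresh : c \notin [:: x; q; y].
  by apply/negP => /fresh_l; rewrite /l mem_cat mem_head orbT.
have dfresh : d \notin [:: x; q; y].
  by apply/negP => /fresh_l; rewrite /l mem_cat !inE eqxx !orbT.
have cx : c <> x by move=> cx; move: cfresh; rewrite cx mem_head.
have cy : c <> y by move=> cy; move: cfresh; rewrite cy !inE eqxx !orbT.
have dx : d <> x by move=> dx; move: dfresh; rewrite dx mem_head.
have dy : d <> y by move=> dy; move: dfresh; rewrite dy !inE eqxx !orbT.
have cd' : c <> d by move=> cd'; apply: cd; rewrite cd'.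
have cxN : (c, x) \in N by rewrite !inE eqxx.
have ydN : (y, d) \in N by rewrite !inE eqxx !orbT.
have d_off : ~ esh (c, x) (sh d).
  move=> dcx; have [] // := good_vertex g4 (NE _ cxN) (NE _ ydN) (x := d) _ dcx.
    by right.
  by move=> /esym.
have c_off : ~ esh (y, d) (sh c).
  move=> cyd; have [] // := good_vertex g4 (NE _ ydN) (NE _ cxN) (x := c) _ cyd.
  by left.
(* The sides of the triangle are covered by [sides], and the two other pieces lie on [(c, d)]. If
   [f] is adjacent to [(c, d)], their only common point is [c] or [d], which is either an end of the
   piece or off it. *)
have NC f n : f \in F -> ~ crosses (c, d) f ->
    (forall s, esh f s -> ~ seg p2 (sh v) s) -> n \in N -> ~ crosses n f.
  move=> fF ncf avf nN [nsh [s [sn sf]]].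
  have cdf : (c, d) <> f by move=> cdf; move: cdF; rewrite cdf fF.
  have [h1 h2] := sides f fF avf s sf.
  move: nN nsh sn; rewrite !inE => /or4P[] /eqP-> nsh sn;
    [|by case: h1|by case: h2|].
  - have [[w wg wf]|nshg] := pselect (shares (c, d) f); last first.
      exact: ncf (conj nshg (ex_intro _ s (conj (sub1 _ sn) sf))).
    have sw := adjacent_meet gEF cdE (FE fF) cdf wg wf (sub1 _ sn) sf.
    case: wg => wE; first exact: nsh (ex_intro2 _ _ w (or_introl wE) wf).
    by apply: d_off; rewrite -[d]wE -sw.
  - have [[w wg wf]|nshg] := pselect (shares (c, d) f); last first.
      exact: ncf (conj nshg (ex_intro _ s (conj (sub2 _ sn) sf))).
    have sw := adjacent_meet gEF cdE (FE fF) cdf wg wf (sub2 _ sn) sf.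
    case: wg => wE; last exact: nsh (ex_intro2 _ _ w (or_intror wE) wf).
    by apply: c_off; rewrite -[c]wE -sw.
have NN n n' : n \in N -> n' \in N -> ~ crosses n n'.
  have m12 : ~ crosses (c, x) (x, q) by apply: (@crosses_adj _ _ x); [right|left].
  have m13 : ~ crosses (c, x) (q, y).
    by move=> [_ [s [s1 s2]]]; have [h _ _] := mut s; exact: (h s1 s2).
  have m14 : ~ crosses (c, x) (y, d).
    by move=> [_ [s [s1 s2]]]; have [_ h _] := mut s; exact: (h s1 s2).
  have m23 : ~ crosses (x, q) (q, y) by apply: (@crosses_adj _ _ q); [right|left].
  have m24 : ~ crosses (x, q) (y, d).
    by move=> [_ [s [s1 s2]]]; have [_ _ h] := mut s; exact: (h s1 s2).
  have m34 : ~ crosses (q, y) (y, d) by apply: (@crosses_adj _ _ y); [right|left].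
  have self (e : edge) : ~ crosses e e by apply: (@crosses_adj _ _ e.1); left.
  rewrite !inE => /or4P[] /eqP-> /or4P[] /eqP->;
   [exact: self|exact: m12|exact: m13|exact: m14
   |by move=> /crosses_sym/m12|exact: self|exact: m23|exact: m24
   |by move=> /crosses_sym/m13|by move=> /crosses_sym/m23|exact: self|exact: m34
   |by move=> /crosses_sym/m14|by move=> /crosses_sym/m24|by move=> /crosses_sym/m34|exact: self].
have rest g : g \in pe l' -> g \in N \/ [/\ g \in pe l, g \in F & g <> (c, d)].
  move=> H; have {}H : [|| g \in pe (rcons l1 c), g \in N | g \in pe (d :: l2)].
    by rewrite -!mem_cat -pel'.
  have [gN|gN] := boolP (g \in N); first by left.
  right; have gF : g \in F.
    by rewrite /F !mem_cat; case/or3P: H gN => [->|->|->]; rewrite ?orbT.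
  split; [|exact: gF|by move=> gcd; move: cdF; rewrite -gcd gF].
  rewrite /l pe_split_eq mem_cat inE.
  by case/or3P: H gN => [->|->|->]; rewrite ?orbT.
have cdl : (c, d) \in pe l by rewrite /l pe_split_eq mem_cat mem_head orbT.
split.
- split; first by apply: good_cat_eq g4 => f; rewrite E'E.
  rewrite (perm_uniq E'F) cat_uniq u' uF andbT /=.
  by apply/hasPn => f fF; apply/negP => /NF; rewrite fF.
- split=> //.
  have : perm_eq l' ([:: x; q; y] ++ l).
    have -> : l' = rcons l1 c ++ [:: x; q; y] ++ d :: l2 by rewrite cat_rcons.
    have -> : l = rcons l1 c ++ d :: l2 by rewrite cat_rcons.
    by rewrite perm_catCA.
  move/perm_uniq => ->; rewrite cat_uniq u3 ul andbT /=.
  by apply/hasPn => w wl; apply/negP => /fresh_l; rewrite wl.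
- rewrite (trace_eqi (perm_mem EF)) (trace_eqi E'E); exact: iso.
- move=> g1 g2 /rest[g1N|[g1l g1F g1cd]] /rest[g2N|[g2l g2F g2cd]].
  + exact: NN.
  + exact: NC g2F (gg cdl g2l) (green_avoid g2l g2cd) g1N.
  + by move=> /crosses_sym; exact: NC g1F (gg cdl g1l) (green_avoid g1l g1cd) g2N.
  + exact: gg.
- split.
  + move=> i g ki /rest[gN|[gl _ _]]; last exact: clear.
    have fB : nth gam B i \in B by apply: mem_nth; case/andP: ki.
    have fF : nth gam B i \in F by rewrite /F !mem_cat fB !orbT.
    exact: NC fF (clear ki cdl) (black_avoid ki) gN.
  + rewrite pel' /l pe_split_eq !count_cat /=.
    have cN f : f \in N -> `[< crosses f gam >] = false.
      by move=> fN; apply/asboolP => -[_ [s [sf sg]]]; exact: (avg f s fN sf sg).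
    have -> : `[< crosses (c, d) gam >] = true.
      by apply/asboolP; split; [exact: ncd|exists p2].
    by rewrite !cN ?inE ?eqxx ?orbT// !add0n ltn_add2l add1n.
Qed.

End OneSlide.
End Inner.

(** * Clearing a path of all black edges *)

Section InnerLoop.
Context {R : realType}.
Local Notation pt := 'rV[R]_3.
Local Notation edge := (pt * pt)%type.
Local Notation sh := (@proj_plane R).
Implicit Types (e f g : edge) (x y z w : pt) (l : seq pt).

Variables (a b : pt) (B X : seq edge).
Hypothesis bb : forall g g', g \in B -> g' \in B -> ~ crosses g g'.
(* Sliding past the start of a black edge only affects earlier black edges. *)
Hypothesis D1 : forall g0 i k, (k < i < size B)%N ->
  ~ endp (nth g0 B k).1 (nth g0 B i).
Hypothesis Bab : forall g, g \in B -> g.1 <> a /\ g.1 <> b.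

(** By [gp_fresh] the inner vertices of the path belong to no other edge; together with [Bab] this
    keeps the start of every black edge off the path, as a slide requires. *)
Record green_path l : Prop := GreenPath {
  gp_head : ohead l = Some a;
  gp_last : last a l = b;
  gp_good : good (pe l ++ B ++ X);
  gp_uniq : uniq (pe l ++ B ++ X);
  gp_uniql : uniq l;
  gp_fresh : forall w f, w \in l -> f \in B ++ X -> endp w f -> w = a \/ w = b;
  gp_green : forall g g', g \in pe l -> g' \in pe l -> ~ crosses g g' }.

Definition clear_from k l : Prop := forall g0 i g, (k <= i < size B)%N ->
  g \in pe l -> ~ crosses g (nth g0 B i).

(** Induction on the number of edges of the path that cross the black edge number [k]. *)
Let clear_index k l : (k < size B)%N -> green_path l -> clear_from k.+1 l ->
  exists l', [/\ green_path l', clear_from k l' &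
    ambient_isotopic (trace_of (pe l ++ B ++ X)) (trace_of (pe l' ++ B ++ X))].
Proof.
move=> kB.
pose gam := nth (0, 0) B k.
have gamB : gam \in B by exact: mem_nth.
have [n] := ubnP (count (fun g => `[< crosses g gam >]) (pe l)).
elim: n l => // n IH l; rewrite ltnS => ln gl cl.
have [none|some] := pselect (forall g, g \in pe l -> ~ crosses g gam).
  exists l; split=> //; last exact: ambient_isotopic_refl.
  move=> g0 i g /andP[ki iB] gl'; move: ki; rewrite leq_eqVlt => /orP[/eqP<-|ki].
    by rewrite (set_nth_default (0, 0))//; exact: none.
  by apply: cl => //; rewrite ki.
have some' : exists2 g, g \in pe l & crosses g gam.
  by apply: contrapT => H; apply: some => g gl' gc; apply: H; exists g.
have vv' : sh gam.1 <> sh gam.2.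
  by apply: (good_neq (gp_good gl)); rewrite !mem_cat gamB !orbT.
have vv0 : sh gam.2 - sh gam.1 != 0 by rewrite subr_eq0 eq_sym; apply/eqP.
have gE := gp_good gl.
have gamE : gam \in pe l ++ B ++ X by rewrite !mem_cat gamB !orbT.
have gP g : g \in pe l -> g \in pe l ++ B ++ X by rewrite mem_cat => ->.
(* The position along [gam], counted from its start, of the crossing with [g]. *)
pose key g r := [/\ ~ shares g gam, 0 <= r <= 1 &
  esh g (sh gam.1 + r *: (sh gam.2 - sh gam.1))].
have ku g (r r' : R) : g \in pe l -> key g r -> key g r' -> r = r'.
  move=> gl' [nsh r01 h1] [_ r01' h2].
  have gg : g <> gam.
    by move=> gg; apply: nsh; rewrite gg; exists gam.1; left.
  have /addrI/eqP := cross_unique gE (gP g gl') gamE gg h1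
    (ex_intro2 _ _ r r01 erefl) h2 (ex_intro2 _ _ r' r01' erefl).
  by rewrite -subr_eq0 -scalerBl scaler_eq0 (negPf vv0) orbF subr_eq0 => /eqP.
have [g [r [gl' [nsh r01 rg] rmin]]] : exists g r,
    [/\ g \in pe l, key g r & forall g' r', g' \in pe l -> key g' r' -> r <= r'].
  apply: seq_min_key => //; case: some' => g gl' [nsh [s [sg [r r01 sr]]]].
  by exists g => //; exists r; split=> //; rewrite -sr.
have [l1 [l2 lE]] := pe_split gl'.
case: g gl' nsh rg lE => c d gl' nsh rg /= lE.
have vl : gam.1 \notin l.
  apply/negP => vl; have [||va|vb] := gp_fresh gl vl (f := gam).
  - by rewrite mem_cat gamB.
  - by left.
  - by case: (Bab gamB) => /(_ va).
  - by case: (Bab gamB) => _ /(_ vb).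
have gamEta : (gam.1, gam.2) = gam by case: (gam).
have := @one_slide R c d gam.1 gam.2 B X l1 l2 k.
rewrite -lE gamEta => /(_ gE (gp_uniq gl) (gp_uniql gl) (gp_green gl) bb kB).
have gamk : nth gam B k = gam by exact: set_nth_default.
have D1' i : (k < i < size B)%N -> ~ endp gam.1 (nth gam B i).
  by move=> ki; have := @D1 gam i k ki; rewrite gamk.
move=> /(_ gamk vl D1' (fun i => cl gam i) r nsh r01 rg).
case=> [g r' gl1 nsh1 r'01 gr'|x [q [y]]]; first by apply: rmin gl1 _.
set l' := l1 ++ _; move=> [[g' u'] [ul' fr] iso gg' [cl' ltc]].
have fr' w f : w \in [:: x; q; y] -> f \in B ++ X -> ~ endp w f.
  by move=> wx fB; apply: fr => //; rewrite inE 2!mem_cat fB !orbT.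
have gpl' : green_path l'.
  split=> //.
  - by have := gp_head gl; rewrite lE /l'; case: (l1).
  - by have := gp_last gl; rewrite lE /l' !last_cat.
  - move=> w f wl' fB wf.
    have [wx|wnx] := boolP (w \in [:: x; q; y]); first by case: (fr' w f).
    apply: (gp_fresh gl _ fB wf); rewrite lE mem_cat !inE.
    by move: wl' wnx; rewrite /l' mem_cat !inE => /or3P[->|->//|] //;
      [rewrite orbT|case/or4P=> -> //; rewrite ?orbT].
have cll' : clear_from k.+1 l'.
  by move=> g0 i g ki gl1; rewrite (set_nth_default gam); [exact: cl'|case/andP: ki].
have [l'' [gp'' cl'' iso'']] := IH l' (leq_trans ltc ln) gpl' cll'.
by exists l''; split=> //; exact: ambient_isotopic_trans iso''.
Qed.

Lemma clear_blacks l : green_path l -> exists l', [/\ green_path l',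
    forall g f, g \in pe l' -> f \in B -> ~ crosses g f &
    ambient_isotopic (trace_of (pe l ++ B ++ X)) (trace_of (pe l' ++ B ++ X))].
Proof.
move=> gl.
suff [l' [h1 h2 h3]] : exists l', [/\ green_path l', clear_from 0 l' &
    ambient_isotopic (trace_of (pe l ++ B ++ X)) (trace_of (pe l' ++ B ++ X))].
  exists l'; split=> // g f gl' fB; rewrite -(nth_index (0, 0) fB).
  by apply: h2 => //; rewrite index_mem.
suff H k : (k <= size B)%N -> exists l', [/\ green_path l', clear_from (size B - k) l' &
    ambient_isotopic (trace_of (pe l ++ B ++ X)) (trace_of (pe l' ++ B ++ X))].
  by have := H (size B) (leqnn _); rewrite subnn.
elim: k => [_|k IH kB].
  exists l; split=> //; last exact: ambient_isotopic_refl.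
  by move=> g0 i g; rewrite subn0 => /andP[h /(leq_ltn_trans h)]; rewrite ltnn.
have [l1 [g1 c1 i1]] := IH (ltnW kB).
have kB' : (size B - k.+1 < size B)%N by rewrite ltn_subrL/=; exact: leq_ltn_trans kB.
have [|l2 [g2 c2 i2]] := clear_index kB' g1.
  by rewrite subnSK.
by exists l2; split=> //; exact: ambient_isotopic_trans i2.
Qed.

End InnerLoop.

(** * Blackening the components *)

Section OuterLoop.
Context {R : realType} {k : nat}.
Local Notation pt := 'rV[R]_3.
Local Notation edge := (pt * pt)%type.
Local Notation sh := (@proj_plane R).
Implicit Types (e f g : edge) (x y z w : pt) (l : seq pt) (S W U : 'I_k -> seq pt).

Definition closing (l : seq pt) : edge := (last 0 l, head 0 l).

Definition gather (T : eqType) (F : 'I_k -> seq T) : seq T :=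
  flatten [seq F j | j <- enum 'I_k].

Lemma gatherP (T : eqType) (F : 'I_k -> seq T) (x : T) :
  reflect (exists j, x \in F j) (x \in gather F).
Proof.
apply: (iffP flatten_mapP) => [[j _ xj]|[j xj]]; exists j => //.
by rewrite mem_enum.
Qed.

Definition edges S : seq edge := gather (fun j => rcons (pe (S j)) (closing (S j))).
Definition path_edges S : seq edge := gather (fun j => pe (S j)).

Record polygons S : Prop := Polygons {
  pg_size : forall j, (2 < size (S j))%N;
  pg_uniq : forall j, uniq (S j);
  pg_disj : forall i j x, x \in S i -> x \in S j -> i = j;
  pg_good : good (edges S);
  pg_closing : forall i j, ~ crosses (closing (S i)) (closing (S j)) }.

Definition cat_fam W U j := W j ++ U j.

Lemma edge_ends S e j : e \in rcons (pe (S j)) (closing (S j)) ->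
  (0 < size (S j))%N -> e.1 \in S j /\ e.2 \in S j.
Proof.
rewrite mem_rcons inE => /orP[/eqP-> s0|].
  by rewrite /closing; case: (S j) s0 => // x l _ /=; rewrite mem_last mem_head.
by case: e => x y /pe_mem.
Qed.

Lemma edges_mem S e : e \in edges S <->
  exists j, e \in pe (S j) \/ e = closing (S j).
Proof.
split.
  by move=> /gatherP[j]; rewrite mem_rcons inE => /orP[/eqP->|]; exists j; auto.
move=> [j [ej|->]]; apply/gatherP; exists j; rewrite mem_rcons inE ?eqxx//.
by rewrite ej orbT.
Qed.

Lemma pe_first_notlast l e : uniq l -> e \in pe l -> e.1 <> last 0 l.
Proof.
move=> ul /pe_split[l1 [l2 lE]] E.
move: ul; rewrite lE cat_uniq => /and3P[_ _] /= /andP[+ _].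
by rewrite {1}E lE last_cat /= mem_last.
Qed.

Lemma mem_pe_first l w : w \in l -> w <> last 0 l ->
  exists2 g, g \in pe l & w = g.1.
Proof.
move=> /path.splitPr[l1 [|y l2]]; first by rewrite last_cat.
move=> _; exists (w, y) => //; by rewrite pe_split_eq mem_cat mem_head orbT.
Qed.

Lemma mem_pe_second x l w : w \in l ->
  exists2 g, g \in pe (x :: l) & w = g.2.
Proof.
elim: l x => [//|y l IH] x; rewrite inE => /orP[/eqP->|wl].
  by exists (x, y) => //; rewrite mem_head.
by have [g gl gw] := IH y wl; exists g => //; rewrite /= inE gl orbT.
Qed.

(** The order hypothesis [D1] of the inner loop as a pairwise relation. It holds along a path with
    distinct vertices, and between paths without common vertices. *)
Let before : rel edge := fun e f => (e.1 != f.1) && (e.1 != f.2).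

Let pairwise_before l : uniq l -> pairwise before (pe l).
Proof.
case: l => [//|x l]; elim: l x => [//|y l IH] x /=.
move=> /andP[xl ul]; rewrite IH// andbT.
apply/allP => e ey; have [e1 e2] : e.1 \in y :: l /\ e.2 \in y :: l.
  by apply: pe_mem; case: e ey.
by rewrite /before/=; apply/andP; split; apply: contraNneq xl => ->.
Qed.

Lemma path_edges_before W : (forall j, uniq (W j)) ->
  (forall i j x, x \in W i -> x \in W j -> i = j) -> pairwise before (path_edges W).
Proof.
move=> uW dW; rewrite /path_edges /gather.
have := enum_uniq 'I_k; elim: (enum 'I_k) => [//|i s IH] /= /andP[is_ us].
rewrite pairwise_cat IH// pairwise_before// !andbT.
apply/allrelP => e f ei /flatten_mapP[j js fj].
have ij : i <> j by move=> ij; rewrite ij js in is_.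
have [e1 _] : e.1 \in W i /\ e.2 \in W i by apply: pe_mem; case: e ei.
have [f1 f2] : f.1 \in W j /\ f.2 \in W j by apply: pe_mem; case: f fj.
by rewrite /before; apply/andP; split; apply/eqP => E; apply: ij;
  apply: (dW i j e.1) => //; rewrite E.
Qed.

(** The edge from the last vertex [a] of the black path [W i] to [u] is replaced by a path [a :: Q]
    clear of all black edges. As [Q] ends at [u], the list [W i ++ Q] is again a black path and the
    closing edge is unchanged. *)
Let recolour W U (i : 'I_k) (u : pt) (U' : seq pt) :
    polygons (cat_fam W U) -> (forall j, W j != [::]) -> U i = u :: U' ->
    (forall g g', g \in path_edges W -> g' \in path_edges W -> ~ crosses g g') ->
  exists Q, let W' j := if j == i then W i ++ Q else W j in
    let V' j := if j == i then U' else U j in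
  [/\ polygons (cat_fam W' V'), (forall j, W' j != [::]),
      (forall g g', g \in path_edges W' -> g' \in path_edges W' -> ~ crosses g g') &
      ambient_isotopic (trace_of (edges (cat_fam W U)))
        (trace_of (edges (cat_fam W' V')))].
Proof.
move=> pW W0 Ui bb.
set S := cat_fam W U in pW *.
have [szS uS dS gS cS] := pW.
have Si : S i = W i ++ u :: U' by rewrite /S /cat_fam Ui.
have [w0 [a Wi]] : exists (w0 : seq pt) (a : pt), W i = rcons w0 a.
  by have := W0 i; case/lastP: (W i) => // w0 a _; exists w0, a.
have aS : a \in S i by rewrite Si Wi mem_cat mem_rcons mem_head.
have uSi : u \in S i by rewrite Si mem_cat mem_head orbT.
have WS j x : x \in W j -> x \in S j by move=> xW; rewrite /S /cat_fam mem_cat xW.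
have uW j : uniq (W j) by have := uS j; rewrite /S /cat_fam cat_uniq => /andP[].
have dWU x : x \in W i -> x \in u :: U' -> False.
  have := uS i; rewrite Si cat_uniq => /and3P[_ /hasPn H _] xW /H /negP.
  by apply.
have aW : a \in W i by rewrite Wi mem_rcons mem_head.
have lastW : last 0 (W i) = a by rewrite Wi last_rcons.
pose B := path_edges W.
(* [undup] supplies the uniqueness asked by [green_path]; traces and [good] depend only on the set
   of edges. *)
pose X := undup [seq e <- edges S | e \notin (a, u) :: B].
have peSi : pe (S i) = pe (W i) ++ (a, u) :: pe (u :: U').
  by rewrite Si Wi cat_rcons pe_split_eq.
have auE : (a, u) \in edges S.
  by apply/edges_mem; exists i; left; rewrite peSi mem_cat mem_head orbT.
have BE e : e \in B -> e \in edges S.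
  move=> /gatherP[j ej]; apply/edges_mem; exists j; left.
  case/pe_split: ej => l1 [l2 Wj]; rewrite /S /cat_fam Wj -catA /=.
  by rewrite pe_split_eq mem_cat; case: (e) => ? ?; rewrite mem_head orbT.
have XE e : (e \in X) = (e \in edges S) && (e \notin (a, u) :: B).
  by rewrite mem_undup mem_filter andbC.
have coverE e : e \in edges S -> e <> (a, u) -> e \in B ++ X.
  move=> eE eau; rewrite mem_cat XE eE inE negb_or.
  by have [//|eB] := boolP (e \in B); rewrite andbT; apply/eqP.
have subE e : e \in pe [:: a; u] ++ B ++ X -> e \in edges S.
  rewrite /= inE mem_cat => /or3P[/eqP->//|/BE//|].
  by rewrite XE => /andP[].
have allE : edges S =i pe [:: a; u] ++ B ++ X.
  move=> e; apply/idP/idP; last exact: subE.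
  move=> eE; rewrite /= inE; have [//|/eqP eau] := eqVneq e (a, u).
  exact: coverE.
have dW i' j x : x \in W i' -> x \in W j -> i' = j.
  by move=> /WS xi /WS xj; exact: dS xi xj.
have pB := path_edges_before uW dW.
have Bfst e : e \in B -> e.1 <> a /\ e.1 <> u.
  move=> /gatherP[j ej].
  have [e1 _] : e.1 \in W j /\ e.2 \in W j by apply: pe_mem; case: e ej.
  split=> E.
    have ij : i = j by apply: (dS i j a) => //; apply: WS; rewrite -E.
    by apply: (pe_first_notlast (uW j) ej); rewrite -ij lastW.
  have uj : u \in W j by rewrite -E.
  have ij : i = j by apply: (dS i j u) => //; exact: WS.
  by apply: (dWU u); [rewrite ij|exact: mem_head].
have au : a <> u.
  by move=> au; apply: (dWU a) => //; rewrite au mem_head.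
have gp : green_path a u B X [:: a; u].
  split=> //.
  - exact: good_sub gS.
  - rewrite /= mem_cat negb_or cat_uniq XE /= mem_head /= andbF /= andbT.
    have uB : uniq B.
      rewrite uniq_pairwise; apply: sub_pairwise pB => e f /andP[ef _] /=.
      by apply: contraNneq ef => ->.
    rewrite uB /= undup_uniq andbT; apply/andP; split.
      by apply/negP => /Bfst[/=].
    by apply/hasPn => e; rewrite XE inE negb_or => /and3P[_ _ ->].
  - by rewrite /= inE andbT; apply/eqP.
  - by move=> w f; rewrite !inE => /orP[/eqP->|/eqP->]; auto.
  - move=> g g'; rewrite !inE => /eqP-> /eqP->.
    by apply: (@crosses_adj _ _ _ a); left.
have D1 g0 i0 k0 : (k0 < i0 < size B)%N -> ~ endp (nth g0 B k0).1 (nth g0 B i0).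
  move=> /andP[ki iB]; have kB := ltn_trans ki iB.
  have /(pairwiseP g0) H := pB; have := H _ _ kB iB ki.
  by move=> /andP[/eqP h1 /eqP h2] [].
have [l [gl clr iso]] := clear_blacks bb D1 Bfst gp.
have [Q lE] : exists Q, l = a :: Q.
  by have := gp_head gl; case: (l) => // x Q [->]; exists Q.
have lastQ : last a Q = u by have := gp_last gl; rewrite lE.
have uQ : uniq Q /\ a \notin Q.
  by have := gp_uniql gl; rewrite lE /= => /andP[].
have Q0 : u \in Q.
  by case: Q lastQ {lE uQ} => [/au//|x Q] /= <-; exact: mem_last.
have [q QE] : exists q, Q = rcons q u.
  by case/lastP: Q lastQ {lE uQ} Q0 => // q x; rewrite last_rcons => ->; exists q.
exists Q => W' V'; set S' := cat_fam W' V'.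
have S'j j : j <> i -> S' j = S j.
  by move=> /eqP ji; rewrite /S' /S /cat_fam /W' /V' (negPf ji).
have S'i : S' i = W i ++ Q ++ U' by rewrite /S' /cat_fam /W' /V' eqxx catA.
have peS'i : pe (S' i) = pe (W i) ++ pe l ++ pe (u :: U').
  by rewrite S'i Wi cat_rcons pe_cat -Wi QE cat_rcons -cat_cons pe_cat lE QE.
have clS' j : closing (S' j) = closing (S j).
  have [->|ji] := eqVneq j i; last by rewrite S'j//; exact/eqP.
  rewrite /closing S'i Si !last_cat lastW lastQ /=; congr pair.
  by case: (W i) (W0 i).
(* Each old vertex of the component other than [a] and [u] is an end of an edge different from
   [(a, u)], so that [gp_fresh] applies. *)
have WiQ w : w \in Q -> w \notin S i \/ w = u.
  move=> wQ; have [->|wu] := eqVneq w u; first by right.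
  left; apply/negP; rewrite Si mem_cat => wS.
  have wa : w <> a by move=> wa; move: uQ.2; rewrite -wa wQ.
  have wl : w \in l by rewrite lE inE wQ orbT.
  case/orP: wS => [wW|].
    have [|g gW wg] := mem_pe_first wW; first by rewrite lastW.
    have gB : g \in B by apply/gatherP; exists i.
    have [||//|wu'] := gp_fresh gl wl (f := g); last by rewrite wu' eqxx in wu.
      by rewrite mem_cat gB.
    by left.
  rewrite inE (negPf wu)/= => wU.
  have [g gU wg] := mem_pe_second u wU.
  have gE : g \in edges S.
    by apply/edges_mem; exists i; left; rewrite peSi mem_cat inE gU !orbT.
  have gau : g <> (a, u) by move=> gau; move: wu; rewrite wg gau eqxx.
  have [|//|wu'] := gp_fresh gl wl (coverE g gE gau); last by rewrite wu' eqxx in wu.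
  by right.
have QSj j w : j <> i -> w \in Q -> w \notin S j.
  move=> ji wQ; apply/negP => wS.
  have [g gS' wg] := mem_pe (ltnW (szS j)) wS.
  have gE : g \in edges S by apply/edges_mem; exists j; left.
  have wl : w \in l by rewrite lE inE wQ orbT.
  have gau : g <> (a, u).
    move=> gau; apply: ji; apply: (dS j i a) => //.
    have [] : a \in S j /\ u \in S j by apply: pe_mem; rewrite -gau.
    by [].
  have [//|wa|wu] := gp_fresh gl wl (coverE g gE gau).
    by move: uQ.2; rewrite -wa wQ.
  by apply: ji; apply: (dS j i w) => //; rewrite wu.
have S'sub j w : w \in S' j -> w \in S j \/ (j = i /\ w \in Q).
  have [->|/eqP ji] := eqVneq j i; last by rewrite S'j//; left.
  rewrite S'i Si !mem_cat !inE => /or3P[->|->|->]; rewrite ?orbT; auto.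
have edgesE : edges S' =i pe l ++ B ++ X.
  move=> e; apply/idP/idP.
    move=> /edges_mem[j [ej|ecl]]; last first.
      have eE : e \in edges S by apply/edges_mem; exists j; right; rewrite ecl clS'.
      rewrite mem_cat coverE ?orbT// => eau.
      have [e1 e2] : a = last 0 (S j) /\ u = head 0 (S j).
        by move: ecl; rewrite eau clS' => -[].
      have uSj : u \in S j.
        rewrite e2; case: (S j) (szS j) => // x s _; exact: mem_head.
      have ij := dS _ _ _ uSi uSj; subst j.
      exfalso; apply: (dWU u); last exact: mem_head.
      have -> : u = head 0 (W i) by rewrite e2 Si; case: (W i) (W0 i).
      by case: (W i) (W0 i) => //= x s _; rewrite mem_head.
    have [ji|/eqP ji] := eqVneq j i.
      move: ej; rewrite ji peS'i !mem_cat => /or3P[eW|->//|eU].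
        have -> : e \in B by apply/gatherP; exists i.
        by rewrite orbT.
      have eE : e \in edges S.
        by apply/edges_mem; exists i; left; rewrite peSi mem_cat inE eU !orbT.
      rewrite -mem_cat coverE ?orbT// => eau; move: eU; rewrite eau => eU.
      have [aU _] := pe_mem eU; move: aU; rewrite inE => /orP[/eqP//|aU].
      by exfalso; apply: (dWU a) => //; rewrite inE aU orbT.
    have eE : e \in edges S by apply/edges_mem; exists j; left; rewrite -S'j.
    rewrite mem_cat coverE ?orbT// => eau; apply: (ji); apply: (dS j i a) => //.
    by have [] : a \in S j /\ u \in S j by apply: pe_mem; rewrite -eau -S'j.
  rewrite !mem_cat => /or3P[el|eB|eX].
  - by apply/edges_mem; exists i; left; rewrite peS'i !mem_cat el orbT.
  - case/gatherP: eB => j ej; apply/edges_mem; exists j; left.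
    have [ji|/eqP ji] := eqVneq j i; first by rewrite ji peS'i mem_cat -ji ej.
    rewrite S'j//; case/pe_split: ej => l1 [l2 Wj]; rewrite /S /cat_fam Wj -catA /=.
    by rewrite pe_split_eq mem_cat; case: (e) => ? ?; rewrite mem_head orbT.
  - move: eX; rewrite XE => /andP[/edges_mem[j [ej|->]] enB]; last first.
      by apply/edges_mem; exists j; right; rewrite clS'.
    apply/edges_mem; exists j; left.
    have [ji|/eqP ji] := eqVneq j i; last by rewrite S'j.
    move: ej enB; rewrite ji peSi peS'i !mem_cat !inE negb_or.
    case/or3P=> [->//|->//|->]; by rewrite !orbT.
have W'edges e : e \in path_edges W' -> e \in pe l \/ e \in B.
  move=> /gatherP[j]; rewrite /W'; have [ji|ji] := eqVneq j i.
    rewrite Wi cat_rcons pe_cat -Wi mem_cat lE => /orP[eW|->]; last by left.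
    by right; apply/gatherP; exists i.
  by move=> ej; right; apply/gatherP; exists j.
split.
- split.
  + move=> j; have [->|/eqP ji] := eqVneq j i; last by rewrite S'j.
    apply: (leq_trans (szS i)); rewrite Si S'i !size_cat leq_add2l /=.
    by rewrite QE size_rcons addSn ltnS leq_addl.
  + move=> j; have [->|/eqP ji] := eqVneq j i; last by rewrite S'j.
    have := uS i; rewrite Si S'i !cat_uniq => /and3P[-> _] /=.
    move=> /andP[uU' ->]; rewrite uQ.1 /= andbT; apply/andP; split.
      apply/hasPn => w; rewrite mem_cat => wQU; apply/negP => wW.
      case/orP: wQU => [wQ|wU]; last by apply: (dWU w) => //; rewrite inE wU orbT.
      have [|wu] := WiQ w wQ; first by rewrite Si mem_cat wW.
      by apply: (dWU w) => //; rewrite wu mem_head.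
    apply/hasPn => w wU; apply/negP => wQ.
    have [|wu] := WiQ w wQ; first by rewrite Si mem_cat inE wU !orbT.
    by move: uU'; rewrite -wu wU.
  + move=> j1 j2 x /S'sub[x1|[-> x1]] /S'sub[x2|[-> x2]] //.
    * exact: dS x1 x2.
    * apply: contrapT => ji; move: (QSj _ _ ji x2); by rewrite x1.
    * apply: contrapT => ji; move: (QSj j2 _ (nesym ji) x1); by rewrite x2.
  + by apply: good_cat_eq (gp_good gl) => e; rewrite edgesE.
  + by move=> j1 j2; rewrite !clS'.
- move=> j; rewrite /W'; have [_|//] := eqVneq j i.
  by case: (W i) (W0 i).
- move=> g g' /W'edges[gl1|gB] /W'edges[gl2|gB'].
  + exact: (gp_green gl).
  + exact: clr.
  + by move=> /crosses_sym; exact: clr.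
  + exact: bb.
- by rewrite (trace_eqi allE) (trace_eqi edgesE).
Qed.

(* [W j] lists the vertices of the black path of component [j], and [U j] the
   vertices to be reached. *)
Lemma blacken W U :
    polygons (cat_fam W U) -> (forall j, W j != [::]) ->
    (forall g g', g \in path_edges W -> g' \in path_edges W -> ~ crosses g g') ->
  exists S, [/\ polygons S,
    (forall g g', g \in path_edges S -> g' \in path_edges S -> ~ crosses g g') &
    ambient_isotopic (trace_of (edges (cat_fam W U))) (trace_of (edges S))].
Proof.
have [n] := ubnP (\sum_j size (U j)).
elim: n W U => // n IH W U; rewrite ltnS => sn pW W0 bb.
have [U0|/existsNP[i Ui]] := pselect (forall i, U i = [::]).
  have EW : cat_fam W U = W by apply: funext => j; rewrite /cat_fam U0 cats0.
  exists W; rewrite EW in pW *; split=> //; exact: ambient_isotopic_refl.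
case Ei : (U i) Ui => [//|u U'] _.
have [Q [p' W0' bb' iso]] := recolour pW W0 Ei bb.
have [|S [pS bS iS]] := IH _ _ _ p' W0' bb'; last first.
  by exists S; split=> //; exact: ambient_isotopic_trans iS.
apply: leq_trans sn; rewrite (bigD1 i)//= [X in (_ < X)%N](bigD1 i)//= eqxx Ei /=.
rewrite ltnS leq_add2l; apply: eq_leq; apply: eq_bigr => j /negPf ji.
by rewrite ji.
Qed.

End OuterLoop.

(** * Shearing into general position *)

Section Shear.
Context {R : realType}.
Local Notation pt := 'rV[R]_3.
Local Notation edge := (pt * pt)%type.
Local Notation sh := (@proj_plane R).
Implicit Types (e f g : edge) (E : seq edge) (x y z w : pt).

Record embedded E : Prop := Embedded {
  emb_neq : forall e, e \in E -> e.1 <> e.2;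
  emb_vertex : forall e f x, e \in E -> f \in E -> endp x f ->
    seg e.1 e.2 x -> endp x e;
  emb_disj : forall e f z, e \in E -> f \in E -> ~ shares e f ->
    seg e.1 e.2 z -> ~ seg f.1 f.2 z;
  emb_same : forall e f, e \in E -> f \in E -> same_ends e f -> e = f }.

(** Shearing and then projecting kills the direction [(- s, - s ^+ 2, 1)]. Its coordinates are
    linearly independent polynomials, so that a given plane contains it for finitely many [s]
    only. *)
Definition slope (s : R) : pt := \row_j [:: s; s ^+ 2; 0]`_j.
Definition shear (s : R) x : pt := x + height x *: slope s.
Definition shear_edge (s : R) e : edge := (shear s e.1, shear s e.2).

Lemma height_slope s : height (slope s) = 0.
Proof. by rewrite /height mxE. Qed.

Lemma shear_line s x y (t : R) :
  shear s (x + t *: (y - x)) = shear s x + t *: (shear s y - shear s x).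
Proof.
by rewrite /shear heightD heightZ heightB; apply/rowP => i; rewrite !mxE; ring.
Qed.

Lemma shear_seg s x y : [set shear s z | z in seg x y] = seg (shear s x) (shear s y).
Proof.
apply/seteqP; split=> [_ [_ [t t01 ->] <-]|_ [t t01 ->]].
  by exists t => //; rewrite shear_line.
by exists (x + t *: (y - x)); [exists t|rewrite shear_line].
Qed.

Lemma height_shear s x : height (shear s x) = height x.
Proof. by rewrite /shear heightD heightZ height_slope mulr0 addr0. Qed.

Lemma shear_inj s : injective (shear s).
Proof.
move=> x y E; have h : height x = height y by rewrite -(height_shear s x) E height_shear.
by move: E; rewrite /shear h => /addIr.
Qed.

Lemma shear_trace s E :
  [set shear s z | z in trace_of E] = trace_of (map (shear_edge s) E).
Proof.
apply/seteqP; split=> [_ [z [e eE ze] <-]|z [_ /mapP[e eE ->]]].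
  exists (shear_edge s e); first exact: map_f.
  by rewrite /= -shear_seg; exists z.
by rewrite /= -shear_seg => -[w we <-]; exists w => //; exists e.
Qed.

(* [N] is a nonzero normal to the plane of [w1] and [w2]; when that plane
   contains the projection direction of the sheared picture, [s] is a root. *)
Lemma slope_poly w1 w2 : exists2 P : {poly R}, P != 0 &
  forall s (k1 k2 : R), k1 *: w1 + k2 *: w2 <> 0 ->
    sh (shear s (k1 *: w1 + k2 *: w2)) = 0 -> root P s.
Proof.
have [N N0 [N1 N2]] : exists2 N : 'cV[R]_3, N != 0 & dotc N w1 = 0 /\ dotc N w2 = 0.
  pose A : 'M[R]_(3, 1 + 1) := row_mx w1^T w2^T.
  have : (0 < \rank (kermx A))%N.
    rewrite mxrank_ker subn_gt0; apply: leq_ltn_trans (rank_leq_col A) _.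
    by [].
  rewrite lt0n mxrank_eq0 => /rowV0Pn[v /sub_kermxP vA v0].
  exists v^T; first by rewrite trmx_eq0.
  move: vA; rewrite /A mul_mx_row -row_mx0 => /eq_row_mx[h1 h2].
  by split; rewrite /dotc (_ : _ *m _ = 0) ?mxE//;
    apply: trmx_inj; rewrite trmx_mul trmxK ?h1 ?h2 trmx0.
pose n0 := N 0 0; pose n1 := N 1 0; pose n2 := N 2 0.
have dE x : dotc N x = x 0 0 * n0 + x 0 1 * n1 + x 0 2 * n2.
  rewrite /dotc mxE !big_ord_recl big_ord0 addr0 addrA /n0 /n1 /n2.
  by congr (_ * N _ _ + x _ _ * N _ _ + x _ _ * N _ _); apply: val_inj.
(* Minus the value of the normal [N] on the direction [(- s, - s ^+ 2, 1)]. *)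
pose P : {poly R} := Poly [:: - n2; n0; n1].
exists P.
  apply: contraNneq N0 => P0.
  have c0 : P`_0 = - n2 by rewrite coef_Poly.
  have c1 : P`_1 = n0 by rewrite coef_Poly.
  have c2 : P`_2 = n1 by rewrite coef_Poly.
  move: c0 c1 c2; rewrite P0 !coef0 => c0 c1 c2.
  apply/eqP/colP => i; rewrite mxE.
  case: i => [[|[|[|//]]] hi].
  - by rewrite [RHS]c1; congr (N _ _); apply: val_inj.
  - by rewrite [RHS]c2; congr (N _ _); apply: val_inj.
  - have n20 : n2 = 0 by lra.
    by rewrite -[RHS]n20; congr (N _ _); apply: val_inj.
move=> s k1 k2; set w := _ + _ => w0 sw.
have Nw : dotc N w = 0 by rewrite /w dotcD !dotcZ N1 N2 !mulr0 addr0.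
move: w w0 sw Nw => w w0 sw Nw.
have hE : height w = w 0 2 by congr (w _ _); apply: val_inj.
have s0 : w 0 0 + w 0 2 * s = 0.
  have /rowP/(_ 0) := sw; rewrite !mxE/= -hE => <-.
  by congr (w _ _ + _ * _); apply: val_inj.
have s1 : w 0 1 + w 0 2 * s ^+ 2 = 0.
  have /rowP/(_ 1) := sw; rewrite !mxE/= -hE => <-.
  by congr (w _ _ + _ * _); apply: val_inj.
have h0 : w 0 2 != 0.
  apply/eqP => h0; apply: w0; apply/rowP => i; rewrite mxE.
  move: s0 s1; rewrite h0 !mul0r !addr0 => s0 s1.
  case: i => [[|[|[|//]]] hi].
  - by rewrite -[RHS]s0; congr (w _ _); apply: val_inj.
  - by rewrite -[RHS]s1; congr (w _ _); apply: val_inj.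
  - by rewrite -[RHS]h0; congr (w _ _); apply: val_inj.
apply/rootP/(mulfI h0); rewrite mulr0 horner_Poly /=.
move: Nw; rewrite dE.
have -> : w 0 0 = - (w 0 2 * s) by lra.
have -> : w 0 1 = - (w 0 2 * s ^+ 2) by lra.
by move=> H; rewrite -[RHS]oppr0 -[in RHS]H; ring.
Qed.

Lemma avoid_roots (Ps : seq {poly R}) : (forall P, P \in Ps -> P != 0) ->
  exists s, forall P, P \in Ps -> ~ root P s.
Proof.
move=> P0; pose Q := \prod_(P <- Ps) P.
have Q0 : Q != 0 by rewrite prodf_seq_neq0; apply/allP.
apply: contrapT => H.
have rQ s : root Q s.
  apply: contrapT => nr; apply: H; exists s => P PPs rP; apply: nr.
  by rewrite /Q (big_rem P)//= rootM rP.
have := max_poly_roots Q0 (rs := [seq n%:R | n <- iota 0 (size Q)]).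
rewrite size_map size_iota ltnn => H'.
suff : false by [].
apply: H'; first by apply/allP => x _; exact: rQ.
rewrite map_inj_uniq ?iota_uniq// => m n /eqP.
by rewrite eqr_nat => /eqP.
Qed.

(** An edge that projects to a point and a vertex that projects onto an edge [e] both make some
    [k1 *: (x - e.1) + k2 *: (e.2 - e.1)] project to 0; one polynomial for each vertex and edge
    excludes them all. The other conditions are spatial and survive the injective shear. *)
Lemma shear_good E : embedded E -> exists s, good (map (shear_edge s) E).
Proof.
move=> [e0 e1 e2 e3].
pose vs := flatten [seq [:: e.1; e.2] | e <- E].
have vsE e x : e \in E -> endp x e -> x \in vs.
  move=> eE xe; apply/flattenP; exists [:: e.1; e.2]; first exact: map_f.
  by case: xe => ->; rewrite !inE eqxx ?orbT.
have /choice[Pf PfP] : forall q : pt * pt, exists P : {poly R}, P != 0 /\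
   forall s (k1 k2 : R), k1 *: q.1 + k2 *: q.2 <> 0 ->
    sh (shear s (k1 *: q.1 + k2 *: q.2)) = 0 -> root P s.
  by move=> q; have [P P0 H] := slope_poly q.1 q.2; exists P.
pose Ps := [seq Pf (x - e.1, e.2 - e.1) | x <- vs, e <- E].
have [s sP] : exists s, forall P, P \in Ps -> ~ root P s.
  by apply: avoid_roots => P /allpairsP[[x e] [/= _ _ ->]]; case: (PfP (x - e.1, e.2 - e.1)).
exists s.
have sh0 e x (k1 k2 : R) : e \in E -> x \in vs ->
    sh (shear s (k1 *: (x - e.1) + k2 *: (e.2 - e.1))) = 0 ->
    k1 *: (x - e.1) + k2 *: (e.2 - e.1) = 0.
  move=> eE xvs H; apply: contrapT => nz.
  have [_ /(_ s k1 k2 nz H) r] := PfP (x - e.1, e.2 - e.1).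
  apply: (sP (Pf (x - e.1, e.2 - e.1))) => //.
  by apply/allpairsP; exists (x, e).
have shearD x y : shear s (x + y) = shear s x + shear s y.
  by rewrite /shear heightD scalerDl addrACA.
have shearZ (a : R) x : shear s (a *: x) = a *: shear s x.
  by rewrite /shear heightZ scalerDr scalerA.
have shearB x y : shear s (x - y) = shear s x - shear s y.
  by rewrite -scaleN1r shearD shearZ scaleN1r.
have endpE x e : endp (shear s x) (shear_edge s e) <-> endp x e.
  by rewrite /endp /=; split=> [[/shear_inj->|/shear_inj->]|[->|->]]; auto.
have sharesE e f : shares (shear_edge s e) (shear_edge s f) <-> shares e f.
  split=> [[x xe xf]|[x xe xf]]; last by exists (shear s x); apply/endpE.
  have [y yx] : exists y, x = shear s y by case: xe => ->; [exists e.1|exists e.2].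
  by exists y; apply/endpE; rewrite -yx.
split.
- move=> _ /mapP[e eE ->] /= H; apply: (e0 e eE).
  have := @sh0 e e.1 0 1 eE (vsE e e.1 eE (or_introl erefl)).
  rewrite scale0r add0r scale1r => /(_ _)/eqP; rewrite subr_eq0 => h.
  by apply/esym/eqP/h; rewrite shearB shB H subrr.
- move=> _ _ x /mapP[e eE ->] /mapP[f fE ->] xf [t t01 /= xt].
  have [y yx] : exists2 y, x = shear s y & endp y f.
    by case: xf => ->; [exists f.1|exists f.2]; rewrite // /endp; auto.
  move=> yf; rewrite yx; apply/endpE; apply: (e1 e f y eE fE yf).
  exists t => //; have := @sh0 e y 1 (- t) eE (vsE f y fE yf).
  rewrite scale1r scaleNr => /(_ _)/eqP; rewrite subr_eq0 subr_eq => h.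
  rewrite addrC; apply/eqP/h; rewrite shearB shearB shearZ shearB.
  rewrite !(shB, shZ) -yx xt; set p := sh _; set q := sh _.
  by apply/rowP => i; rewrite !mxE; ring.
- move=> _ _ z /mapP[e eE ->] /mapP[f fE ->] nef /=.
  rewrite -!shear_seg => -[x xe <-] [y yf] /shear_inj yx.
  by apply: (e2 e f x eE fE) => //; [move=> /sharesE|rewrite -yx].
- move=> _ _ /mapP[e eE ->] /mapP[f fE ->] ef; congr shear_edge; apply: e3 => //.
  case: ef => [[/shear_inj h1 /shear_inj h2]|[/shear_inj h1 /shear_inj h2]].
    by left; case: e f h1 h2 {eE fE} => [? ?] [? ?] /= -> ->.
  by right; case: e h1 h2 {eE fE} => [? ?] /= -> ->.
Qed.

End Shear.

(** * Vertices of polygonal curves *)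

Section PathMap.
Context {T U : eqType}.

Lemma pe_map (f : T -> U) l : pe (map f l) = [seq (f p.1, f p.2) | p <- pe l].
Proof. by case: l => [//|x l] /=; elim: l x => [//|y l IH] x /=; rewrite IH. Qed.

Lemma pe_rcons (x : T) l y : pe (x :: rcons l y) = rcons (pe (x :: l)) (last x l, y).
Proof. by elim: l x => [//|z l IH] x; rewrite /= -IH. Qed.

End PathMap.

Section Breakpoints.
Context {R : realType}.
Implicit Types (s t x : R) (ts : seq R).

Lemma pe_lt x ts s t : path <%R x ts -> (s, t) \in pe (x :: ts) ->
  [/\ x <= s, s < t & t <= last x ts].
Proof.
elim: ts x => [//|y ts IH] x /= /andP[xy pts].
have yl : y <= last y ts.
  by elim: (ts) (y) pts => [//|z l IHl] w /= /andP[/ltW wz /IHl]; exact: le_trans.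
rewrite inE => /orP[/eqP[-> ->]//|sts].
have [ys st tl] := IH y pts sts; split=> //; exact: le_trans (ltW xy) ys.
Qed.

Lemma pe_apart x ts s t s' t' : path <%R x ts ->
  (s, t) \in pe (x :: ts) -> (s', t') \in pe (x :: ts) ->
  [\/ (s, t) = (s', t'), t' <= s | t <= s'].
Proof.
elim: ts x => [//|y ts IH] x /= /andP[xy pts].
rewrite !inE => /orP[/eqP[-> ->]|h1] /orP[/eqP[-> ->]|h2].
- by constructor 1.
- by constructor 3; have [] := pe_lt pts h2.
- by constructor 2; have [] := pe_lt pts h1.
- exact: IH h1 h2.
Qed.

Lemma pe_cover x ts u : x <= u <= last x ts -> (0 < size ts)%N ->
  exists s t, (s, t) \in pe (x :: ts) /\ s <= u <= t.
Proof.
elim: ts x => [//|y [|z ts] IH] x /andP[xu ul] _.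
  by exists x, y; rewrite inE eqxx xu.
have [uy|yu] := lerP u y; first by exists x, y; rewrite inE eqxx xu uy.
have [|s [t [st ust]]] := IH y _ isT; first by rewrite (ltW yu).
by exists s, t; split=> //; rewrite inE st orbT.
Qed.

Lemma path_lt_bounds x ts y : path <%R x (rcons ts y) ->
  forall z, z \in x :: ts -> x <= z < y.
Proof.
elim: ts x => [|w ts IH] x /=.
  by rewrite andbT => xy z; rewrite inE => /eqP->; rewrite lexx.
move=> /andP[xw pw] z; rewrite inE => /orP[/eqP->|zw].
  by rewrite lexx /=; have /andP[_] := IH w pw w (mem_head _ _); exact: lt_trans.
by have /andP[wz ->] := IH w pw z zw; rewrite (le_trans (ltW xw)).
Qed.

(** Breakpoints may be repeated in [polygonal]; dropping the repetitions makes them strictly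
    increasing. *)
Lemma polygonal_breaks d (f : R -> 'rV[R]_d) : polygonal f ->
  exists ts, path <%R 0 (rcons ts 1) /\
    forall s t, (s, t) \in pe (0 :: rcons ts 1) -> affine_between f s t.
Proof.
move=> [_ [n [b [b0 bn H]]]].
suff K m : (m <= n)%N -> exists ls, [/\ path <%R 0 ls, last 0 ls = b m &
    forall s t, (s, t) \in pe (0 :: ls) -> affine_between f s t].
  have [ls [pl ll al]] := K n (leqnn n).
  case/lastP: ls pl ll al => [_ /= l0|ts x]; last first.
    by rewrite last_rcons => p xb a; rewrite xb bn in p a; exists ts.
  by move/eqP: l0; rewrite bn eq_sym oner_eq0.
elim: m => [_|m IH mn]; first by exists [::]; split=> //=; rewrite ?b0.
have [ls [pl ll al]] := IH (ltnW mn).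
have [bb ab] := H m mn.
have [E|ne] := eqVneq (b m) (b m.+1); first by exists ls; rewrite -E.
exists (rcons ls (b m.+1)); split; last 1 first.
- move=> s t; rewrite pe_rcons mem_rcons inE => /orP[/eqP[-> ->]|]; last exact: al.
  by rewrite ll.
- by rewrite rcons_path pl ll lt_neqAle ne.
- by rewrite last_rcons.
Qed.

Lemma affine_seg d (f : R -> 'rV[R]_d) s t u : affine_between f s t -> 0 <= u <= 1 ->
  s <= t -> f (s + u * (t - s)) = f s + u *: (f t - f s).
Proof.
move=> [p [v H]] u01 st.
rewrite (H (s + _)); last by apply/andP; split; nra.
rewrite (H t) ?st ?lexx// (H s) ?st ?lexx//.
by apply/rowP => i; rewrite !mxE; ring.
Qed.

Lemma affine_segP d (f : R -> 'rV[R]_d) s t z : affine_between f s t -> s < t ->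
  seg (f s) (f t) z <-> exists2 x, s <= x <= t & z = f x.
Proof.
move=> af st; split=> [[u u01 ->]|[x xst ->]].
  by exists (s + u * (t - s)); [nra|rewrite affine_seg// ltW].
exists ((x - s) / (t - s)).
  by rewrite divr_ge0 ?ler_pdivrMr ?mul1r//=; lra.
rewrite -affine_seg//; last exact: ltW.
- by rewrite divfK ?subrKC// gt_eqF//; lra.
- by rewrite divr_ge0 ?ler_pdivrMr ?mul1r//=; lra.
Qed.

Lemma periodic_int T (f : R -> T) t (m : int) : periodic1 f -> f (t + m%:~R) = f t.
Proof.
move=> pf; have N (n : nat) x : f (x + n%:R) = f x.
  elim: n => [|n IH]; first by rewrite addr0.
  by rewrite -natr1 addrA pf.
case: m => n; first exact: N.
by rewrite NegzE mulrNz -[LHS](N n.+1) subrK.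
Qed.

Lemma frac_params t : 0 <= t - (Num.floor t)%:~R < 1.
Proof. by have := floor_le t; have := floorD1_gt t; rewrite intrD; lra. Qed.

End Breakpoints.

Section CurvePolygons.
Context {R : realType} {k : nat}.
Local Notation pt := 'rV[R]_3.
Variable c : curves R k 3.
Hypothesis pc : polygonal_link_param c.

Let per i : periodic1 (c i). Proof. by case: pc => -[]. Qed.

Let c1 i : c i 1 = c i 0.
Proof. by rewrite -[1]add0r per. Qed.

Let cinj i j x y : 0 <= x < 1 -> 0 <= y < 1 -> c i x = c j y -> i = j /\ x = y.
Proof.
move=> x01 y01 E; case: pc => -[_ _ inj] _.
by have [] := inj (i, x) (j, y) x01 y01 E.
Qed.

Let cinj01 i j x y : 0 <= x <= 1 -> 0 <= y <= 1 -> c i x = c j y ->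
  i = j /\ [\/ x = y, x = 0 /\ y = 1 | x = 1 /\ y = 0].
Proof.
move=> x01 y01 E.
have [x1|x1] := eqVneq x 1; have [y1|y1] := eqVneq y 1.
- subst x y; move: E; rewrite !c1 => /cinj[]; [lra|lra|].
  by move=> -> _; split=> //; constructor 1.
- subst x; move: E; rewrite c1 => /cinj[]; [lra| |].
    by rewrite lt_neqAle y1; lra.
  by move=> -> <-; split=> //; constructor 3.
- subst y; move: E; rewrite c1 => /cinj[]; [|lra|].
    by rewrite lt_neqAle x1; lra.
  by move=> -> ->; split=> //; constructor 2.
- move: E => /cinj[]; [by rewrite lt_neqAle x1; lra|by rewrite lt_neqAle y1; lra|].
  by move=> -> ->; split=> //; constructor 1.
Qed.

(** The vertices are the points at the breakpoints except 1, whose point is that at 0: the last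
    interval gives the closing edge. *)
Lemma curve_polygons : exists V : 'I_k -> seq pt,
  [/\ forall i, V i != [::], forall i, uniq (V i),
      forall i j x, x \in V i -> x \in V j -> i = j, embedded (edges V) &
      trace c = trace_of (edges V)].
Proof.
have /choice[ts tsP] : forall i, exists ts, path <%R 0 (rcons ts 1) /\
    forall s t, (s, t) \in pe (0 :: rcons ts 1) -> affine_between (c i) s t.
  by move=> i; apply: polygonal_breaks; case: pc.
pose I i := pe (0 :: rcons (ts i) 1).
have tsp i : path <%R 0 (rcons (ts i) 1) by case: (tsP i).
have Ilt i s t : (s, t) \in I i -> [/\ 0 <= s, s < t & t <= 1].
  by move=> /(pe_lt (tsp i)); rewrite last_rcons.
have Iaff i s t : (s, t) \in I i -> affine_between (c i) s t.
  by case: (tsP i) => _; apply.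
pose V i := map (c i) (0 :: ts i).
have VI i : rcons (pe (V i)) (closing (V i)) = [seq (c i p.1, c i p.2) | p <- I i].
  rewrite /I pe_rcons map_rcons -pe_map /closing /V; congr (rcons _ (_, _)).
    by rewrite /= last_map.
  by rewrite /= c1.
have edgeP e : e \in edges V <->
    exists i s t, (s, t) \in I i /\ e = (c i s, c i t).
  split=> [/gatherP[i]|[i [s [t [st ->]]]]].
    by rewrite VI => /mapP[[s t] st ->]; exists i, s, t.
  by apply/gatherP; exists i; rewrite VI; apply/mapP; exists (s, t).
have segP i s t z : (s, t) \in I i -> seg (c i s) (c i t) z ->
    exists2 x, s <= x <= t & z = c i x.
  by move=> st; have [_ lt _] := Ilt _ _ _ st; move/(affine_segP z (Iaff _ _ _ st) lt).
have mid i s t : (s, t) \in I i ->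
    c i ((s + t) / 2) = c i s + 2^-1 *: (c i t - c i s).
  move=> st; have [_ lt _] := Ilt _ _ _ st.
  rewrite -(affine_seg (Iaff _ _ _ st)) ?ltW//; first by congr (c i _); lra.
  lra.
(* Distinct intervals have at most ends in common, also after identifying 0 with 1, so distinct
   edges meet only at vertices of both. *)
have meet i s t j s' t' x y : (s, t) \in I i -> (s', t') \in I j ->
    s <= x <= t -> s' <= y <= t' -> c i x = c j y ->
    i = j /\ ((s, t) = (s', t') \/ exists2 w, (w = s \/ w = t) &
      (exists2 w', (w' = s' \/ w' = t') & c i w = c j w') /\ c i x = c i w).
  move=> st st' xst yst E.
  have [s0 slt t1] := Ilt _ _ _ st; have [s0' slt' t1'] := Ilt _ _ _ st'.
  have [||ij H] := cinj01 _ _ E; [lra|lra|].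
  split=> //; subst j; case: H => [xy|[x0 y1]|[x1 y0]].
  - have [eqst|le1|le2] := pe_apart (tsp i) st st'; first by left.
      right; exists s; first by left.
      have xs : x = s by lra.
      by split; [exists t'; [right|congr (c i _); lra]|rewrite xs].
    right; exists t; first by right.
    have xt : x = t by lra.
    by split; [exists s'; [left|congr (c i _); lra]|rewrite xt].
  - right; exists s; first by left.
    have -> : s = 0 by lra.
    split; last by rewrite x0.
    by exists t'; [right|]; have -> : t' = 1 by lra; rewrite c1.
  - right; exists t; first by right.
    have -> : t = 1 by lra.
    split; last by rewrite x1.
    by exists s'; [left|]; have -> : s' = 0 by lra; rewrite c1.
have lt1 i x : x \in 0 :: ts i -> 0 <= x < 1.
  exact: (path_lt_bounds (tsp i)).
have memV i z : z \in V i -> exists2 x, 0 <= x < 1 & z = c i x.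
  by move=> /mapP[x /lt1 x01 ->]; exists x.
have ends i s t w z : (s, t) \in I i -> w = s \/ w = t -> z = c i w ->
    endp z (c i s, c i t).
  by move=> _ [->|->] ->; [left|right].
exists V; split.
- by [].
- move=> i; rewrite map_inj_in_uniq.
    have : sorted <%R (0 :: ts i).
      by have := tsp i; rewrite rcons_path => /andP[].
    exact: lt_sorted_uniq.
  by move=> x y /lt1 x01 /lt1 y01 /cinj[].
- by move=> i j z /memV[x x01 ->] /memV[y y01] /cinj[].
- split.
  + move=> e /edgeP[i [s [t [st ->]]]] /= E.
    have [s0 slt t1] := Ilt _ _ _ st.
    have := mid i s t st; rewrite -E subrr scaler0 addr0 => /cinj01[||_ H]; [lra|lra|].
    by clear E; case: H => [H|[H1 H2]|[H1 H2]]; lra.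
  + move=> e f z /edgeP[i [s [t [st ->]]]] /edgeP[j [s' [t' [st' ->]]]] zf.
    have [s0' slt' t1'] := Ilt _ _ _ st'.
    have [w wst zw] : exists2 w, s' <= w <= t' & z = c j w.
      by case: zf => /= ->; [exists s'|exists t'] => //; lra.
    move=> /(segP i s t z st)[x xst zx].
    have := meet i s t j s' t' x w st st' xst wst; rewrite -zx -zw.
    move=> /(_ erefl)[ij [[ss tt]|[v vst [_ zv]]]].
      by move: zf; rewrite ij ss tt.
    exact: (ends i s t v z st vst zv).
  + move=> e f z /edgeP[i [s [t [st ->]]]] /edgeP[j [s' [t' [st' ->]]]] nsh.
    move=> /(segP i s t z st)[x xst zx] /(segP j s' t' z st')[y yst zy].
    have := meet i s t j s' t' x y st st' xst yst; rewrite -zx -zy.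
    move=> /(_ erefl)[ij [[ss tt]|[v vst [[v' v'st vv'] zv]]]]; apply: nsh.
      by rewrite ij ss tt; exists (c j s'); left.
    exists z; first exact: (ends i s t v z st vst zv).
    by apply: (ends j s' t' v' z st' v'st); rewrite -vv'.
  + move=> e f /edgeP[i [s [t [st ->]]]] /edgeP[j [s' [t' [st' ->]]]].
    case=> //= -[E1 E2].
    have [s0 slt t1] := Ilt _ _ _ st; have [s0' slt' t1'] := Ilt _ _ _ st'.
    (* Edges with the same ends have the same midpoint, and this point determines its parameter,
       which is the middle of both intervals. *)
    have : c i ((s + t) / 2) = c j ((s' + t') / 2).
      rewrite (mid i s t st) (mid j s' t' st') E1 E2.
      by apply/rowP => l; rewrite !mxE; lra.
    move=> /cinj01[||ij H]; [lra|lra|].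
    have {}H : s + t = s' + t' by case: H => [H|[H1 H2]|[H1 H2]]; lra.
    clear E1 E2; subst j; have [[<- <-]//|le|le] := pe_apart (tsp i) st st'; exfalso; lra.
- apply/seteqP; split=> [_ [i [t ->]]|z [e /edgeP[i [s [t [st ->]]]] ze]].
    have u01 := frac_params t; set u := t - _ in u01.
    have -> : c i t = c i u by rewrite -(periodic_int u (Num.floor t) (per i)) subrK.
    have [||s [s' [ss us]]] := @pe_cover _ 0 (rcons (ts i) 1) u.
    - by rewrite last_rcons; lra.
    - by rewrite size_rcons.
    exists (c i s, c i s'); first by apply/edgeP; exists i, s, s'.
    have [_ lt _] := Ilt _ _ _ ss.
    by apply/(affine_segP _ (Iaff _ _ _ ss) lt); exists u.
  by have [x _ ->] := segP i s t z st ze; exists i, x.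
Qed.

End CurvePolygons.

(** * Closing edges *)

Lemma mem_rot3 (T : eqType) (x y z : T) (s : seq T) :
  [:: x, y, z & s] =i [:: z, x, y & s].
Proof.
by move=> w; rewrite !inE; case: (w == x); case: (w == y); case: (w == z).
Qed.

Lemma perm_rebase (T : eqType) (x y z : T) (s : seq T) :
  perm_eq (z :: s ++ [:: x; y]) ([:: y; z] ++ x :: s).
Proof. by apply/permP => a; rewrite /= count_cat /=; lia. Qed.

Section Closing.
Context {R : realType} {k : nat}.
Local Notation pt := 'rV[R]_3.
Local Notation edge := (pt * pt)%type.
Local Notation sh := (@proj_plane R).
Implicit Types (e f g : edge) (E F : seq edge) (x y z w : pt) (V : 'I_k -> seq pt).

(** Each other edge meets the shadow of [(x, y)] at most once by [cross_unique], so the interval can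
    be shrunk away from one edge after another. *)
Lemma free_subsegment (x y : pt) F : good ((x, y) :: F) -> (x, y) \notin F ->
  exists al be : R, [/\ 0 < al, al < be, be < 1 &
    forall f t, f \in F -> al <= t <= be -> ~ esh f (sh x + t *: (sh y - sh x))].
Proof.
move=> gE nF.
suff K (G : seq edge) : {subset G <= F} -> exists al be : R, [/\ 0 < al, al < be, be < 1 &
    forall f t, f \in G -> al <= t <= be -> ~ esh f (sh x + t *: (sh y - sh x))].
  exact: K.
elim: G => [_|f G IH sub].
  by exists (1 / 3), (2 / 3); split=> [|||//]; lra.
have fF : f \in F by apply: sub; rewrite mem_head.
have [|al [be [al0 ab be1 H]]] := IH.
  by move=> g gG; apply: sub; rewrite inE gG orbT.
have nxy : sh y - sh x != 0.
  by rewrite subr_eq0 eq_sym; apply/eqP/(good_neq gE (mem_head _ _)).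
have one t t' : 0 <= t <= 1 -> 0 <= t' <= 1 ->
    esh f (sh x + t *: (sh y - sh x)) -> esh f (sh x + t' *: (sh y - sh x)) -> t = t'.
  move=> t01 t01' ft ft'.
  have xyf : (x, y) <> f by move=> xyf; rewrite xyf fF in nF.
  have fE : f \in (x, y) :: F by rewrite inE fF orbT.
  have := cross_unique gE (mem_head _ _) fE xyf (ex_intro2 _ _ t t01 erefl) ft
    (ex_intro2 _ _ t' t01' erefl) ft'.
  move=> /addrI/eqP; rewrite -subr_eq0 -scalerBl scaler_eq0 (negPf nxy) orbF.
  by rewrite subr_eq0 => /eqP.
have sub_ok al' be' : al <= al' -> be' <= be -> 0 < al' -> al' < be' -> be' < 1 ->
    (forall t, al' <= t <= be' -> ~ esh f (sh x + t *: (sh y - sh x))) ->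
    exists al be : R, [/\ 0 < al, al < be, be < 1 &
    forall g t, g \in f :: G -> al <= t <= be -> ~ esh g (sh x + t *: (sh y - sh x))].
  move=> h1 h2 h3 h4 h5 h6; exists al', be'; split=> // g t.
  rewrite inE => /orP[/eqP->|gG] tb; first exact: h6.
  by apply: H => //; lra.
have [[t [tb ft]]|none] := pselect (exists t, al <= t <= be /\
    esh f (sh x + t *: (sh y - sh x))); last first.
  apply: (sub_ok al be) => // t tb ft.
  by apply: none; exists t.
have [tbe|tbe] := ltrP t be.
  apply: (sub_ok ((t + be) / 2) be); [lra|lra|lra|lra|lra|] => t' tb' ft'.
  by have tt : t = t' by [apply: one ft ft'; lra]; lra.
apply: (sub_ok al ((al + be) / 2)); [lra|lra|lra|lra|lra|] => t' tb' ft'.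
by have tt : t = t' by [apply: one ft ft'; lra]; lra.
Qed.

Lemma vertex_edge V j w : w \in V j -> exists2 e, endp w e &
  e \in rcons (pe (V j)) (closing (V j)).
Proof.
move=> wV; have [->|/eqP wl] := eqVneq w (last 0 (V j)).
  by exists (closing (V j)); [left|rewrite mem_rcons mem_head].
have [g gV wg] := mem_pe_first wV wl.
by exists g; [left|rewrite mem_rcons inE gV orbT].
Qed.

(** For the treated components the closing edge crosses no edge at all, a property that persists
    when other edges are subdivided. *)
Let closed V (s : seq 'I_k) : Prop :=
  [/\ forall j, V j != [::], forall j, uniq (V j),
      forall i j x, x \in V i -> x \in V j -> i = j, good (edges V) &
      forall j, j \in s -> (2 < size (V j))%N /\
        forall e, e \in edges V -> ~ crosses (closing (V j)) e].

(** The first edge [(x, y)] is subdivided at the ends [m1] and [m2] of a free subsegment. Listing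
    the vertices from [m2] around to [m1] makes this subsegment the closing edge, without changing
    the polygon. *)
Let close_one V (s : seq 'I_k) (i : 'I_k) : i \notin s -> closed V s ->
  exists V', closed V' (i :: s) /\ trace_of (edges V) = trace_of (edges V').
Proof.
move=> is_ [V0 uV dV gV cV].
have clE j : closing (V j) \in edges V by apply/edges_mem; exists j; right.
have [x [y [r Vi]]] : exists x y r, V i = [:: x, y & r].
  move: (V0 i) (good_neq gV (clE i)); case: (V i) => [//|x [|y r]] _ /=.
    by [].
  by move=> _; exists x, y, r.
have xyi : (x, y) \in pe (V i) by rewrite Vi mem_head.
have xyE : (x, y) \in edges V by apply/edges_mem; exists i; left.
pose F := [seq e <- edges V | e != (x, y)].
have EF : edges V =i (x, y) :: F.
  move=> e; rewrite inE mem_filter; have [->|//] := eqVneq e (x, y).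
  by rewrite xyE.
have gF : good ((x, y) :: F) by apply: good_cat_eq gV.
have nF : (x, y) \notin F by rewrite mem_filter eqxx.
have [al [be [al0 ab be1 free]]] := free_subsegment gF nF.
have al01 : 0 < al < 1 by lra.
pose m1 := x + al *: (y - x); pose m2 := x + be *: (y - x).
have shm t : sh (x + t *: (y - x)) = sh x + t *: (sh y - sh x).
  by rewrite shD shZ shB.
have m1F f : f \in F -> ~ esh f (sh m1) by move=> fF; rewrite shm; apply: free => //; lra.
have m2F f : f \in F -> ~ esh f (sh m2) by move=> fF; rewrite shm; apply: free => //; lra.
have [g1 [n1 n1']] := good_subdiv gF nF al01 m1F.
have g2 : good [:: (m1, y), (x, m1) & F].
  by apply: good_cat_eq g1; exact: mem_swap2.
have n2 : (m1, y) \notin (x, m1) :: F.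
  by move: n1; rewrite !inE !negb_or eq_sym n1' andbT => /andP[].
pose t := (be - al) / (1 - al).
have t01 : 0 < t < 1 by rewrite divr_gt0 ?ltr_pdivrMr ?mul1r//=; lra.
have m2E : m2 = m1 + t *: (y - m1).
  rewrite /m1 /m2 /t; apply/rowP => l; rewrite !mxE; field.
  by rewrite gt_eqF//; lra.
have nxy : sh y - sh x != 0.
  by rewrite subr_eq0 eq_sym; apply/eqP/(good_neq gF (mem_head _ _)).
have inj (a b : R) : sh x + a *: (sh y - sh x) = sh x + b *: (sh y - sh x) -> a = b.
  move=> /addrI/eqP; rewrite -subr_eq0 -scalerBl scaler_eq0 (negPf nxy) orbF.
  by rewrite subr_eq0 => /eqP.
have m2F' f : f \in (x, m1) :: F -> ~ esh f (sh m2).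
  rewrite inE => /orP[/eqP->|]; last exact: m2F.
  move=> [b b01 /=]; rewrite !shm => E.
  have bb : be = b * al.
    by apply: inj; rewrite E; apply/rowP => l; rewrite !mxE; ring.
  by clear -al0 ab b01 bb; nra.
have := good_subdiv g2 n2 t01; rewrite -m2E => /(_ m2F')[g3 _].
pose N := [:: (x, m1); (m1, m2); (m2, y)].
have gN : good (N ++ F).
  by apply: good_cat_eq g3; exact: mem_rot3.
pose V' j := if j == i then m2 :: y :: r ++ [:: x; m1] else V j.
have V'j j : j <> i -> V' j = V j by move=> /eqP/negPf ji; rewrite /V' ji.
have V'i : V' i = m2 :: y :: r ++ [:: x; m1] by rewrite /V' eqxx.
have uVi := uV i; rewrite Vi in uVi.
have xr : x \notin y :: r by move: uVi => /andP[].
have clVi : closing (V i) = (last y r, x) by rewrite /closing Vi.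
have clV'i : closing (V' i) = (m1, m2) by rewrite /closing V'i /= last_cat.
have peV'i : pe (V' i) = (m2, y) :: pe (y :: r) ++ [:: (last y r, x); (x, m1)].
  rewrite V'i; transitivity ((m2, y) :: pe (y :: r ++ [:: x; m1])) => //.
  congr cons; rewrite -cat_cons.
  have -> : y :: r = rcons (belast y r) (last y r) by rewrite lastI.
  by rewrite cat_rcons pe_split_eq.
have edgesE : edges V' =i N ++ F.
  move=> e; apply/idP/idP.
    have Fin f j : f \in rcons (pe (V j)) (closing (V j)) -> f <> (x, y) -> f \in F.
      move=> fj /eqP fxy; rewrite mem_filter fxy; apply/edges_mem; exists j.
      by move: fj; rewrite mem_rcons inE => /orP[/eqP->|]; auto.
    move=> /gatherP[j]; have [->|/eqP ji] := eqVneq j i; last first.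
      rewrite V'j// mem_cat => ej; rewrite (Fin e j) ?orbT// => exy.
      have s0 : (0 < size (V j))%N by case: (V j) (V0 j).
      have [xj _] := edge_ends ej s0.
      apply: ji; apply: (dV j i x); last by rewrite Vi mem_head.
      by rewrite exy in xj.
    rewrite mem_rcons inE clV'i => /orP[/eqP->|].
      by rewrite mem_cat !inE eqxx orbT.
    rewrite peV'i inE !mem_cat !inE => /or4P[/eqP->|er|/eqP->|/eqP->].
    - by rewrite eqxx !orbT.
    - rewrite (Fin e i) ?orbT//.
        by rewrite Vi mem_rcons inE /= inE er !orbT.
      by move=> exy; move: er xr; rewrite exy => /pe_mem[-> _].
    - rewrite (Fin (last y r, x) i) ?orbT// -?clVi.
        by rewrite mem_rcons mem_head.
      rewrite clVi => -[xl _]; move: xr; rewrite -{1}xl mem_last //.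
    - by rewrite eqxx.
  rewrite mem_cat => /orP[|].
    rewrite !inE => /or3P[/eqP->|/eqP->|/eqP->]; apply/edges_mem; exists i.
    - by left; rewrite peV'i inE mem_cat !inE eqxx !orbT.
    - by right; rewrite clV'i.
    - by left; rewrite peV'i mem_head.
  rewrite mem_filter => /andP[exy /edges_mem[j ej]]; apply/edges_mem; exists j.
  have [ji|/eqP ji] := eqVneq j i; last by rewrite V'j.
  left; rewrite ji peV'i inE mem_cat !inE; move: ej; rewrite ji clVi Vi.
  rewrite inE (negPf exy) /= => -[->|->]; by rewrite ?eqxx !orbT.
have fresh w j : w = m1 \/ w = m2 -> w \notin V j.
  move=> wm; apply/negP => wV; have [e we ej] := vertex_edge wV.
  have wF f : f \in F -> ~ esh f (sh w) by case: wm => ->; [exact: m1F|exact: m2F].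
  have [exy|/eqP exy] := eqVneq e (x, y).
    have x0 : sh x = sh x + 0 *: (sh y - sh x) by rewrite scale0r addr0.
    have y1 : sh y = sh x + 1 *: (sh y - sh x) by rewrite scale1r subrKC.
    have key (q : R) : 0 < q < 1 -> w <> x + q *: (y - x).
      move=> q01 /(congr1 sh); rewrite shm; move: we; rewrite exy => -[] /= ->.
        by rewrite {1}x0 => /inj E; clear -E q01; lra.
      by rewrite {1}y1 => /inj E; clear -E q01; lra.
    by case: wm; apply: key => //; lra.
  apply: (wF e); last exact: esh_end.
  rewrite mem_filter (introF eqP exy) /=; apply/edges_mem; exists j.
  by move: ej; rewrite mem_rcons inE => /orP[/eqP->|]; auto.
have m12 : m1 != m2.
  by apply/eqP => /(congr1 sh); rewrite !shm => /inj; lra.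
have V'sub j w : w \in V' j -> w \in V j \/ j = i /\ (w = m1 \/ w = m2).
  have [->|/eqP ji] := eqVneq j i; last by rewrite V'j//; left.
  rewrite V'i Vi !inE mem_cat !inE => /or4P[/eqP->|->|->|/orP[->|/eqP->]];
    by rewrite ?orbT; auto.
have shcl (s0 : 'rV[R]_2) : esh (m1, m2) s0 -> esh (x, y) s0 /\ forall f, f \in F -> ~ esh f s0.
  move=> [b b01 /=]; rewrite !shm => ->.
  have -> : sh x + al *: (sh y - sh x) + b *: (sh x + be *: (sh y - sh x) -
     (sh x + al *: (sh y - sh x))) = sh x + (al + b * (be - al)) *: (sh y - sh x).
    by apply/rowP => l; rewrite !mxE; ring.
  split; first by exists (al + b * (be - al)) => //; nra.
  by move=> f fF; apply: free => //; nra.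
exists V'; split; last first.
  rewrite (trace_eqi EF) (trace_split x y F al01) -/m1.
  rewrite (trace_eqi (mem_swap2 _ _ _)) (trace_split m1 y _ t01) -m2E.
  by rewrite (trace_eqi (mem_rot3 _ _ _ _)) (trace_eqi edgesE).
split.
- by move=> j; rewrite /V'; case: ifP.
- move=> j; have [->|/eqP ji] := eqVneq j i; last by rewrite V'j.
  rewrite V'i (perm_uniq (perm_rebase x m1 m2 (y :: r))) -Vi.
  rewrite cat_uniq uV andbT /= inE m12 /=.
  apply/hasPn => w wV; rewrite !inE; apply/negP => /orP[/eqP wm|/eqP wm].
    by move: wV; rewrite wm; apply/negP/fresh; left.
  by move: wV; rewrite wm; apply/negP/fresh; right.
- move=> j1 j2 w /V'sub[w1|[-> w1]] /V'sub[w2|[-> w2]] //.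
  + exact: dV w1 w2.
  + by case/negP: (fresh w j1 w2).
  + by case/negP: (fresh w j2 w1).
- by apply: good_cat_eq gN => e; rewrite edgesE.
- move=> j; have [->|/eqP ji] := eqVneq j i.
    move=> _; split; first by rewrite V'i /= size_cat addnS.
    move=> e; rewrite edgesE clV'i mem_cat => eE [nsh [s0 [s1 s2]]].
    have [sxy sF] := shcl s0 s1.
    case/orP: eE => [|eF]; last exact: (sF e eF).
    rewrite !inE => /or3P[] /eqP eE; apply: nsh; rewrite eE.
    - by exists m1; [left|right].
    - by exists m1; left.
    - by exists m2; [right|left].
  rewrite inE => /orP[/eqP//|js]; have [szj cj] := cV j js.
  rewrite V'j//; split=> // e; rewrite edgesE mem_cat => /orP[eN|eF]; last first.
    by apply: cj; move: eF; rewrite mem_filter => /andP[].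
  move=> [nsh [s0 [s1 s2]]]; apply: (cj (x, y) xyE); split.
    move=> [w wc wxy]; apply: ji; apply: (dV j i w).
      have [] := @edge_ends _ _ V (closing (V j)) j.
      - by rewrite mem_rcons mem_head.
      - exact: ltn_trans szj.
      by case: wc => ->.
    by rewrite Vi; case: wxy => ->; rewrite !inE eqxx ?orbT.
  exists s0; split=> //; move: eN s2; rewrite !inE => /or3P[] /eqP-> s2.
  - by move: s2; rewrite /esh/= shm; exact: seg_cutW.
  - by have [] := shcl s0 s2.
  - move: s2 => [b b01 /=]; rewrite shm => ->.
    exists (be + b * (1 - be)); first nra.
    by apply/rowP => l; rewrite !mxE; ring.
Qed.

Lemma close_all V : (forall j, V j != [::]) -> (forall j, uniq (V j)) ->
    (forall i j x, x \in V i -> x \in V j -> i = j) -> good (edges V) ->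
  exists V', polygons V' /\ trace_of (edges V) = trace_of (edges V').
Proof.
move=> V0 uV dV gV.
have [V' [[V0' uV' dV' gV' cV'] tr]] : exists V', closed V' (enum 'I_k) /\
    trace_of (edges V) = trace_of (edges V').
  have := enum_uniq 'I_k; elim: (enum 'I_k) => [|i s IH].
    by move=> _; exists V; split.
  move=> /= /andP[is_ /IH[V1 [c1 t1]]].
  by have [V2 [c2 t2]] := close_one is_ c1; exists V2; rewrite t1.
exists V'; split=> //; split=> //.
- by move=> j; case: (cV' j); rewrite ?mem_enum.
- move=> i j; case: (cV' i); rewrite ?mem_enum// => _; apply.
  by apply/edges_mem; exists j; right.
Qed.

End Closing.

(** * Diagrams *)

Section ClosedCurve.
Context {R : realType} {d : nat}.
Implicit Types (t u : R) (v : nat -> 'rV[R]_d.+1).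

Definition clamp u : R := Num.min (Num.max u 0) 1.

(** Summing clamped contributions of the edges makes continuity immediate, without gluing at the
    vertices, and extends the path by constants outside the unit interval. *)
Definition polyline n v u : 'rV[R]_d.+1 :=
  v 0%N + \sum_(0 <= m < n) clamp (n%:R * u - m%:R) *: (v m.+1 - v m).

Definition closed_curve n v t := polyline n v (t - (Num.floor t)%:~R).

Lemma clamp0 u : u <= 0 -> clamp u = 0.
Proof. by move=> u0; rewrite /clamp max_r// min_l. Qed.

Lemma clamp1 u : 1 <= u -> clamp u = 1.
Proof. by move=> u1; rewrite /clamp max_l ?min_r//; lra. Qed.

Lemma clamp_id u : 0 <= u <= 1 -> clamp u = u.
Proof. by move=> u01; rewrite /clamp max_l ?min_l//; lra. Qed.

Lemma cont_clamp : continuous clamp.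
Proof.
by apply: cont_min; [apply: cont_max; [exact: cont_id|]|]; exact: cont_cst.
Qed.

Lemma cont_polyline n v : continuous (polyline n v).
Proof.
apply: contD; first exact: cont_cst.
elim: n {2}n => [|p IH] n.
  by under eq_fun do rewrite big_nil; exact: cont_cst.
under eq_fun do rewrite big_nat_recr//=.
apply: contD; first exact: IH.
apply: contZ; last exact: cont_cst.
apply: (cont_comp (f := fun u => n%:R * u - p%:R)); last exact: cont_clamp.
apply: contB; last exact: cont_cst.
by apply: contM; [exact: cont_cst|exact: cont_id].
Qed.

Lemma polyline_at n v m u : (m < n)%N -> m%:R <= n%:R * u <= m.+1%:R ->
  polyline n v u = v m + (n%:R * u - m%:R) *: (v m.+1 - v m).
Proof.
move=> mn; rewrite -natr1 => /andP[lo hi].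
rewrite /polyline (big_cat_nat (n := m)) ?(ltnW mn)//=.
have -> : \sum_(0 <= l < m) clamp (n%:R * u - l%:R) *: (v l.+1 - v l) =
    v m - v 0%N.
  rewrite -telescope_sumr//; apply: eq_big_nat => l /andP[_ lm].
  have : (l.+1%:R : R) <= m%:R by rewrite ler_nat.
  by rewrite -natr1 => lm'; rewrite clamp1 ?scale1r//; lra.
rewrite addrA subrKC big_ltn// clamp_id; last lra.
rewrite big_nat_cond big1 ?addr0// => l /andP[/andP[ml _] _].
have : (m.+1%:R : R) <= l%:R by rewrite ler_nat.
by rewrite -natr1 => lm'; rewrite clamp0 ?scale0r//; lra.
Qed.

Lemma polyline_le0 n v u : u <= 0 -> polyline n v u = v 0%N.
Proof.
move=> u0; rewrite /polyline big1 ?addr0// => l _.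
have n0 : 0 <= n%:R :> R by []; have l0 : 0 <= l%:R :> R by [].
by rewrite clamp0 ?scale0r//; nra.
Qed.

Lemma polyline_ge1 n v u : 1 <= u -> polyline n v u = v n.
Proof.
move=> u1; rewrite /polyline -[RHS](subrKC (v 0%N)) -telescope_sumr//.
congr (_ + _); apply: eq_big_nat => l /andP[_ ln].
have : (l.+1%:R : R) <= n%:R by rewrite ler_nat.
have l0 : 0 <= l%:R :> R by [].
by rewrite -natr1 => lm'; rewrite clamp1 ?scale1r//; nra.
Qed.

Section Closed.
Variables (n : nat) (v : nat -> 'rV[R]_d.+1).
Hypothesis vn : v n = v 0%N.
Local Notation f := (closed_curve n v).

Lemma closed_curve_period : periodic1 f.
Proof.
move=> t; rewrite /closed_curve; congr polyline.
have -> : Num.floor (t + 1) = Num.floor t + 1.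
  by rewrite -[1 in LHS]/(1%:~R) floorDrz ?intr_int// floor1.
by rewrite intrD; lra.
Qed.

(* Near an integer [m] the two branches [F (t - m + 1)] and [F (t - m)] of the
   curve are glued along the constant value [v 0] taken by [F] outside [0, 1]. *)
Lemma closed_curve_local (m : int) t : m%:~R - 1 < t < m%:~R + 1 ->
  f t = polyline n v (t - m%:~R + 1) + polyline n v (t - m%:~R) - v 0%N.
Proof.
move=> tm; rewrite /closed_curve; have [mt|tm'] := lerP m%:~R t.
  have -> : Num.floor t = m by apply/eqP; rewrite floor_eq; rewrite intrD; lra.
  by rewrite (polyline_ge1 n v (u := _ + 1)) ?vn; [rewrite [v 0%N + _]addrC addrK|lra].
have -> : Num.floor t = m - 1.
  by apply/eqP; rewrite floor_eq !intrD mulrNz; lra.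
rewrite (polyline_le0 n v (u := t - m%:~R)); last lra.
by rewrite addrK; congr polyline; rewrite intrD mulrNz; lra.
Qed.

Lemma closed_curve_cont : continuous f.
Proof.
move=> t; pose m := Num.floor t.
pose g s := polyline n v (s - m%:~R + 1) + polyline n v (s - m%:~R) - v 0%N.
have cg : continuous g.
  have c1 : continuous (fun s : R => s - m%:~R).
    by apply: contB; [exact: cont_id|exact: cont_cst].
  apply: contB; last exact: cont_cst.
  apply: contD; last exact: cont_comp c1 (@cont_polyline n v).
  apply: (cont_comp (f := fun s : R => s - m%:~R + 1) (g := polyline n v)); last exact: cont_polyline.
  by apply: contD => //; exact: cont_cst.
have tm : m%:~R - 1 < t < m%:~R + 1.
  by have := floor_le t; have := floorD1_gt t; rewrite -/m intrD; lra.
have fg : \forall s \near t, g s = f s.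
  near=> s; rewrite /g -closed_curve_local//.
  by apply/andP; split; near: s; [apply: lt_nbhsr|apply: lt_nbhsl]; lra.
rewrite /continuous_at -(nbhs_singleton fg).
exact: cvg_trans (near_eq_cvg fg) (cg t).
Unshelve. all: by end_near. Qed.

Lemma closed_curve_at m t : (m < n)%N -> m%:R <= n%:R * t <= m.+1%:R ->
  f t = v m + (n%:R * t - m%:R) *: (v m.+1 - v m).
Proof.
move=> mn tb; have n0 : 0 < n%:R :> R by rewrite ltr0n (leq_ltn_trans _ mn).
have m0 : 0 <= m%:R :> R by [].
have m1 : m.+1%:R <= n%:R :> R by rewrite ler_nat.
have t01 : 0 <= t <= 1 by apply/andP; split; nra.
(* At 1 the floor jumps and the curve is back at [v 0], which is the right end [v n] of the last
   edge. *)
have [t1|t1] := eqVneq t 1.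
  rewrite t1 -{1}[1]add0r closed_curve_period /closed_curve floor0 subr0.
  have E : m.+1 = n.
    apply/eqP; rewrite eqn_leq mn -(ler_nat R); move: tb; rewrite t1 mulr1.
    by case/andP.
  rewrite polyline_le0// -vn -E mulr1 -natr1 addrAC subrr add0r scale1r.
  by rewrite subrKC.
have -> : f t = polyline n v t.
  rewrite /closed_curve (_ : Num.floor t = 0) ?subr0//.
  by apply/eqP; rewrite floor_eq /= add0r lt_neqAle t1.
exact: polyline_at.
Qed.

Lemma closed_curve_polygonal : (0 < n)%N -> polygonal f.
Proof.
move=> n0; split; first exact: closed_curve_period.
have n0' : 0 < n%:R :> R by rewrite ltr0n.
exists n, (fun m => m%:R / n%:R); split; rewrite ?mul0r ?divff ?gt_eqF//.
move=> m mn; split; first by rewrite ler_pM2r ?invr_gt0// ler_nat.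
exists (v m - m%:R *: (v m.+1 - v m)), (n%:R *: (v m.+1 - v m)) => t tb.
rewrite (closed_curve_at mn).
  by apply/rowP => i; rewrite !mxE; ring.
by move: tb; rewrite ler_pdivrMr// ler_pdivlMr// ![t * _]mulrC.
Qed.

Lemma closed_curve_locate t : 0 <= t < 1 -> (0 < n)%N ->
  exists m, [/\ (m < n)%N, m%:R <= n%:R * t & n%:R * t < m.+1%:R].
Proof.
move=> t01 n0; have n0' : 0 < n%:R :> R by rewrite ltr0n.
have nt : 0 <= n%:R * t by nra.
exists (Num.truncn (n%:R * t)).
have /andP[lo hi] := truncn_itv nt; split=> //.
by rewrite -(ltr_nat R); apply: (le_lt_trans lo); nra.
Qed.

End Closed.
End ClosedCurve.

(** * The meander diagram of a coloured family of polygons *)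

Section Diagram.
Context {R : realType} {k : nat}.
Local Notation pt := 'rV[R]_3.
Local Notation edge := (pt * pt)%type.
Local Notation sh := (@proj_plane R).
Implicit Types (e f g : edge) (E F : seq edge).

(** With parallel directions the shadows would share an interval around the crossing, which is
    interior to both, against [cross_unique]. *)
Lemma indep_crossing E e f (s s' : R) : good E -> e \in E -> f \in E -> e <> f ->
    0 < s < 1 -> 0 < s' < 1 ->
    sh e.1 + s *: (sh e.2 - sh e.1) = sh f.1 + s' *: (sh f.2 - sh f.1) ->
  indep (sh e.2 - sh e.1) (sh f.2 - sh f.1).
Proof.
move=> gE eE fE ef s01 s01' P.
set U := sh e.2 - sh e.1 in P *; set W := sh f.2 - sh f.1 in P *.
have U0 : U != 0 by rewrite subr_eq0 eq_sym; apply/eqP/(good_neq gE eE).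
have W0 : W != 0 by rewrite subr_eq0 eq_sym; apply/eqP/(good_neq gE fE).
have key (l : R) : U = l *: W -> False.
  move=> UW; have l1 : 0 < 1 + `|l| by have := normr_ge0 l; lra.
  pose d := Num.min (Num.min s (1 - s)) (Num.min s' (1 - s') / (1 + `|l|)).
  have d0 : 0 < d by rewrite !lt_min divr_gt0 ?lt_min//=; lra.
  have d1 : d <= 1 - s by rewrite !ge_min lexx orbT.
  have dl : d * (1 + `|l|) <= Num.min s' (1 - s').
    by rewrite -ler_pdivlMr// ge_min lexx orbT.
  have dlb : `|d * l| <= Num.min s' (1 - s').
    by rewrite normrM gtr0_norm//; apply: le_trans dl; nra.
  move: dlb; rewrite le_min !ler_norml => /andP[/andP[h1 h2] /andP[h3 h4]].
  have : sh e.1 + s *: U = sh e.1 + (s + d) *: U.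
    apply: (cross_unique gE eE fE ef).
    - by exists s => //; lra.
    - by rewrite P; exists s' => //; lra.
    - by exists (s + d) => //; lra.
    - rewrite scalerDl addrA P UW scalerA -addrA -scalerDl.
      by exists (s' + d * l) => //; lra.
  move=> /addrI/eqP; rewrite -subr_eq0 -scalerBl scaler_eq0 (negPf U0) orbF.
  by move/eqP; lra.
move=> a b H; have a0 : a = 0.
  apply: contrapT => /eqP a0; apply: (key (- (b / a))).
  apply: (scalerI a0); rewrite scalerA mulrN mulrCA divff// mulr1 scaleNr.
  by apply/eqP; rewrite -addr_eq0 H.
split=> //; move/eqP: H; rewrite a0 scale0r add0r scaler_eq0 (negPf W0) orbF.
by move/eqP.
Qed.

Variable S : 'I_k -> seq pt.
Hypothesis pS : polygons S.
Hypothesis bb : forall g g', g \in path_edges S -> g' \in path_edges S ->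
  ~ crosses g g'.

Let n i := size (S i).
(** The first vertex is repeated at the end, so that the closing edge is the edge number
    [(n i).-1]. *)
Let v i (m : nat) : pt := nth 0 (rcons (S i) (head 0 (S i))) m.
Let c : curves R k 3 := fun i => closed_curve (n i) (v i).

Let n3 i : (2 < n i)%N. Proof. exact: pg_size. Qed.
Let n0 i : (0 < n i)%N. Proof. exact: ltn_trans (n3 i). Qed.
Let n0R i : 0 < (n i)%:R :> R. Proof. by rewrite ltr0n. Qed.

Let vn i : v i (n i) = v i 0%N.
Proof.
rewrite /v nth_rcons ltnn eqxx nth_rcons n0.
by case: (S i) (n0 i).
Qed.

Let v_lt i m : (m < n i)%N -> v i m = nth 0 (S i) m.
Proof. by move=> mn; rewrite /v nth_rcons mn. Qed.

Let vS i m : (m < n i)%N -> v i m \in S i.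
Proof. by move=> mn; rewrite v_lt// mem_nth. Qed.

Let v_inj i j m l : (m < n i)%N -> (l < n j)%N -> v i m = v j l -> i = j /\ m = l.
Proof.
move=> mi lj E; have ij : i = j.
  by apply: (pg_disj pS (vS mi)); rewrite E vS.
subst j; split=> //; move: E; rewrite !v_lt// => /eqP.
by rewrite nth_uniq ?pg_uniq// => /eqP.
Qed.

Let edge_path i m : (m.+1 < n i)%N -> (v i m, v i m.+1) \in pe (S i).
Proof.
move=> mn; rewrite !v_lt ?(ltnW mn)//.
have -> : pe (S i) =
    pe (take m (S i) ++ nth 0 (S i) m :: nth 0 (S i) m.+1 :: drop m.+2 (S i)).
  by congr pe; rewrite -!drop_nth ?(ltnW mn)// cat_take_drop.
by rewrite pe_split_eq mem_cat mem_head orbT.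
Qed.

Let edge_closing i : (v i (n i).-1, v i (n i).-1.+1) = closing (S i).
Proof.
rewrite prednK// vn !v_lt// ?prednK// /closing nth_last.
by congr pair; case: (S i).
Qed.

Let edge_in i m : (m < n i)%N -> (v i m, v i m.+1) \in edges S.
Proof.
move=> mn; apply/edges_mem; exists i.
have [E|lt] : m = (n i).-1 \/ (m.+1 < n i)%N.
  move: mn; rewrite -{1}(prednK (n0 i)) ltnS leq_eqVlt => /orP[/eqP->|lt].
    by left.
  by right; rewrite -(prednK (n0 i)) ltnS.
  by right; rewrite E edge_closing.
by left; exact: edge_path.
Qed.

Let ct i t m : (m < n i)%N -> m%:R <= (n i)%:R * t <= m.+1%:R ->
  c i t = v i m + ((n i)%:R * t - m%:R) *: (v i m.+1 - v i m).
Proof. exact: closed_curve_at (vn i) m t. Qed.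

(* The point with parameter [t] of component [i] lies at position [s] on the
   edge number [m]. *)
Let on i t m (s : R) := [/\ (m < n i)%N, (n i)%:R * t = m%:R + s & 0 <= s < 1].

Let onP i t : 0 <= t < 1 -> exists m s, on i t m s.
Proof.
move=> t01; have [m [mn lo hi]] := closed_curve_locate t01 (n0 i).
exists m, ((n i)%:R * t - m%:R); split=> //; first by rewrite addrC subrK.
by move: hi; rewrite -natr1; lra.
Qed.

Let e_ i m : edge := (v i m, v i m.+1).

Let on_c i t m s : on i t m s ->
  c i t = (e_ i m).1 + s *: ((e_ i m).2 - (e_ i m).1).
Proof.
move=> [mn E s01]; rewrite (@ct i t m)//; last by rewrite E -natr1; lra.
by rewrite E [m%:R + s]addrC addrK.
Qed.

Let on_seg i t m s : on i t m s -> seg (e_ i m).1 (e_ i m).2 (c i t).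
Proof. by move=> h; exists s; [case: h; lra|exact: on_c]. Qed.

Let on_esh i t m s : on i t m s -> esh (e_ i m) (sh (c i t)).
Proof. by move=> /on_seg; exact: sh_seg. Qed.

Let e_inj i m j l : (m < n i)%N -> (l < n j)%N -> e_ i m = e_ j l -> i = j /\ m = l.
Proof. by move=> mi lj [E _]; exact: v_inj E. Qed.

Let on_inj i t m s j t' : on i t m s -> on j t' m s -> i = j -> t = t'.
Proof.
move=> [_ E _] [_ E' _] ij; subst j; move: E; rewrite -E'.
by apply: mulfI; rewrite gt_eqF.
Qed.

Let gE := pg_good pS.
Let eE i m : (m < n i)%N -> e_ i m \in edges S. Proof. exact: edge_in. Qed.

(* Since positions satisfy [s < 1], a point that is a vertex is the start of
   its edge, which determines the edge. *)
Let at_vertex i t m s w : on i t m s -> endp w (e_ i m) -> sh (c i t) = sh w ->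
  w = v i m /\ s = 0.
Proof.
move=> h we; have [mn _ s01] := h; rewrite (on_c h) shD shZ shB => E.
have ne := good_neq gE (eE mn).
have key (q : R) : sh w = sh (e_ i m).1 + q *: (sh (e_ i m).2 - sh (e_ i m).1) -> s = q.
  rewrite -E => /addrI/eqP; rewrite -subr_eq0 -scalerBl scaler_eq0 !subr_eq0.
  by move=> /orP[/eqP//|/eqP/esym].
case: we => we; rewrite we in key *.
  by split=> //; apply: key; rewrite scale0r addr0.
have : s = 1 by apply: key; rewrite scale1r subrKC.
by move=> s1; move: s01; rewrite s1 ltxx andbF.
Qed.

(** A single edge has an injective shadow; adjacent edges meet only at their common vertex, which by
    [s < 1] is counted on one of them only; and no vertex projects onto an edge that it does not
    bound. *)
Let meet_data i t m s j t' l s' : on i t m s -> on j t' l s' ->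
    sh (c i t) = sh (c j t') -> (i, t) <> (j, t') ->
  [/\ crosses (e_ i m) (e_ j l), e_ i m <> e_ j l, 0 < s < 1 & 0 < s' < 1].
Proof.
move=> h h' E ne.
have [mn Et s01] := h; have [ln Et' s01'] := h'.
have ee : e_ i m <> e_ j l.
  move=> ee; have [ij ml] := e_inj mn ln ee; subst j l.
  apply: ne; congr pair; apply: (on_inj h); last exact: erefl.
  suff -> : s = s' by [].
  move: E; rewrite (on_c h) (on_c h') !shD !shZ shB => /addrI/eqP.
  rewrite -subr_eq0 -scalerBl scaler_eq0 !subr_eq0 => /orP[/eqP//|/eqP/esym].
  by move/(good_neq gE (eE mn)).
have nsh : ~ shares (e_ i m) (e_ j l).
  move=> [w we wf]; have sw := adjacent_meet gE (eE mn) (eE ln) ee we wf (on_esh h).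
  have {}sw : sh (c i t) = sh w by apply: sw; rewrite E; exact: on_esh h'.
  have [w1 _] := at_vertex h we sw.
  have [w2 _] : w = v j l /\ s' = 0 by apply: (at_vertex h' wf); rewrite -E.
  have [ij ml] := v_inj mn ln (etrans (esym w1) w2).
  by apply: ee; rewrite ij ml.
have pos i' t0 m' s0 f : on i' t0 m' s0 -> f \in edges S -> ~ shares (e_ i' m') f ->
    esh f (sh (c i' t0)) -> 0 < s0.
  move=> h0 fE nshf fc; have [mn0 _ s001] := h0.
  rewrite lt_neqAle; apply/andP; split; last by case/andP: s001.
  apply/eqP => s00; apply: nshf; exists (v i' m'); first by left.
  apply: (good_vertex gE fE (eE mn0)); first by left.
  by move: fc; rewrite (on_c h0) -s00 scale0r addr0.
split=> //.
- split=> //; exists (sh (c i t)); split; first exact: on_esh h.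
  by rewrite E; exact: on_esh h'.
- have := pos _ _ _ _ _ h (eE ln) nsh; rewrite E => /(_ (on_esh h')); lra.
- have := pos _ _ _ _ _ h' (eE mn) (fun X => nsh (shares_sym X)).
  by rewrite -E => /(_ (on_esh h)); lra.
Qed.

Let colours i m j l : (m < n i)%N -> (l < n j)%N -> crosses (e_ i m) (e_ j l) ->
  ((m.+1 < n i)%N /\ l.+1 = n j) \/ (m.+1 = n i /\ (l.+1 < n j)%N).
Proof.
move=> mn ln cr.
have path i' m' : (m'.+1 < n i')%N -> e_ i' m' \in path_edges S.
  by move=> h; apply/gatherP; exists i'; exact: edge_path.
have last i' m' : m'.+1 = n i' -> e_ i' m' = closing (S i').
  by move=> h; rewrite -edge_closing -h.
move: (mn) (ln); rewrite leq_eqVlt => /orP[/eqP m1|m1];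
  rewrite leq_eqVlt => /orP[/eqP l1|l1].
- by case: (pg_closing pS (i := i) (j := j)); rewrite -(last i m)// -(last j l).
- by right.
- by left.
- by case: (bb (path i m m1) (path j l l1)).
Qed.

(** The closing edge occupies the last of the [n i] equal parameter intervals: the arc up to here is
    black, the rest red. *)
Let bound i : R := (n i).-1%:R / (n i)%:R.

Let bound01 i : 0 <= bound i /\ bound i < 1.
Proof.
split; first by rewrite divr_ge0.
by rewrite ltr_pdivrMr// mul1r ltr_nat prednK.
Qed.

Let on_arc_unit (lo hi t : R) : 0 <= lo -> hi <= 1 -> 0 < t < 1 ->
  on_arc lo hi t <-> lo <= t <= hi.
Proof.
move=> lo0 hi1 t01; split=> [[q qb]|tb]; last by exists 0; rewrite addr0.
have [q0|q0|q0] := ltgtP q 0; last by move: qb; rewrite q0 addr0.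
- have : (q%:~R : R) <= (-1)%:~R by rewrite ler_int; lia.
  by rewrite mulrNz; lra.
- have : (1%:~R : R) <= q%:~R by rewrite ler_int; lia.
  by lra.
Qed.

(** A point inside an edge is at neither end of the arcs, so it has exactly one colour although both
    arcs are closed. *)
Let inner i t m s : on i t m s -> 0 < s < 1 -> 0 < t < 1 /\
  (t <= bound i <-> (m.+1 < n i)%N) /\ (bound i <= t <-> m.+1 = n i).
Proof.
move=> [mn E _] s01; have m0 : 0 <= m%:R :> R by [].
have m1 : m.+1%:R <= (n i)%:R :> R by rewrite ler_nat.
have N0 := n0R i; rewrite -natr1 in m1.
have t01 : 0 < t < 1 by apply/andP; split; nra.
have P1 : ((n i).-1%:R : R) = (n i)%:R - 1.
  by rewrite -{2}(prednK (n0 i)) -natr1 addrK.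
have tb : (t <= bound i) = (m.+1 < n i)%N.
  rewrite /bound ler_pdivlMr// mulrC E P1; apply/idP/idP => [h|h].
    have : (m.+1%:R : R) < (n i)%:R + 0%:R by rewrite -natr1 addr0; lra.
    by rewrite addr0 ltr_nat.
  have : (m.+2%:R : R) <= (n i)%:R by rewrite ler_nat.
  by rewrite -!natr1; lra.
split=> //; split; first by rewrite tb.
rewrite /bound ler_pdivrMr// mulrC E P1; split=> h.
  by apply/eqP; rewrite eqn_leq mn -ltnS -(ltr_nat R) -!natr1; lra.
by rewrite -h -natr1; lra.
Qed.

Let D : diagram_data R k := DiagramData (fun i t => sh (c i t))
  (fun x y => height (at_param c y) < height (at_param c x)).

Let onx (x : 'I_k * R) : params x -> exists m s, on x.1 x.2 m s.
Proof. exact: onP. Qed.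

Let crossing_data x y : crossing D x y -> exists m s l s',
  [/\ on x.1 x.2 m s, on y.1 y.2 l s', crosses (e_ x.1 m) (e_ y.1 l),
      e_ x.1 m <> e_ y.1 l & 0 < s < 1 /\ 0 < s' < 1].
Proof.
move=> [px py xy E]; have [m [s h]] := onx px; have [l [s' h']] := onx py.
have [|h1 h2 h3 h4] := meet_data h h' E; last by exists m, s, l, s'.
by move=> E'; apply: xy; case: x y E' {px py E h h'} => [? ?] [? ?].
Qed.

Let black (x : 'I_k * R) := on_arc 0 (bound x.1) x.2.
Let red (x : 'I_k * R) := on_arc (bound x.1) 1 x.2.

Let colour_on (x : 'I_k * R) m s : on x.1 x.2 m s -> 0 < s < 1 ->
  (black x <-> (m.+1 < n x.1)%N) /\ (red x <-> m.+1 = n x.1).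
Proof.
move=> h s01; have [t01 [h1 h2]] := inner h s01; have [b0 b1] := bound01 x.1.
have A1 : black x <-> 0 <= x.2 <= bound x.1 by apply: on_arc_unit => //; lra.
have A2 : red x <-> bound x.1 <= x.2 <= 1 by apply: on_arc_unit => //; lra.
by rewrite A1 A2 -h1 -h2; split; split=> H; lra.
Qed.

Let crossing_colour x y : crossing D x y ->
  [/\ black x, ~ red x, red y & ~ black y] \/
  [/\ red x, ~ black x, black y & ~ red y].
Proof.
move=> /crossing_data[m [s [l [s' [h h' cr ne [s01 s01']]]]]].
have [b1 r1] := colour_on h s01; have [b2 r2] := colour_on h' s01'.
have [mn _ _] := h; have [ln _ _] := h'.
rewrite (propext b1) (propext r1) (propext b2) (propext r2).
case: (colours mn ln cr) => -[h1 h2]; [left|right]; split=> //.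
- by move=> E; move: h1; rewrite E ltnn.
- by rewrite h2 ltnn.
- by rewrite h1 ltnn.
- by move=> E; move: h2; rewrite E ltnn.
Qed.

(** A double point in space would project to a crossing, hence lie on two edges without common
    vertex, which are disjoint. *)
Let c_link : polygonal_link_param c.
Proof.
split; last by move=> i; exact: closed_curve_polygonal.
split.
- by move=> i; exact: closed_curve_cont.
- by move=> i; exact: closed_curve_period.
move=> x y px py E; apply: contrapT => xy.
have cr : crossing D x y by split=> //; rewrite /at_param /= -/(at_param c x) E.
have [m [s [l [s' [h h' [nsh _] _ _]]]]] := crossing_data cr.
have [mn _ _] := h; have [ln _ _] := h'.
apply: (good_disj gE (eE mn) (eE ln) nsh (on_seg h)).
by move: E; rewrite /at_param => ->; exact: on_seg h'.
Qed.

Let c_trace : trace c = trace_of (edges S).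
Proof.
apply/seteqP; split=> [_ [i [t ->]]|z [e /edges_mem[i ei] ze]].
  have u01 := frac_params t; set u := t - _ in u01.
  have -> : c i t = c i u.
    by rewrite /c -(periodic_int u (Num.floor t) (closed_curve_period (n i) (v i))) subrK.
  have [m [s h]] := onP i u01; have [mn _ _] := h.
  by exists (e_ i m); [exact: eE|exact: on_seg h].
have [m mn em] : exists2 m, (m < n i)%N & e = e_ i m.
  case: ei => [/pe_split[l1 [l2 E]]|->].
    have sz : ((size l1).+1 < n i)%N by rewrite /n E size_cat /= addnS ltnS addnS ltnS leq_addr.
    exists (size l1); first exact: ltnW sz.
    rewrite /e_ !v_lt ?(ltnW sz)// E !nth_cat ltnn subnn ltnNge leqnSn /=.
    by rewrite subSnn; case: (e).
  by exists (n i).-1; rewrite ?prednK// /e_ edge_closing.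
move: ze; rewrite em => -[s s01 ->].
exists i, ((m%:R + s) / (n i)%:R).
have E : (n i)%:R * ((m%:R + s) / (n i)%:R) = m%:R + s.
  by rewrite mulrCA divff ?mulr1// gt_eqF.
by rewrite (@ct i _ m)// E -?natr1; [rewrite [m%:R + s]addrC addrK|lra].
Qed.

Let near_edge i t m s : on i t m s -> 0 < s < 1 ->
  \forall h \near (0 : R), sh (c i (t + h)) =
    sh (c i t) + h *: ((n i)%:R *: (sh (v i m.+1) - sh (v i m))).
Proof.
move=> ho s01; have [mn E _] := ho; have N0 := n0R i.
have d0 : 0 < Num.min s (1 - s) / (n i)%:R.
  by rewrite divr_gt0// lt_min; lra.
have dn : \forall h \near (0 : R), `|h| <= Num.min s (1 - s) / (n i)%:R.
  by apply/nbhs_norm0P; exists (Num.min s (1 - s) / (n i)%:R) => // h /= /ltW.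
apply: filterS dn => h; rewrite ler_pdivlMr// => hb.
have : `|h * (n i)%:R| <= Num.min s (1 - s) by rewrite normrM (gtr0_norm N0).
rewrite le_min !ler_norml => /andP[/andP[h1 h2] /andP[h3 h4]].
rewrite (@ct i _ m)//; last by rewrite mulrDr E -natr1; lra.
rewrite (on_c ho) /= mulrDr E !shD !shZ !shB.
by apply/rowP => q; rewrite !mxE; ring.
Qed.

Let D_transverse x y : crossing D x y -> transverse (shadow D) x y.
Proof.
move=> cr; have [m [s [l [s' [h h' _ ne [s01 s01']]]]]] := crossing_data cr.
have [mn _ _] := h; have [ln _ _] := h'.
exists ((n x.1)%:R *: (sh (v x.1 m.+1) - sh (v x.1 m))),
  ((n y.1)%:R *: (sh (v y.1 l.+1) - sh (v y.1 l))); split; last first.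
  apply: filterS2 (near_edge h s01) (near_edge h' s01') => q hx hy.
  by split.
have [_ _ _ E] := cr.
have ind := indep_crossing gE (eE mn) (eE ln) ne s01 s01'.
apply: indep_row_free => a b; rewrite !scalerA => H.
have [] := ind _ _ _ H.
  by move: E; rewrite /at_param /= (on_c h) (on_c h') !shD !shZ !shB.
move=> /eqP; rewrite mulf_eq0 (gt_eqF (n0R _)) orbF => /eqP->.
by move=> /eqP; rewrite mulf_eq0 (gt_eqF (n0R _)) orbF => /eqP->.
Qed.

Let same_edges_same_crossing x y x' y' m s l s' m' q l' q' :
  crossing D x y -> crossing D x' y' ->
  on x.1 x.2 m s -> on y.1 y.2 l s' -> on x'.1 x'.2 m' q -> on y'.1 y'.2 l' q' ->
  e_ x.1 m = e_ x'.1 m' -> e_ y.1 l = e_ y'.1 l' -> (x, y) = (x', y').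
Proof.
move=> cr cr' hx hy hx' hy' ex ey.
have [_ _ xy] := cr; rewrite /at_param /= => E.
have [_ _ _] := cr'; rewrite /at_param /= => E'.
have [mn _ _] := hx; have [ln _ _] := hy; have [mn' _ _] := hx'; have [ln' _ _] := hy'.
have [|_ ne _ _] := meet_data hx hy E.
  by move=> xyE; apply: xy; case: x y xyE {cr cr' hx hy ex ey E mn ln} => [? ?] [? ?].
have [i1 m1] := e_inj mn mn' ex; have [j1 l1] := e_inj ln ln' ey.
have Q : sh (c x.1 x.2) = sh (c x'.1 x'.2).
  apply: (cross_unique gE (eE mn) (eE ln) ne).
  - exact: on_esh hx.
  - by rewrite E; exact: on_esh hy.
  - by rewrite ex; exact: on_esh hx'.
  - by rewrite ey E'; exact: on_esh hy'.
have one z z' m0 s0 m0' s0' : on z.1 z.2 m0 s0 -> on z'.1 z'.2 m0' s0' ->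
    e_ z.1 m0 = e_ z'.1 m0' -> sh (c z.1 z.2) = sh (c z'.1 z'.2) -> z = z'.
  move=> h h' ee EE; apply: contrapT => zz; have [|_ nee _ _] := meet_data h h' EE.
    by move=> X; apply: zz; case: z z' X {h h' ee EE} => [? ?] [? ?].
  exact: nee.
rewrite (one x x' _ _ _ _ hx hx' ex Q).
by rewrite (one y y' _ _ _ _ hy hy' ey) -?E ?Q.
Qed.

Let D_finite : finite_set [set z : ('I_k * R) * ('I_k * R) | crossing D z.1 z.2].
Proof.
pose EE := [seq (e, f) | e <- edges S, f <- edges S].
pose B (q : edge * edge) := [set z : ('I_k * R) * ('I_k * R) |
  crossing D z.1 z.2 /\ exists m s l s', [/\ on z.1.1 z.1.2 m s,
    on z.2.1 z.2.2 l s', e_ z.1.1 m = q.1 & e_ z.2.1 l = q.2]].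
apply: (@sub_finite_set _ _ (\bigcup_(q in [set` EE]) B q)).
  move=> [x y] /= cr.
  have [m [s [l [s' [h h' _ _ _]]]]] := crossing_data cr.
  have [mn _ _] := h; have [ln _ _] := h'.
  exists (e_ x.1 m, e_ y.1 l).
    by apply/allpairsP; exists (e_ x.1 m, e_ y.1 l); rewrite /= !eE.
  by split=> //; exists m, s, l, s'.
apply: bigcup_finite; first exact: finite_seq.
move=> q _; have [[z0 Bz0]|none] := pselect (exists z, B q z); last first.
  rewrite (_ : B q = set0); first exact: finite_set0.
  by apply/seteqP; split=> z // Bz; apply: none; exists z.
apply: (@sub_finite_set _ _ [set z0]); last exact: finite_set1.
move=> [x y] [cr [m [s [l [s' [h1 h2 h3 h4]]]]]].
case: z0 Bz0 => [x0 y0] [cr0 [m0 [q0 [l0 [q0' [g1 g2 g3 g4]]]]]].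
by apply: (same_edges_same_crossing cr cr0 h1 h2 g1 g2); rewrite ?h3 ?h4.
Qed.

Lemma polygons_meander : exists D0 : diagram_data R k,
  meander_diagram D0 /\ represents D0 (trace_of (edges S)).
Proof.
exists D; split; last first.
  by exists c; split=> //; rewrite c_trace; exact: ambient_isotopic_refl.
split.
- split.
  + move=> i; have [p [N [b [b0 bN H]]]] := @closed_curve_polygonal R 2 _ _ (vn i) (n0 i).
    split; first by move=> t; congr (proj_plane _); exact: p.
    exists N, b; split=> // m mN; have [bb' [p0 [w W]]] := H m mN; split=> //.
    exists (sh p0), (sh w) => t tb; rewrite -shZ -shD.
    by congr (sh _); exact: W.
  + exact: D_finite.
  (* The strands of each crossing have opposite colours, which is impossible for three strands
     crossing pairwise. *)
  + move=> x y z xy yz; apply: contrapT => xz.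
    have [px py _ E] := xy; have [_ pz _ E'] := yz.
    have cr : crossing D x z by split=> //; rewrite E.
    have := crossing_colour xy; have := crossing_colour yz; have := crossing_colour cr.
    by move=> [[? ? ? ?]|[? ? ? ?]] [[? ? ? ?]|[? ? ? ?]] [[? ? ? ?]|[? ? ? ?]].
  + exact: D_transverse.
  + move=> x y [px py xy E] /=; rewrite -leNgt le_eqVlt; case: eqP => //= h.
    case: c_link => -[_ _ inj] _; exfalso; apply: xy; apply: inj => //.
    exact: sh_inj_height.
- exists (fun=> 0), bound; split.
  + by move=> i; have := bound01 i; rewrite add0r; lra.
  + move=> i; have [b0 b1] := bound01 i.
    have two s t : 0 <= s < 1 -> 0 <= t < 1 -> s <> t -> sh (c i s) = sh (c i t) ->
        crossing D (i, s) (i, t) by move=> s1 t1 st E; split=> // -[].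
    split=> s t /=; rewrite ?add0r => sb tb E.
    * exists 0; rewrite addr0; apply: contrapT => st.
      have cr : crossing D (i, s) (i, t) by apply: two => //; lra.
      have [m [q [l [q' [h h' crs _ [q01 q01']]]]]] := crossing_data cr.
      have [_ [h1 _]] := inner h q01; have [_ [h2 _]] := inner h' q01'.
      have [mn _ _] := h; have [ln _ _] := h'.
      have m1 : (m.+1 < n i)%N by apply/h1; case/andP: sb.
      have l1 : (l.+1 < n i)%N by apply/h2; case/andP: tb.
      by case: (colours mn ln crs) => -[A B]; move: m1 l1; rewrite ?A ?B ltnn.
    * have c1 : c i 1 = c i 0.
        by rewrite -{1}[1]add0r; exact: (closed_curve_period (n i) (v i) 0).
      have bpos : 0 < bound i.
        by rewrite divr_gt0// ltr0n -ltnS prednK// ltnW.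
      (* The red arc contains the parameter 1, which stands for 0: this is a vertex, hence not on a
         crossing by [inner]. *)
      have at1 u : bound i <= u < 1 -> sh (c i 1) = sh (c i u) -> False.
        rewrite c1 => ub Eu.
        have cr : crossing D (i, 0) (i, u) by apply: two => //; lra.
        have [m [q [l [q' [h _ _ _ [q01 _]]]]]] := crossing_data cr.
        by have [] := inner h q01; rewrite ltxx.
      have [s1|s1] := eqVneq s 1; have [t1|t1] := eqVneq t 1.
      - by exists 0; rewrite addr0 s1 t1.
      - by case: (at1 t); [rewrite lt_neqAle t1; lra|rewrite -s1].
      - by case: (at1 s); [rewrite lt_neqAle s1; lra|rewrite -t1].
      - exists 0; rewrite addr0; apply: contrapT => st.
        have s_lt : s < 1 by rewrite lt_neqAle s1; lra.
        have t_lt : t < 1 by rewrite lt_neqAle t1; lra.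
        have cr : crossing D (i, s) (i, t) by apply: two => //; lra.
        have [m [q [l [q' [h h' crs _ [q01 q01']]]]]] := crossing_data cr.
        have [_ [_ h1]] := inner h q01; have [_ [_ h2]] := inner h' q01'.
        have [mn _ _] := h; have [ln _ _] := h'.
        have m1 : m.+1 = n i by apply/h1; case/andP: sb.
        have l1 : l.+1 = n i by apply/h2; case/andP: tb.
        by case: (colours mn ln crs) => -[A B]; move: A B; rewrite m1 l1 ltnn.
  + by move=> x y /crossing_colour[[? ? ? ?]|[? ? ? ?]]; [left|right];
      rewrite add0r; split.
  + by move=> x y /crossing_colour[[? ? ? ?]|[? ? ? ?]] [].
  + by move=> x y /crossing_colour[[? ? ? ?]|[? ? ? ?]]; rewrite !add0r => -[].
Qed.

End Diagram.

Lemma represents_trans (R : realType) (k : nat) (D : diagram_data R k) L L' :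
  ambient_isotopic L L' -> represents D L' -> represents D L.
Proof.
move=> LL' [c [pc prc ov iso]]; exists c; split=> //.
exact: ambient_isotopic_trans iso.
Qed.

Lemma edges_shear (R : realType) (k : nat) (s : R) (V : 'I_k -> seq 'rV[R]_3) :
    (forall i, V i != [::]) ->
  edges (fun i => map (shear s) (V i)) = map (shear_edge s) (edges V).
Proof.
move=> V0; rewrite /edges /gather map_flatten -[in RHS]map_comp.
congr flatten; apply: eq_map.
move=> i /=; rewrite map_rcons pe_map; congr rcons.
by rewrite /closing; case: (V i) (V0 i) => // x l _; rewrite /= last_map.
Qed.

Theorem theorem1p3 (R : realType) (k : nat) (L : set 'rV[R]_3)
  (hL : tame_link k L) : has_meander_diagram k L.
Proof.
have [_ [c [pc iso0]]] := hL.
have [V [V0 uV dV eV trV]] := curve_polygons pc.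
have [s gV] := shear_good eV.
pose V1 i := map (shear s) (V i).
have EV1 : edges V1 = map (shear_edge s) (edges V) by exact: edges_shear.
have [||||V2 [pV2 trV2]] := @close_all R k V1.
- by move=> i; rewrite -size_eq0 size_map size_eq0.
- by move=> i; rewrite map_inj_uniq//; exact: shear_inj.
- move=> i j _ /mapP[x xi ->] /mapP[y yj] /shear_inj xy.
  by apply: (dV i j x) => //; rewrite xy.
- by rewrite EV1.
have iso1 : ambient_isotopic L (trace_of (edges V2)).
  apply: (ambient_isotopic_trans iso0).
  rewrite trV -trV2 EV1 -shear_trace.
  exact: shear_isotopy (height_slope s).
(* Initially the black path of each component is its first vertex, so there are no black edges. *)
have V2E : cat_fam (fun j => [:: head 0 (V2 j)]) (fun j => behead (V2 j)) = V2.
  apply: functional_extensionality_dep => j.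
  by rewrite /cat_fam; case: (V2 j) (pg_size pV2 j).
have [|||S [pS bb iso2]] := @blacken R k
  (fun j => [:: head 0 (V2 j)]) (fun j => behead (V2 j)).
- by rewrite V2E.
- by [].
- by move=> g g' /gatherP[j].
have [D [mD rD]] := polygons_meander pS bb.
exists D; split=> //.
apply: (represents_trans (ambient_isotopic_trans iso1 _) rD).
by rewrite -{1}V2E.
Qed.
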